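(* For every integer $n\ge 0$ the following congruences hold: \begin{align*} u(3n)&\equiv 0\pmod 3, & u(5n)&\equiv 0\pmod 5, & u(5n+3)&\equiv 0\pmod 5,\\ u(7n)&\equiv 0\pmod 7, & u(7n+5)&\equiv 0\pmod 7, & u(13n)&\equiv 0\pmod{13},\\ v(3n+1)&\equiv 0\pmod 3, & v(5n+1)&\equiv 0\pmod 5, & v(5n+4)&\equiv 0\pmod 5,\\ v(13n+10)&\equiv 0\pmod{13}. &&&& \end{align*}
   Context: A partition of a positive integer $n$ is a non-increasing sequence of positive integers summing to $n$; the empty partition is the unique partition of $0$. A partition quadruple of $n$ is a quadruple $(\pi_1,\pi_2,\pi_3,\pi_4)$ of partitions whose parts altogether sum to $n$. For a partition $\pi$, $s(\pi)$ denotes its smallest part and $\ell(\pi)$ its largest part, with the conventions that the empty partition has smallest part $\infty$ and largest part $0$. Let $u(n)$ be the number of partition quadruples $(\pi_1,\pi_2,\pi_3,\pi_4)$ of $n$ such that $\pi_1$ is non-empty, $s(\pi_1)\le s(\pi_2)$, $s(\pi_1)\le s(\pi_3)$, $s(\pi_1)\le s(\pi_4)$, and $\ell(\pi_4)\le 2s(\pi_1)$. Let $v(n)$ be the number of partition quadruples $(\pi_1,\pi_2,\pi_3,\pi_4)$ of $n$ such that the smallest part of $\pi_1$ appears at least twice in $\pi_1$, $s(\pi_1)\le s(\pi_2)$, $s(\pi_1)\le s(\pi_3)$, $s(\pi_1)\le s(\pi_4)$, and $\ell(\pi_4)\le 2s(\pi_1)$. (Equivalently, with $(z;q)_n=\prod_{j=0}^{n-1}(1-zq^j)$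 and $(z;q)_\infty=\prod_{j\ge0}(1-zq^j)$, $\sum_{n\ge0}u(n)q^n=\sum_{n\ge1}\frac{q^n}{(q^n;q)_\infty^3(q^n;q)_{n+1}}$ and $\sum_{n\ge0}v(n)q^n=\sum_{n\ge1}\frac{q^{2n}}{(q^n;q)_\infty^3(q^n;q)_{n+1}}$.) *)

(* Defs.v *)
From mathcomp Require Import all_boot.

Set Implicit Arguments.
Unset Strict Implicit.
Unset Printing Implicit Defensive.

Definition is_partition (s : seq nat) : bool := sorted geq s && (0 \notin s).

(* [None] stands for the value infinity, and [leqi] is the order of
   nat extended with infinity. *)
Definition leqi (a b : option nat) : bool :=
  match a, b with
  | _, None => true
  | None, Some _ => false
  | Some m, Some n => m <= n
  end.

Definition smallest (s : seq nat) : option nat :=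
  if s is x :: s' then Some (foldr minn x s') else None.

Definition largest (s : seq nat) : nat := foldr maxn 0 s.

Definition quadruple : Type := (seq nat * seq nat * seq nat * seq nat)%type.

Definition is_partition_quadruple (n : nat) (p : quadruple) : bool :=
  let: (p1, p2, p3, p4) := p in
  [&& is_partition p1, is_partition p2, is_partition p3, is_partition p4
    & sumn p1 + sumn p2 + sumn p3 + sumn p4 == n].

Definition parts_condition (p : quadruple) : bool :=
  let: (p1, p2, p3, p4) := p in
  [&& leqi (smallest p1) (smallest p2),
      leqi (smallest p1) (smallest p3),
      leqi (smallest p1) (smallest p4)
    & leqi (Some (largest p4)) (omap (muln 2) (smallest p1))].

Definition u_condition (p : quadruple) : bool :=
  let: (p1, _, _, _) := p in (p1 != [::]) && parts_condition p.

Definition smallest_repeated (s : seq nat) : bool :=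
  if smallest s is Some m then 2 <= count_mem m s else false.

Definition v_condition (p : quadruple) : bool :=
  let: (p1, _, _, _) := p in smallest_repeated p1 && parts_condition p.

(* The components of a partition quadruple of n have at most n parts, each at
   most n, so they all lie in the finite type [n.-bseq 'I_n.+1]; see
   [count_quadruplesP] below. *)
Definition bpart (n : nat) : finType := {bseq n of 'I_n.+1}.

Definition parts (n : nat) (s : bpart n) : seq nat := map val (bseqval s).

Definition bquad (n : nat) : finType :=
  (bpart n * bpart n * bpart n * bpart n)%type.

Definition quad_of (n : nat) (p : bquad n) : quadruple :=
  let: (p1, p2, p3, p4) := p in (parts p1, parts p2, parts p3, parts p4).

Definition count_quadruples (n : nat) (P : pred quadruple) : nat :=
  #|[set p : bquad n | is_partition_quadruple n (quad_of p) && P (quad_of p)]|.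

Definition u (n : nat) : nat := count_quadruples n u_condition.

Definition v (n : nat) : nat := count_quadruples n v_condition.

Lemma parts_inj n : injective (@parts n).
Proof. by move=> s t /(inj_map val_inj) /val_inj. Qed.

Lemma quad_of_inj n : injective (@quad_of n).
Proof.
by move=> [[[a b] c] d] [[[a' b'] c'] d'] [] /parts_inj-> /parts_inj->
  /parts_inj-> /parts_inj->.
Qed.

Lemma size_sumn (s : seq nat) : 0 \notin s -> size s <= sumn s.
Proof.
elim: s => //= x s IHs; rewrite inE negb_or eq_sym => /andP[x0 /IHs le_s].
by rewrite -add1n leq_add // lt0n.
Qed.

Lemma mem_sumn (s : seq nat) x : x \in s -> x <= sumn s.
Proof.
elim: s => //= y s IHs; rewrite inE => /predU1P[->|/IHs le_x].
  exact: leq_addr.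
exact: leq_trans le_x (leq_addl _ _).
Qed.

Lemma parts_surj n (s : seq nat) :
  is_partition s -> sumn s <= n -> exists t : bpart n, parts t = s.
Proof.
move=> /andP[_ s0] le_s.
have sz : size (map (@inord n) s) <= n.
  by rewrite size_map (leq_trans (size_sumn s0)).
exists (Bseq sz); rewrite /parts /= -map_comp.
rewrite -[RHS]map_id; apply/eq_in_map => x xs /=.
by rewrite inordK // ltnS (leq_trans (mem_sumn xs)).
Qed.

Lemma count_quadruplesP (n : nat) (P : pred quadruple) :
  exists e : seq quadruple,
    [/\ uniq e, forall p, (p \in e) = is_partition_quadruple n p && P p
      & size e = count_quadruples n P].
Proof.
pose A := [set p : bquad n |
  is_partition_quadruple n (quad_of p) && P (quad_of p)].
exists (map (@quad_of n) (enum A)); split.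
- by rewrite map_inj_uniq ?enum_uniq //; apply: quad_of_inj.
- move=> p; apply/mapP/idP => [[q]|Hp].
    by rewrite mem_enum inE => Hq ->.
  suff [q Eq] : exists q : bquad n, quad_of q = p.
    by exists q; rewrite // mem_enum inE Eq.
  case: p Hp => [[[a b] c] d] /andP[/and5P[pa pb pc pd /eqP En] _].
  have [a' Ea] : exists t : bpart n, parts t = a.
    by apply: parts_surj => //; rewrite -En -!addnA leq_addr.
  have [b' Eb] : exists t : bpart n, parts t = b.
    by apply: parts_surj => //; rewrite -En [sumn a + _]addnC -!addnA leq_addr.
  have [c' Ec] : exists t : bpart n, parts t = c.
    by apply: parts_surj => //; rewrite -En addnAC leq_addl.
  have [d' Ed] : exists t : bpart n, parts t = d.
    by apply: parts_surj => //; rewrite -En leq_addl.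
  by exists (a', b', c', d'); rewrite /= Ea Eb Ec Ed.
- by rewrite size_map -cardE.
Qed.

(* Main.v *)
(** Write [K = 1/(q)_oo^3], [P = \sum sigma_1(n) q^n], [D = q d/dq], and let [G_k] be
    the sum of [(-1)^(a+1) a^k q^(ab/2)] over [0 < a < b] of opposite parity.
    Bailey's lemma turns the two generating functions into
    [2 U = K (2 D G_1 - G_3 + G_1)] and [U - V = K G_1]; summing the Appell-type
    identities for [\sum_n n (q^n t_(k-n) + t_(k+n)) / (1 - q^n)], with
    [t_r = (-1)^r q^(r(r+1)/2)], against odd powers of [2 k + 1] gives
    [G_3 + 6 D G_1 - G_1 + 24 P G_1 = 6 D P], hence [U = 4 D (G_1 K) - 3 (D P) K].
    Modulo 3 this formula suffices.  Modulo 5, 7 and 13, Ramanujan's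
    differential equations and Fermat's little theorem applied to the theta series
    [\sum_m (-1)^m (2m+1) q^(m(m+1)/2) = 1/K] express [(D P) K] through powers of [D]
    acting on [K] (modulo 5, 7), or show that it is killed by a polynomial in [D]
    (modulo 13).  Modulo 5 and 7, the combination [(1 - 24 P - 24 G_1) K] moreover
    vanishes at the exponents in certain residue classes, which ties the coefficients
    of [G_1 K] to those of [K]. *)

Require Import Defs.
From HB Require Import structures.
From mathcomp Require Import all_boot all_order all_algebra.
From mathcomp Require Import zify ring.

Set Implicit Arguments.
Unset Strict Implicit.
Unset Printing Implicit Defensive.

Import GRing.Theory.
Local Open Scope ring_scope.

(** * Truncated theta series *)

(** With m, r the coefficients of q^n in G_1 K and (D P) K, the formulas read 2 u(n) = 8 n m - 6 r
    and 2 v(n) = (8 n - 2) m - 6 r, which explains the residue classes. For n = 0 (u) and 4 n = 1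
    (v: classes 1, 4, 10 modulo 3, 5, 13) the term in m drops and only the vanishing of 6 r is left.
    The classes u(5n+3), v(5n+1) and u(7n+5) need m itself. Put B = 1 - 24 P - 24 G_1. As D K = 3 P
    K, 24 G_1 K = K - 8 D K - B K, so m is known where B K vanishes. The coefficients of B at N > 0
    are signed sums of b over a b = 2 N. Since this product is fixed modulo p, Fermat exchanges
    powers of a with powers of b.

    Convergence never enters: identities hold in any commutative ring with q^M = 0 and a derivation
    D with D q = q, and the n-th coefficient is read off in k[q]/(q^(n+1)). The Appell identities
    are cancelled by 480 and 14, which is impossible modulo 3, 5 and 7; this forces the passage
    through integer coefficients. *)

Section IntegerSums.
Variable A : zmodType.
Implicit Types f : int -> A.

Definition zsum (B : nat) f : A := \sum_(i < B.*2.+1) f (i%:Z - B%:Z).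

Lemma zsum0 f : zsum 0 f = f 0.
Proof. by rewrite /zsum big_ord_recl big_ord0 addr0. Qed.

Lemma zsumS B f : zsum B.+1 f = zsum B f + f B.+1%:Z + f (- B.+1%:Z).
Proof.
rewrite /zsum doubleS big_ord_recl big_ord_recr [LHS]addrC; congr (_ + _ + _).
- by apply: eq_bigr => i _; congr f; rewrite /= /bump /=; lia.
- by congr f; rewrite /= /bump /=; lia.
- by congr f; rewrite /= sub0r.
Qed.

Lemma eq_zsum B f g : (forall r, f r = g r) -> zsum B f = zsum B g.
Proof. by move=> e; apply: eq_bigr. Qed.

Lemma zsum_add B f g : zsum B (fun r => f r + g r) = zsum B f + zsum B g.
Proof. exact: big_split. Qed.

Lemma zsum_opp B f : zsum B (fun r => - f r) = - zsum B f.
Proof. exact: sumrN. Qed.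

Lemma zsum_exchange B n (F : 'I_n -> int -> A) :
  zsum B (fun r => \sum_(i < n) F i r) = \sum_(i < n) zsum B (F i).
Proof. exact: exchange_big. Qed.

Lemma zsum_pairs B f :
  zsum B f = f 0 + \sum_(r < B) (f r.+1%:Z + f (- r.+1%:Z)).
Proof.
elim: B => [|B IH]; first by rewrite zsum0 big_ord0 addr0.
by rewrite zsumS IH big_ord_recr /= !addrA.
Qed.

Lemma zsum_stable B B' f :
  (forall r, (B < `|r|)%N -> f r = 0) -> (B <= B')%N -> zsum B' f = zsum B f.
Proof.
move=> f0 /subnKC<-; elim: (B' - B)%N => [|d IH]; first by rewrite addn0.
by rewrite addnS zsumS IH !f0 ?addr0 //; lia.
Qed.

Lemma zsum_succ B f :
  zsum B (fun r => f (r + 1)) = zsum B f + f B.+1%:Z - f (- B%:Z).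
Proof.
elim: B => [|B IH]; first by rewrite !zsum0 add0r oppr0 addrAC subrr add0r.
rewrite !zsumS IH.
have -> : B.+1%:Z + 1 = B.+2%:Z :> int by lia.
have -> : - B.+1%:Z + 1 = - B%:Z :> int by lia.
by rewrite addrAC subrK -!addrA; congr (_ + (_ + _)); rewrite addrC subrK.
Qed.

(** The support of radius C stays n away from the edge of the window, so no term leaves it under the
    shift. *)
Lemma zsum_shift B C n f : (forall r, (C < `|r|)%N -> f r = 0) ->
  (C + n <= B)%N -> zsum B (fun r => f (r + n%:Z)) = zsum B f.
Proof.
move=> f0; elim: n => [|n IH] le; first by apply: eq_zsum => r; rewrite addr0.
rewrite -IH; last by lia.
under eq_zsum => r do (have -> : r + n.+1%:Z = r + 1 + n%:Z by lia).
rewrite (zsum_succ B (fun r => f (r + n%:Z))) /= !f0 ?addr0 ?subr0 //; lia.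
Qed.

Lemma zsum_shiftN B C n f : (forall r, (C < `|r|)%N -> f r = 0) ->
  (C + n + n <= B)%N -> zsum B (fun r => f (r - n%:Z)) = zsum B f.
Proof.
move=> f0 le; rewrite -(@zsum_shift B (C + n) n (fun r => f (r - n%:Z))) //.
  by apply: eq_zsum => r; rewrite addrK.
by move=> r hr; apply: f0; lia.
Qed.

(** Pairs k with -1 - k, the involution under which theta terms are odd ([thtN]). The window is not
    symmetric under it, which leaves the top term [f B]. *)
Lemma zsum_half B f :
  zsum B f = \sum_(k < B) (f k%:Z + f (- 1 - k%:Z)) + f B%:Z.
Proof.
elim: B => [|B IH]; first by rewrite zsum0 big_ord0 add0r.
rewrite zsumS IH big_ord_recr /=.
have -> : - B.+1%:Z = -1 - B%:Z :> int by lia.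
by rewrite [LHS]addrAC !addrA.
Qed.

End IntegerSums.

Section ZsumRing.
Variable A : pzRingType.

Lemma zsum_mull B (c : A) f : zsum B (fun r => c * f r) = c * zsum B f.
Proof. by rewrite /zsum mulr_sumr. Qed.

End ZsumRing.

Section NilpotentSeries.
Variables (A : comNzRingType) (q : A) (M : nat).
Hypotheses (qM : q ^+ M = 0).

Lemma qge n : (M <= n)%N -> q ^+ n = 0.
Proof. by move=> /subnKC<-; rewrite exprD qM mul0r. Qed.

Definition geo (n : nat) : A := \sum_(j < M) q ^+ (n * j).

Lemma geoE n : (0 < n)%N -> (1 - q ^+ n) * geo n = 1.
Proof.
move=> n0; rewrite /geo.
under eq_bigr do rewrite exprM.
by rewrite -opprB mulNr -subrX1 -exprM qge ?sub0r ?opprK //; nia.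
Qed.

(** [Negz m] is -1 - m, and r (r + 1) / 2 is invariant under r -> -1 - r, so both constructors carry
    the same binomial. *)
Definition tri (r : int) : nat :=
  match r with Posz m => 'C(m.+1, 2) | Negz m => 'C(m.+1, 2) end.

Lemma triE r : (tri r)%:Z * 2 = r * (r + 1).
Proof.
have H (m : nat) : ('C(m.+1, 2) * 2 = m.+1 * m)%N.
  by rewrite bin2 /= muln2 halfK oddM /= andNb subn0.
by case: r => m /=; have := H m; rewrite ?NegzE; nia.
Qed.

(* [(-1)^r q^(r (r + 1) / 2)] for every integer [r]. *)
Definition tht (r : int) : A :=
  match r with
  | Posz m => (-1) ^+ m * q ^+ tri r
  | Negz m => (-1) ^+ m.+1 * q ^+ tri r
  end.

Lemma thtN r : tht (-1 - r) = - tht r.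
Proof.
case: r => m.
  have -> : -1 - m%:Z = Negz m by rewrite NegzE; lia.
  by rewrite /= exprS mulN1r mulNr.
have -> : -1 - Negz m = m%:Z by rewrite NegzE; lia.
by rewrite /= exprS mulN1r mulNr opprK.
Qed.

Lemma tht_eq0 r : (M < `|r|)%N -> tht r = 0.
Proof.
by move=> hr; have := triE r; case: r hr => m /= hr e;
   rewrite qge ?mulr0 //; move: e; rewrite ?NegzE /=; nia.
Qed.

(** This is t_(j+1) = - q^(j+1) t_j; the spare exponents [a] and [b] allow j + 1 to be negative. *)
Lemma tht_succ (j : int) (a b : nat) : b%:Z = a%:Z + j + 1 ->
  q ^+ a * tht (j + 1) = - (q ^+ b * tht j).
Proof.
move=> e.
have E r : exists s : bool, tht r = (-1) ^+ s * q ^+ tri r /\ (s = odd `|r|).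
  exists (odd `|r|); split=> //; case: r => m /=; first by rewrite signr_odd.
  by rewrite -signr_odd.
have [s [-> es]] := E (j + 1); have [t [-> et]] := E j.
have -> : s = ~~ t by rewrite es et; lia.
have ex : (a + tri (j + 1) = b + tri j)%N.
  have := triE (j + 1); have := triE j; lia.
rewrite signrN !mulNr mulrN mulrCA -exprD ex exprD.
by congr (- _); rewrite mulrCA.
Qed.

End NilpotentSeries.

Arguments tri : simpl never.
Arguments tht : simpl never.

(** * Bailey's lemma and Jacobi's identity *)

Section BaileyPairs.
Variables (A : comNzRingType) (q : A) (M : nat).
Hypotheses (qM : q ^+ M = 0).
Notation qge := (qge qM).
Notation geo := (geo q M).
Notation geoE := (geoE qM).
Notation tht := (tht q).
Notation tht_eq0 := (tht_eq0 qM).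

Definition poch k : A := \prod_(i < k) (1 - q ^+ i.+1).

(* The value [0] at negative indices is the usual convention [1 / (q)_(-n) = 0],
   which truncates the Bailey sums to [|r| <= n]. *)
Definition ipoch (z : int) : A :=
  if z is Posz k then \prod_(i < k) geo i.+1 else 0.

Lemma pochS k : poch k.+1 = poch k * (1 - q ^+ k.+1).
Proof. exact: big_ord_recr. Qed.

Lemma ipochS (k : nat) : ipoch k.+1%:Z = ipoch k%:Z * geo k.+1.
Proof. exact: big_ord_recr. Qed.

Lemma poch0 : poch 0 = 1. Proof. exact: big_ord0. Qed.
Lemma ipoch0 : ipoch 0%:Z = 1. Proof. exact: big_ord0. Qed.

Lemma pochK (k : nat) : poch k * ipoch k%:Z = 1.
Proof.
elim: k => [|k IH]; first by rewrite poch0 ipoch0 mulr1.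
by rewrite pochS ipochS mulrACA IH geoE // mulr1.
Qed.

Lemma ipoch_pred (k : nat) : ipoch (k%:Z - 1) = (1 - q ^+ k) * ipoch k%:Z.
Proof.
case: k => [|k]; first by rewrite expr0 subrr mul0r.
have -> : k.+1%:Z - 1 = k%:Z :> int by lia.
by rewrite ipochS mulrCA geoE // mulr1.
Qed.

Lemma poch_stable k : (M <= k)%N -> poch k = poch M.
Proof.
move=> /subnKC<-; elim: (k - M)%N => [|d IH]; first by rewrite addn0.
by rewrite addnS pochS IH qge ?subr0 ?mulr1 //; lia.
Qed.

Lemma ipoch_stable k : (M <= k)%N -> ipoch k%:Z = ipoch M%:Z.
Proof.
move=> le; rewrite -[LHS]mul1r -(pochK M) -(poch_stable le).
by rewrite mulrC mulrA mulrC [_ * poch k]mulrC pochK mulr1.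
Qed.

Definition bpair (n : nat) (r : int) : A := ipoch (n%:Z - r) * ipoch (n%:Z + r).

Lemma bpairN n r : bpair n (- r) = bpair n r.
Proof. by rewrite /bpair opprK mulrC. Qed.

Lemma bpair_eq0 n r : (n < `|r|)%N -> bpair n r = 0.
Proof.
move=> h; have [h1|h1] : (n%:Z - r < 0) \/ (n%:Z + r < 0) by lia.
  by rewrite /bpair; case: (n%:Z - r) h1 => //= m _; rewrite mul0r.
by rewrite /bpair; case: (n%:Z + r) h1 => //= m _; rewrite mulr0.
Qed.

Lemma bpair_stable n r : (M + M <= n)%N -> (`|r| <= M)%N ->
  bpair n r = ipoch M%:Z ^+ 2.
Proof.
move=> le hr; rewrite /bpair.
have -> : n%:Z - r = (absz (n%:Z - r))%:Z by lia.
have -> : n%:Z + r = (absz (n%:Z + r))%:Z by lia.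
by rewrite !ipoch_stable //; lia.
Qed.

Lemma ipoch_rec (n i j : nat) : (i + j = n.*2.+2)%N ->
  (1 - q ^+ n.*2.+1) * (1 - q ^+ n.*2.+2) * (ipoch i%:Z * ipoch j%:Z) =
  (1 + q ^+ n.*2.+1) * (ipoch (i%:Z - 1) * ipoch (j%:Z - 1))
  + q ^+ i * (ipoch i%:Z * ipoch (j%:Z - 2))
  + q ^+ j * (ipoch (i%:Z - 2) * ipoch j%:Z).
Proof.
have d2 k : ipoch (k.+1%:Z - 2) = (1 - q ^+ k) * ((1 - q ^+ k.+1) * ipoch k.+1%:Z).
  have -> : k.+1%:Z - 2 = k%:Z - 1 :> int by lia.
  rewrite ipoch_pred; congr (_ * _); rewrite -ipoch_pred; congr ipoch; lia.
have i1 : ipoch (0%:Z - 1) = 0 by [].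
have i2 : ipoch (0%:Z - 2) = 0 by [].
case: i => [|i]; first by rewrite add0n => ->; rewrite d2 i1 i2 ipoch0; ring.
case: j => [|j]; first by rewrite addn0 => ->; rewrite d2 i1 i2 ipoch0; ring.
move=> e; have e1 : n.*2 = (i + j)%N by lia.
by rewrite !d2 !ipoch_pred e1 !exprS exprD; ring.
Qed.

(** [ipoch_rec] with i = n + 1 - r and j = n + 1 + r; the powers q^i and q^j, which depend on r, are
    absorbed by the neighbouring theta terms. *)
Lemma bpair_rec n r :
  (1 - q ^+ n.*2.+1) * (1 - q ^+ n.*2.+2) * (tht r * bpair n.+1 r) =
  (1 + q ^+ n.*2.+1) * (tht r * bpair n r)
  - q ^+ n.+1 * (tht (r - 1) * bpair n (r - 1))
  - q ^+ n * (tht (r + 1) * bpair n (r + 1)).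
Proof.
case: (ltnP n.+1 `|r|) => h; first by rewrite !bpair_eq0 ?mulr0 ?subr0 //; lia.
have [i ei] : exists i : nat, n.+1%:Z - r = i%:Z by exists (absz (n.+1%:Z - r)); lia.
have [j ej] : exists j : nat, n.+1%:Z + r = j%:Z by exists (absz (n.+1%:Z + r)); lia.
have := @ipoch_rec n i j; rewrite /bpair ei ej.
have -> : n%:Z - r = i%:Z - 1 by lia.
have -> : n%:Z + r = j%:Z - 1 by lia.
have -> : n%:Z - (r - 1) = i%:Z by lia.
have -> : n%:Z + (r - 1) = j%:Z - 2 by lia.
have -> : n%:Z - (r + 1) = i%:Z - 2 by lia.
have -> : n%:Z + (r + 1) = j%:Z by lia.
move=> H.
rewrite mulrCA [X in _ * X]H; last by lia.
have t1 : q ^+ n.+1 * tht (r - 1) = - (q ^+ i * tht r).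
  have := @tht_succ A q (r - 1) i n.+1; rewrite subrK => ->; last by lia.
  by rewrite opprK.
have t2 : q ^+ n * tht (r + 1) = - (q ^+ j * tht r).
  by apply: tht_succ; lia.
rewrite [q ^+ n.+1 * _]mulrA t1 [q ^+ n * _]mulrA t2; ring.
Qed.

Definition bsum B n (psi : int -> A) := zsum B (fun r => psi r * (tht r * bpair n r)).

Lemma bsum_lin B n (a b c : A) f g h :
  bsum B n (fun r => a * f r + b * g r + c * h r) =
  a * bsum B n f + b * bsum B n g + c * bsum B n h.
Proof.
rewrite /bsum -!zsum_mull -!zsum_add; apply: eq_zsum => r; ring.
Qed.

(** Summation by parts of [bpair_rec]. On polynomials in r the operator acting on psi is triangular
    by degree with eigenvalue (1 - q^n) (1 - q^(n+1)), so the sums for 1, r and r (r - 1) / 2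
    satisfy recurrences that close. *)
Lemma bsum_rec B n psi : (n + 2 <= B)%N ->
  (1 - q ^+ n.*2.+1) * (1 - q ^+ n.*2.+2) * bsum B n.+1 psi =
  bsum B n (fun r => (1 + q ^+ n.*2.+1) * psi r
     - q ^+ n.+1 * psi (r + 1) - q ^+ n * psi (r - 1)).
Proof.
move=> le; rewrite /bsum.
rewrite -zsum_mull.
under eq_zsum => r do rewrite mulrCA bpair_rec !mulrBr.
rewrite zsum_add zsum_add !zsum_opp.
have -> : zsum B (fun r => psi r * (q ^+ n.+1 * (tht (r - 1) * bpair n (r - 1)))) =
   zsum B (fun r => q ^+ n.+1 * psi (r + 1) * (tht r * bpair n r)).
  rewrite -(@zsum_shiftN _ B n 1 (fun r => q ^+ n.+1 * psi (r + 1) * _)).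
  - by apply: eq_zsum => r; rewrite subrK; ring.
  - by move=> r hr; rewrite bpair_eq0 ?mulr0.
  - by lia.
have -> : zsum B (fun r => psi r * (q ^+ n * (tht (r + 1) * bpair n (r + 1)))) =
   zsum B (fun r => q ^+ n * psi (r - 1) * (tht r * bpair n r)).
  rewrite -(@zsum_shift _ B n 1 (fun r => q ^+ n * psi (r - 1) * _)).
  - by apply: eq_zsum => r; rewrite addrK; ring.
  - by move=> r hr; rewrite bpair_eq0 ?mulr0.
  - by lia.
rewrite -!zsum_opp -!zsum_add; apply: eq_zsum => r; ring.
Qed.

Lemma geo_cancel (n : nat) (x y : A) : (0 < n)%N ->
  (1 - q ^+ n) * x = (1 - q ^+ n) * y -> x = y.
Proof.
move=> n0 /(congr1 (fun z => geo n * z)).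
by rewrite !mulrA ![geo n * _]mulrC geoE // !mul1r.
Qed.

Lemma bsum0 B psi : bsum B 0 psi = psi 0.
Proof.
rewrite /bsum (@zsum_stable _ 0) //; last first.
  by move=> r hr; rewrite bpair_eq0 ?mulr0.
rewrite zsum0; have -> : bpair 0 0 = 1 by rewrite -[bpair 0 0]/(ipoch 0%:Z * ipoch 0%:Z) ipoch0 mulr1.
by rewrite /tht /tri /= !expr0 !mulr1.
Qed.

Definition ps1 (r : int) : A := 1.
Definition psr (r : int) : A := r%:~R.
(** r (r - 1) / 2, expressed by [tri] because 2 need not be invertible. *)
Definition pst (r : int) : A := (tri (- r))%:R.

Lemma pst_succ r : pst (r + 1) = pst r + psr r.
Proof.
rewrite /pst /psr; apply/esym/eqP; rewrite -subr_eq0; apply/eqP.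
rewrite !pmulrn -intrD -rmorphB /=.
have -> : (tri (- r))%:Z + r - (tri (- (r + 1)))%:Z = 0; last by [].
by have := triE (- r); have := triE (- (r + 1)); lia.
Qed.

Lemma pst_pred r : pst (r - 1) = pst r - psr r + 1.
Proof.
have := pst_succ (r - 1); rewrite subrK => ->.
by rewrite /psr intrB; ring.
Qed.

Lemma bsumS B n psi x : (n + 2 <= B)%N ->
  bsum B n (fun r => (1 + q ^+ n.*2.+1) * psi r
     - q ^+ n.+1 * psi (r + 1) - q ^+ n * psi (r - 1)) =
  (1 - q ^+ n.*2.+1) * (1 - q ^+ n.*2.+2) * x ->
  bsum B n.+1 psi = x.
Proof.
move=> le; rewrite -bsum_rec // -!mulrA => /geo_cancel e.
by apply: (@geo_cancel n.*2.+2) => //; apply: e.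
Qed.

(** The eigenvalue vanishes at n = 0, which starts the vanishing. *)
Lemma bsum_ps1 B n : (n + 2 <= B)%N -> bsum B n.+1 ps1 = 0.
Proof.
elim: n => [|n IH] le; apply: bsumS => //; rewrite mulr0.
  by rewrite bsum0 /ps1; ring.
rewrite (_ : bsum B _ _ = bsum B n.+1 (fun r =>
    (1 - q ^+ n.+1) * (1 - q ^+ n.+2) * ps1 r + 0 * ps1 r + 0 * ps1 r)).
  by rewrite bsum_lin !mul0r !addr0 IH ?mulr0 //; lia.
by apply: eq_zsum => r; rewrite /ps1 -addnn !exprS exprD !exprS; ring.
Qed.

Lemma bsum_psr B n : (n + 2 <= B)%N ->
  bsum B n.+1 psr = poch n * poch n.+1 * ipoch n.+1.*2%:Z.
Proof.
elim: n => [|n IH] le; apply: bsumS => //.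
  rewrite bsum0 doubleS /psr !ipochS ipoch0 pochS poch0 add0r sub0r intrN /=.
  (* Inserting (1 - q) geo 1 = 1 and (1 - q^2) geo 2 = 1 on the left makes the equation polynomial
     in q and the [geo] terms. *)
  by rewrite -[LHS]mulr1 -[X in _ * X = _](geoE (n := 1)) // -[X in _ * X = _]mulr1 -[X in _ * (_ * X) = _](geoE (n := 2)) //; ring.
rewrite (_ : bsum B _ _ = bsum B n.+1 (fun r =>
    (1 - q ^+ n.+1) * (1 - q ^+ n.+2) * psr r + q ^+ n.+1 * (1 - q) * ps1 r + 0 * ps1 r)).
  rewrite bsum_lin bsum_ps1 ?IH; try lia.
  rewrite 2!pochS [n.+2.*2]doubleS 2!ipochS.
  have e1 := geoE (n := n.+1.*2.+1) isT; have e2 := geoE (n := n.+1.*2.+2) isT.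
  rewrite pochS.
  rewrite -[LHS]mulr1 -[X in _ * X = _]e1 -[X in _ * X = _]mulr1 -[X in _ * (_ * X) = _]e2.
  ring.
apply: eq_zsum => r; rewrite /psr /ps1 intrD intrB -addnn !exprS exprD !exprS.
ring.
Qed.

Lemma bsum_pst B n : (n + 2 <= B)%N ->
  bsum B n.+1 pst = - (poch n ^+ 2 * ipoch n.+1.*2%:Z).
Proof.
elim: n => [|n IH] le; apply: bsumS => //.
  rewrite bsum0 doubleS /pst /tri !ipochS ipoch0 poch0 /=.
  rewrite -[LHS]mulr1 -[X in _ * X = _](geoE (n := 1)) // -[X in _ * X = _]mulr1 -[X in _ * (_ * X) = _](geoE (n := 2)) //.
  rewrite !binS !bin0 !bin1 /=.
  by ring.
rewrite (_ : bsum B _ _ = bsum B n.+1 (fun r =>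
    (1 - q ^+ n.+1) * (1 - q ^+ n.+2) * pst r + q ^+ n.+1 * (1 - q) * psr r
    + (- q ^+ n.+1) * ps1 r)).
  rewrite bsum_lin bsum_ps1 ?IH ?bsum_psr; try lia.
  rewrite pochS [n.+2.*2]doubleS 2!ipochS.
  have e1 := geoE (n := n.+1.*2.+1) isT; have e2 := geoE (n := n.+1.*2.+2) isT.
  rewrite -[LHS]mulr1 -[X in _ * X = _]e1 -[X in _ * X = _]mulr1 -[X in _ * (_ * X) = _]e2.
  rewrite !exprS; ring.
apply: eq_zsum => r; rewrite pst_succ pst_pred /ps1 -addnn !exprS exprD !exprS.
ring.
Qed.

Definition euler : A := poch M.
Definition ieuler : A := ipoch M%:Z.

Lemma eulerK : euler * ieuler = 1.
Proof. exact: pochK. Qed.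

Lemma bsum_stable B n psi : (M + M <= n)%N -> 
  bsum B n psi = ieuler ^+ 2 * zsum B (fun r => psi r * tht r).
Proof.
move=> le; rewrite -zsum_mull; apply: eq_zsum => r.
case: (leqP `|r| M) => hr; last by rewrite tht_eq0 // !(mul0r, mulr0).
by rewrite bpair_stable // mulrA mulrC.
Qed.

Lemma theta_stable B B' (psi : int -> A) : (M <= B)%N -> (M <= B')%N ->
  zsum B (fun r => psi r * tht r) = zsum B' (fun r => psi r * tht r).
Proof.
by move=> h h'; rewrite !(@zsum_stable _ M) // => r hr; rewrite tht_eq0 ?mulr0.
Qed.

Lemma theta_null B : (M <= B)%N -> zsum B tht = 0.
Proof.
move=> le; have := @bsum_ps1 (M + M + 2) (M + M) (leqnn _).
rewrite bsum_stable; last by lia.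
move=> /(congr1 (fun z => euler ^+ 2 * z)); rewrite mulr0 mulrA -exprMn eulerK expr1n mul1r.
rewrite (@theta_stable _ B) //; last by lia.
by move=> <-; apply: eq_zsum => r; rewrite mul1r.
Qed.

(** The limit of [bsum_psr] as n grows: the kernel tends to 1 / (q)_oo^2 and the right side to
    (q)_oo. *)
Theorem jacobi_cube B : (M <= B)%N -> zsum B (fun r => psr r * tht r) = euler ^+ 3.
Proof.
move=> le; have := @bsum_psr (M + M + 2) (M + M) (leqnn _).
rewrite bsum_stable; last by lia.
rewrite (@theta_stable _ B) //; last by lia.
move=> /(congr1 (fun z => euler ^+ 2 * z)); rewrite mulrA -exprMn eulerK expr1n mul1r => ->.
rewrite !poch_stable ?ipoch_stable; try lia.
by rewrite -/euler -/ieuler -[LHS]mulr1 -[RHS]mulr1 -[X in _ = _ * X]eulerK; ring.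
Qed.

(** Bailey's lemma for a = 1 with both parameters tending to 1, as a telescoping finite sum; the
    right side tends to q^r / (1 - q^r)^2. *)
Lemma bailey_partial N r : (0 < r)%N ->
  \sum_(n < N) q ^+ n.+1 * poch n ^+ 2 * bpair n.+1 r%:Z =
  q ^+ r * geo r ^+ 2 * (poch N ^+ 2 * bpair N r%:Z).
Proof.
move=> r0; elim: N => [|N IH].
  by rewrite big_ord0 bpair_eq0 ?mulr0.
rewrite big_ord_recr /= IH pochS.
case: (ltnP N.+1 r) => h; first by rewrite !bpair_eq0 ?(mulr0, addr0) //; lia.
pose i := (N.+1 - r)%N; pose j := (N.+1 + r)%N.
have -> : bpair N r%:Z = (1 - q ^+ i) * (1 - q ^+ j) * bpair N.+1 r%:Z.
  rewrite /bpair.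
  have -> : N%:Z - r%:Z = i%:Z - 1 by lia.
  have -> : N%:Z + r%:Z = j%:Z - 1 by lia.
  have -> : N.+1%:Z - r%:Z = i%:Z by lia.
  have -> : N.+1%:Z + r%:Z = j%:Z by lia.
  by rewrite !ipoch_pred; ring.
have -> : N.+1 = (i + r)%N by lia.
have -> : j = (i + r + r)%N by lia.
rewrite !exprD; move: (q ^+ r) (q ^+ i) (geo r) (geoE r0) => R I g e.
set P := poch N; set b := bpair _ _.
have -> : I * R * P ^+ 2 * b = I * R * P ^+ 2 * b * ((1 - R) * g) ^+ 2.
  by rewrite e expr1n mulr1.
ring.
Qed.

(** The condition psi 0 = 0 removes the row r = 0, where 1 / (1 - q^r) does not exist; the rows r
    and - r merge through q^r t_(-r) = t_r. *)
Lemma bailey_sum psi : psi 0 = 0 ->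
  \sum_(n < M.*2) q ^+ n.+1 * poch n ^+ 2 * bsum (M.*2 + 2) n.+1 psi =
  \sum_(r < M.*2 + 2) geo r.+1 ^+ 2 *
     (q ^+ r.+1 * psi r.+1%:Z + psi (- r.+1%:Z)) * tht r.+1%:Z.
Proof.
move=> psi0.
under eq_bigr => n _ do rewrite /bsum -zsum_mull.
rewrite -zsum_exchange zsum_pairs psi0.
under eq_bigr => n _ do rewrite mul0r mulr0.
rewrite big1 // add0r; apply: eq_bigr => r _.
have t : q ^+ r.+1 * tht (- r.+1%:Z) = tht r.+1%:Z.
  have -> : - r.+1%:Z = -1 - r%:Z by lia.
  have -> : r.+1%:Z = r%:Z + 1 by lia.
  by rewrite thtN mulrN -[RHS]mul1r -[1 in RHS](expr0 q) (@tht_succ A q r%:Z 0 r.+1) //; lia.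
have [m em] : exists m, m = - r.+1%:Z by exists (- r.+1%:Z).
rewrite -em in t *; rewrite -big_split /=.
rewrite (eq_bigr (fun n : 'I__ => q ^+ n.+1 * poch n ^+ 2 * bpair n.+1 r.+1%:Z *
    (psi r.+1%:Z * tht r.+1%:Z + psi m * tht m))); last first.
  by move=> n _; rewrite em bpairN -em; ring.
rewrite -mulr_suml bailey_partial //.
case: (leqP r.+1 M) => hr; last first.
  by rewrite !tht_eq0 ?(mulr0, addr0) //; lia.
rewrite bpair_stable; try lia.
rewrite poch_stable -?exprMn ?pochK; last by lia.
rewrite expr1n mulr1.
transitivity (geo r.+1 ^+ 2 *
  (psi r.+1%:Z * (q ^+ r.+1 * tht r.+1%:Z) + psi m * (q ^+ r.+1 * tht m))).
  by ring.
by rewrite t; ring.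
Qed.

End BaileyPairs.
Arguments ipoch : simpl never.

(** * The derivation and Lambert series *)

Lemma sum_trim (A : zmodType) (m n : nat) (F : nat -> A) : (m <= n)%N ->
  (forall i, (m <= i)%N -> F i = 0) -> \sum_(i < n) F i = \sum_(i < m) F i.
Proof.
move=> /subnKC<- F0; elim: (n - m)%N => [|d IH]; first by rewrite addn0.
by rewrite addnS big_ord_recr /= IH F0 ?addr0 //; lia.
Qed.

Lemma sum_parity (A : zmodType) (n : nat) (F : nat -> A) :
  \sum_(i < n.*2) F i = \sum_(i < n) F i.*2 + \sum_(i < n) F i.*2.+1.
Proof.
elim: n => [|n IH]; first by rewrite !big_ord0 addr0.
by rewrite doubleS !big_ord_recr /= IH -!addrA; congr (_ + _); rewrite addrCA.
Qed.

Section Derivation.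
Variables (A : comNzRingType) (q : A) (M : nat) (D : {additive A -> A}).
Hypotheses (qM : q ^+ M = 0) (DM : forall x y, D (x * y) = D x * y + x * D y)
  (Dq : D q = q).
Notation qge := (qge qM).
Notation geo := (geo q M).
Notation geoE := (geoE qM).
Notation tht := (tht q).
Notation tht_eq0 := (tht_eq0 qM).
Notation poch := (poch q).
Notation ipoch := (ipoch q M).
Notation euler := (euler q M).
Notation ieuler := (ieuler q M).

Lemma D1 : D 1 = 0.
Proof. by have := DM 1 1; rewrite !mulr1 mul1r -{1}[D 1]addr0 => /addrI<-. Qed.

Lemma Dnat n : D n%:R = 0.
Proof. by rewrite raddfMn D1 mul0rn. Qed.

Lemma Dnatl n x : D (n%:R * x) = n%:R * D x.
Proof. by rewrite DM Dnat mul0r add0r. Qed.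

Lemma DX x n : D (x ^+ n) = n%:R * x ^+ n.-1 * D x.
Proof.
elim: n => [|n IH]; first by rewrite expr0 D1 !mul0r.
rewrite exprS DM IH /= mulrS; case: n IH => [|n] _ /=.
  by rewrite expr0; ring.
by rewrite exprS; ring.
Qed.

Lemma DqX n : D (q ^+ n) = n%:R * q ^+ n.
Proof.
rewrite DX Dq -mulrA -exprSr; case: n => [|n] //=.
by rewrite !mul0r.
Qed.

Lemma Dinv x y : x * y = 1 -> D y = - y ^+ 2 * D x.
Proof.
move=> e; have := congr1 D e; rewrite DM D1 => /(congr1 (fun z => y * z)).
rewrite mulr0 mulrDr [y * (x * _)]mulrA [y * x]mulrC e mul1r => /eqP.
by rewrite addrC addr_eq0 => /eqP->; ring.
Qed.

Definition vv n : A := q ^+ n * geo n.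

Lemma geo_vv n : (0 < n)%N -> geo n = 1 + vv n.
Proof. by move=> n0; rewrite -[1](geoE n0) /vv; ring. Qed.

Lemma vv_sum n : vv n = \sum_(j < M) q ^+ (n * j.+1).
Proof. by rewrite /vv mulr_sumr; apply: eq_bigr => j _; rewrite -exprD mulnS. Qed.

Lemma vv_eq0 n : (M <= n)%N -> vv n = 0.
Proof. by move=> h; rewrite /vv qge ?mul0r. Qed.

Lemma Dgeo n : (0 < n)%N -> D (geo n) = n%:R * (q ^+ n * geo n ^+ 2).
Proof. by move=> n0; rewrite (Dinv (geoE n0)) raddfB /= D1 DqX; ring. Qed.

Lemma Dvv n : (0 < n)%N -> D (vv n) = n%:R * (vv n + vv n ^+ 2).
Proof.
move=> n0; rewrite /vv DM DqX Dgeo //.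
by ring.
Qed.

(* The series [\sum_n sigma_k(n) q^n], in Lambert form. *)
Definition sigser k : A := \sum_(n < M) n.+1%:R ^+ k * vv n.+1.

Lemma Deuler : D euler = - (sigser 1 * euler).
Proof.
suff H m : D (poch m) = - ((\sum_(n < m) n.+1%:R ^+ 1 * vv n.+1) * poch m) by exact: H.
elim: m => [|m IH].
  by rewrite poch0 D1 big_ord0 mul0r oppr0.
rewrite pochS DM IH raddfB /= D1 DqX big_ord_recr /= expr1 /vv.
have e := geoE (ltn0Sn m).
rewrite -[X in _ + poch m * X]mulr1 -[X in _ + poch m * (_ * X)]e; ring.
Qed.

Lemma Dieuler : D ieuler = sigser 1 * ieuler.
Proof.
rewrite (Dinv (eulerK qM)) Deuler.
by rewrite -[X in _ = sigser 1 * X]mulr1 -(eulerK qM); ring.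
Qed.

(* The sum of [(-1)^(a+1) phi(a, b) q^(a b / 2)] over [0 < a < b] of opposite
   parity, with [b = a + 2 m + 1]. *)
Definition gp (phi : nat -> nat -> A) : A :=
  \sum_(r < M) - tht r.+1%:Z *
     \sum_(m < M) q ^+ (r.+1 * m) * phi r.+1 (r.+1 + m.*2.+1)%N.

Definition gser k : A := gp (fun a _ => a%:R ^+ k).

Lemma eq_gp phi psi : (forall a b, phi a b = psi a b) -> gp phi = gp psi.
Proof.
move=> e; apply: eq_bigr => r _; congr (_ * _); apply: eq_bigr => m _.
by rewrite e.
Qed.

Lemma gpD phi psi : gp (fun a b => phi a b + psi a b) = gp phi + gp psi.
Proof.
rewrite -big_split; apply: eq_bigr => r _ /=; rewrite -mulrDr -big_split.
by congr (_ * _); apply: eq_bigr => m _; rewrite mulrDr.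
Qed.

Lemma gpZ c phi : gp (fun a b => c * phi a b) = c * gp phi.
Proof.
rewrite mulr_sumr; apply: eq_bigr => r _ /=; rewrite mulrCA [c * _]mulr_sumr.
by congr (_ * _); apply: eq_bigr => m _; rewrite mulrCA.
Qed.

Lemma GE k : gser k = \sum_(r < M) - (r.+1%:R ^+ k * tht r.+1%:Z * geo r.+1).
Proof.
apply: eq_bigr => r _; rewrite -mulr_suml -/(geo _); ring.
Qed.

Lemma Dtht r : D (tht r) = (tri r)%:R * tht r.
Proof.
have H n m : D ((-1) ^+ n * q ^+ m) = m%:R * ((-1) ^+ n * q ^+ m).
  rewrite -signr_odd DM DqX; case: (odd n); rewrite ?expr1 ?expr0 ?raddfN /= D1; ring.
by case: r => m; rewrite /tht H.
Qed.

(** 2 D acts on q^(a b / 2) as multiplication by a b; this later turns mixed monomials in a and b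
    into derivatives. *)
Lemma Dgp (phi : nat -> nat -> A) : (forall a b, D (phi a b) = 0) ->
  2 * D (gp phi) = gp (fun a b => a%:R * b%:R * phi a b).
Proof.
move=> D0; rewrite raddf_sum mulr_sumr; apply: eq_bigr => r _ /=.
rewrite DM raddfN /= Dtht raddf_sum /=.
rewrite (_ : _ + _ = - tht r.+1%:Z * \sum_(m < M)
   ((tri r.+1%:Z)%:R + (r.+1 * m)%:R) * (q ^+ (r.+1 * m) * phi r.+1 (r.+1 + m.*2.+1)%N)); last first.
  rewrite [RHS]mulr_sumr mulr_sumr mulr_sumr -big_split; apply: eq_bigr => m _ /=.
  by rewrite DM DqX D0; ring.
rewrite mulrCA mulr_sumr; congr (_ * _); apply: eq_bigr => m _.
rewrite !mulrA -natrD -natrM.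
have -> : (2 * (tri r.+1%:Z + r.+1 * m) = r.+1 * (r.+1 + m.*2.+1))%N.
  by have := triE r.+1%:Z; nia.
by rewrite natrM; ring.
Qed.

(* Multiplied by [ieuler ^+ 3] this is the generating function of [u] for [e = 1]
   and of [v] for [e = 2]. *)
Definition Fser e : A :=
  \sum_(n < M) q ^+ (e * n.+1) * poch n ^+ 4 * ipoch n.+1.*2%:Z.

Lemma bailey_sum_trim (psi : int -> A) (F : nat -> A) : psi 0 = 0 ->
  (forall n, (n < M)%N -> bsum q M (M.*2 + 2) n.+1 psi = F n) ->
  \sum_(n < M) q ^+ n.+1 * poch n ^+ 2 * F n =
  \sum_(r < M) geo r.+1 ^+ 2 *
     (q ^+ r.+1 * psi r.+1%:Z + psi (- r.+1%:Z)) * tht r.+1%:Z.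
Proof.
move=> psi0 eF; transitivity (\sum_(n < M) q ^+ n.+1 * poch n ^+ 2 * bsum q M (M.*2 + 2) n.+1 psi).
  by apply: eq_bigr => n _; rewrite eF.
rewrite -(@sum_trim _ M M.*2 (fun n => q ^+ n.+1 * poch n ^+ 2 * bsum q M (M.*2 + 2) n.+1 psi)).
- rewrite (bailey_sum qM psi0) (@sum_trim _ M _ (fun r : nat => geo r.+1 ^+ 2 *
     (q ^+ r.+1 * psi r.+1%:Z + psi (- r.+1%:Z)) * tht r.+1%:Z)) //; first by lia.
  by move=> i hi; rewrite tht_eq0 ?mulr0 //; lia.
- by lia.
- by move=> i hi; rewrite qge ?mul0r //; lia.
Qed.

(** The factor 1 - q^n changes one (q)_(n-1) into (q)_n, and (q)_(n-1) (q)_n / (q)_(2n) is the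
    Bailey sum of psi r = r. *)
Lemma Fser_sub : Fser 1 - Fser 2 = gser 1.
Proof.
have H := @bailey_sum_trim (@psr A)
  (fun n => poch n * poch n.+1 * ipoch n.+1.*2%:Z) (erefl _).
rewrite -sumrB GE.
transitivity (\sum_(n < M) q ^+ n.+1 * poch n ^+ 2 * (poch n * poch n.+1 * ipoch n.+1.*2%:Z)).
  apply: eq_bigr => n _; rewrite pochS mul1n mul2n -addnn exprD; ring.
rewrite H; last by move=> n hn; apply: bsum_psr => //; lia.
apply: eq_bigr => r _; rewrite /psr rmorphN /= -pmulrn.
have e := geoE (ltn0Sn r).
transitivity (- (r.+1%:R ^+ 1 * tht r.+1%:Z * (geo r.+1 * ((1 - q ^+ r.+1) * geo r.+1)))).
  by ring.
by rewrite e mulr1.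
Qed.

(** Here psi r = r (r - 1) / 2. The squares of 1 / (1 - q^r) in the Bailey sum come from
    differentiating 1 / (1 - q^r), whence the term in D G_1. *)
Lemma Fser1 : 2 * Fser 1 = 2 * D (gser 1) - gser 3 + gser 1.
Proof.
have H := @bailey_sum_trim (@pst A)
  (fun n => - (poch n ^+ 2 * ipoch n.+1.*2%:Z)) (erefl _).
transitivity (- (2 * \sum_(n < M) q ^+ n.+1 * poch n ^+ 2 * - (poch n ^+ 2 * ipoch n.+1.*2%:Z))).
  rewrite -mulrN -sumrN; congr (_ * _); apply: eq_bigr => n _; rewrite mul1n; ring.
rewrite H; last by move=> n hn; apply: bsum_pst => //; lia.
rewrite !GE raddf_sum /= !mulr_sumr -sumrN -sumrB -big_split; apply: eq_bigr => r _ /=.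
rewrite raddfN /= DM Dgeo // DM Dtht expr1 Dnat /pst opprK.
have t2 : (tri r.+1%:Z)%:R * 2 = r.+1%:R * (r.+1%:R + 1) :> A.
  rewrite natr1 -!natrM; congr (_%:R).
  by have := triE r.+1%:Z; nia.
have t3 : (tri (- r.+1%:Z))%:R * 2 = r.+1%:R * (r.+1%:R - 1) :> A.
  rewrite -{2}[r.+1%:R]natr1 addrK -!natrM; congr (_%:R).
  by have := triE (- r.+1%:Z); nia.
have e := geoE (ltn0Sn r).
transitivity (- (geo r.+1 ^+ 2 * tht r.+1%:Z * (q ^+ r.+1 * ((tri (- r.+1%:Z))%:R * 2) +
  (tri r.+1%:Z)%:R * 2))); first by ring.
rewrite t2 t3.
transitivity (- r.+1%:R * tht r.+1%:Z *
  (r.+1%:R * (r.+1%:R + 1) * (geo r.+1 * ((1 - q ^+ r.+1) * geo r.+1))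
   + 2 * r.+1%:R * q ^+ r.+1 * geo r.+1 ^+ 2
   - r.+1%:R ^+ 2 * (geo r.+1 * ((1 - q ^+ r.+1) * geo r.+1))
   + geo r.+1 * ((1 - q ^+ r.+1) * geo r.+1))); first by ring.
by rewrite e -t2; ring.
Qed.

End Derivation.

(** * Ramanujan's differential equations *)

Lemma sum_offset (A : zmodType) (M k : nat) (h : nat -> A) :
  (forall j, (M <= j)%N -> h j = 0) ->
  \sum_(m < M) h (k + m)%N = \sum_(j < M) (if (k <= j)%N then h j else 0).
Proof.
move=> h0; pose g j := if (k <= j)%N then h j else 0.
rewrite -(@sum_trim _ M (k + M) g); last 2 first.
- by lia.
- by move=> i hi; rewrite /g h0 //; case: ifP.
rewrite big_split_ord /= [X in _ = X + _]big1; last first.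
  by move=> i _; rewrite /g leqNgt ltn_ord.
by rewrite add0r; apply: eq_bigr => m _; rewrite /g leq_addr.
Qed.

Lemma sum_sym (A : comNzRingType) (n : nat) (X : nat -> nat -> A) :
  (forall a c, X a c = X c a) ->
  \sum_(a < n) \sum_(c < n) X a c =
  2 * \sum_(a < n) \sum_(c < n) (if (a < c)%N then X a c else 0)
  + \sum_(a < n) X a a.
Proof.
move=> sX; rewrite mulr_natl mulr2n.
rewrite [X in _ = X + _ + _]exchange_big /= -!big_split /=; apply: eq_bigr => a _.
rewrite (bigD1 a) //= addrC; congr (_ + _).
rewrite -big_split /= [RHS](bigD1 a) //= !ltnn !add0r; apply: eq_bigr => c hc.
case: (ltngtP a c) => h; rewrite ?addr0 ?add0r //.
by case/eqP: hc; apply: val_inj.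
Qed.

Section Convolutions.
Variables (A : comNzRingType) (q : A) (M : nat) (D : {additive A -> A}).
Hypotheses (qM : q ^+ M = 0) (DM : forall x y, D (x * y) = D x * y + x * D y)
  (Dq : D q = q).
Notation qge := (qge qM).
Notation geo := (geo q M).
Notation geoE := (geoE qM).
Notation tht := (tht q).
Notation tht_eq0 := (tht_eq0 qM).
Notation vv := (vv q M).
Notation S := (sigser q M).
Notation gp := (gp q M).

Lemma thtE (n : nat) : tht n%:Z = (-1) ^+ n * q ^+ tri n%:Z.
Proof. by []. Qed.

(** Indexes the pairs by their odd member 2 i + 1 and their even member 2 j + 2; the smaller of the
    two is a, and its parity decides the sign. *)
Lemma gp_parity phi : gp phi = \sum_(i < M) \sum_(j < M) q ^+ (i.*2.+1 * j.+1) *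
  (if (i <= j)%N then phi i.*2.+1 j.*2.+2 else - phi j.*2.+2 i.*2.+1).
Proof.
pose F r := - tht r.+1%:Z * \sum_(m < M) q ^+ (r.+1 * m) * phi r.+1 (r.+1 + m.*2.+1)%N.
transitivity (\sum_(r < M.*2) F r).
  rewrite (@sum_trim _ M) //; first by lia.
  by move=> r hr; rewrite /F tht_eq0 ?oppr0 ?mul0r //; lia.
rewrite sum_parity.
have F1 (i : nat) : F i.*2 = \sum_(j < M)
   (if (i <= j)%N then q ^+ (i.*2.+1 * j.+1) * phi i.*2.+1 j.*2.+2 else 0).
  rewrite -(@sum_offset _ M i (fun j => q ^+ (i.*2.+1 * j.+1) * phi i.*2.+1 j.*2.+2)).
    rewrite /F mulr_sumr; apply: eq_bigr => m _.
    rewrite thtE exprS -signr_odd odd_double expr0 mulr1 mulN1r opprK mulrA -exprD.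
    congr (q ^+ _ * phi _ _); last by lia.
    by have := triE i.*2.+1%:Z; nia.
  by move=> j hj; rewrite qge ?mul0r //; nia.
have F2 (j : nat) : F j.*2.+1 = - \sum_(i < M)
   (if (j < i)%N then q ^+ (i.*2.+1 * j.+1) * phi j.*2.+2 i.*2.+1 else 0).
  rewrite -(@sum_offset _ M j.+1 (fun i => q ^+ (i.*2.+1 * j.+1) * phi j.*2.+2 i.*2.+1)).
    rewrite /F mulNr mulr_sumr; congr (- _); apply: eq_bigr => m _.
    rewrite thtE -signr_odd /= odd_double /= expr0 mul1r mulrA -exprD.
    congr (q ^+ _ * phi _ _); last by lia.
    by have := triE j.*2.+2%:Z; nia.
  by move=> i hi; rewrite qge ?mul0r //; nia.
under eq_bigr do rewrite F1.
under [X in _ + X]eq_bigr do rewrite F2 -sumrN.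
rewrite [X in _ + X]exchange_big /= -big_split; apply: eq_bigr => i _ /=.
rewrite -big_split; apply: eq_bigr => j _ /=.
by case: leqP => h; rewrite ?oppr0 ?addr0 ?add0r ?mulrN.
Qed.

Lemma S_sum k : S k = \sum_(n < M) \sum_(x < M) n.+1%:R ^+ k * q ^+ (n.+1 * x.+1).
Proof. by apply: eq_bigr => n _; rewrite vv_sum mulr_sumr. Qed.

(** With its sign, b^k - a^k is always the even member to the k minus the odd one, so the order of
    the pair disappears. Splitting the Lambert series by the parity of the divisor, and by that of
    the codivisor, then gives the factor 2^k - 1. *)
Lemma gp_powers k :
  gp (fun _ b => b%:R ^+ k) - gp (fun a _ => a%:R ^+ k) = (2 ^+ k - 1) * S k.
Proof.
pose X : A := \sum_(i < M) \sum_(j < M) j.+1%:R ^+ k * q ^+ (i.*2.+1 * j.+1).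
pose O : A := \sum_(i < M) \sum_(j < M) i.*2.+1%:R ^+ k * q ^+ (i.*2.+1 * j.+1).
pose Y : A := \sum_(i < M) \sum_(j < M) j.+1%:R ^+ k * q ^+ (i.*2.+2 * j.+1).
have dbl (j : nat) : j.*2.+2%:R = 2 * j.+1%:R :> A.
  by rewrite -doubleS -muln2 natrM mulrC.
have -> : gp (fun _ b => b%:R ^+ k) - gp (fun a _ => a%:R ^+ k) = 2 ^+ k * X - O.
  rewrite !gp_parity mulr_sumr -!sumrB; apply: eq_bigr => i _.
  rewrite mulr_sumr -!sumrB; apply: eq_bigr => j _.
  by case: leqP => _; rewrite dbl exprMn; ring.
have e1 : S k = X + Y.
  rewrite S_sum exchange_big /=.
  rewrite -(@sum_trim _ M M.*2 (fun x => \sum_(n < M) n.+1%:R ^+ k * q ^+ (n.+1 * x.+1))).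
  - rewrite (sum_parity M (fun x => \sum_(n < M) n.+1%:R ^+ k * q ^+ (n.+1 * x.+1))); congr (_ + _); apply: eq_bigr => i _; apply: eq_bigr => j _;
    by rewrite mulnC.
  - by lia.
  - by move=> i hi; rewrite big1 // => n _; rewrite qge ?mulr0 //; nia.
have e2 : S k = O + 2 ^+ k * Y.
  rewrite S_sum.
  rewrite -(@sum_trim _ M M.*2 (fun n => \sum_(x < M) n.+1%:R ^+ k * q ^+ (n.+1 * x.+1))).
  - rewrite (sum_parity M (fun n => \sum_(x < M) n.+1%:R ^+ k * q ^+ (n.+1 * x.+1))); congr (_ + _).
    rewrite /Y exchange_big mulr_sumr; apply: eq_bigr => i _; rewrite mulr_sumr.
    apply: eq_bigr => j _; rewrite dbl exprMn -mulrA; congr (_ * (_ * q ^+ _)); lia.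
  - by lia.
  - by move=> i hi; rewrite big1 // => n _; rewrite qge ?mulr0 //; nia.
transitivity (2 ^+ k * (X + Y) - (O + 2 ^+ k * Y)); first by ring.
by rewrite -e1 -e2; ring.
Qed.

Lemma vvM a b : (0 < a)%N -> (0 < b)%N ->
  vv a * vv b = vv (a + b) * (1 + vv a + vv b).
Proof.
move=> a0 b0; have ea := geoE a0; have eb := geoE b0.
have eab : (1 - q ^+ (a + b)) * geo (a + b) = 1 by apply: geoE; lia.
rewrite exprD in eab; rewrite /vv exprD.
move: (q ^+ a) (q ^+ b) (geo a) (geo b) (geo (a + b)) ea eb eab => x y g h k ea eb eab.
transitivity (x * g * (y * h) * ((1 - x * y) * k)); first by rewrite eab mulr1.
transitivity (x * y * k * ((1 - x) * g * ((1 - y) * h) + x * g * ((1 - y) * h) + y * h * ((1 - x) * g))).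
  by ring.
by rewrite ea eb; ring.
Qed.

(* Skoruppa's argument: by [vvM] the sum of [h a b v_a v_b] is that of
   [h a b v_(a+b)] plus twice that of [h a (c - a) v_a v_c] over [a < c], and the
   hypothesis on [g] moves the last sum to the left. *)
Lemma convolution (h g : nat -> nat -> A) :
  (forall a b, h a b = h b a) -> (forall a b, g a b = g b a) ->
  (forall a b, h a (a + b)%N - h a b = 2 * g a (a + b)%N) ->
  2 * \sum_(a < M) \sum_(b < M) g a.+1 b.+1 * (vv a.+1 * vv b.+1)
  + \sum_(a < M) (h a.+1 a.+1 - 2 * g a.+1 a.+1) * vv a.+1 ^+ 2 =
  \sum_(n < M) (\sum_(a < n) h a.+1 (n - a)%N) * vv n.+1.
Proof.
move=> sh sg hg.
pose T : A := \sum_(a < M) \sum_(b < M) h a.+1 b.+1 * (vv a.+1 * vv b.+1).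
pose L : A := \sum_(a < M) \sum_(c < M)
   (if (a < c)%N then h a.+1 (c - a)%N * (vv a.+1 * vv c.+1) else 0).
pose N : A := \sum_(n < M) (\sum_(a < n) h a.+1 (n - a)%N) * vv n.+1.
have E1 : T = N + 2 * L.
  have -> : T = \sum_(a < M) \sum_(b < M) h a.+1 b.+1 * vv (a.+1 + b.+1)
     + 2 * \sum_(a < M) \sum_(b < M) h a.+1 b.+1 * vv (a.+1 + b.+1) * vv a.+1.
    rewrite mulr_natl mulr2n [X in _ + (_ + X)]exchange_big /= -!big_split /=.
    apply: eq_bigr => a _; rewrite -!big_split; apply: eq_bigr => b _ /=.
    by rewrite vvM // (sh b.+1) [(b.+1 + _)%N]addnC; ring.
  congr (_ + 2 * _).
    rewrite /N; under [RHS]eq_bigr => n _.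
      rewrite mulr_suml.
      rewrite (big_ord_widen M (fun a => h a.+1 (n - a)%N * vv n.+1)); last exact/ltnW.
      rewrite big_mkcond; over.
    rewrite [RHS]exchange_big; apply: eq_bigr => a _ /=.
    rewrite -(@sum_offset _ M a.+1 (fun n => h a.+1 (n - a)%N * vv n.+1)).
      by apply: eq_bigr => b _; congr (h _ _ * vv _); lia.
    by move=> j hj; rewrite vv_eq0 ?mulr0 //; lia.
  apply: eq_bigr => a _ /=.
  rewrite -(@sum_offset _ M a.+1 (fun n => h a.+1 (n - a)%N * (vv a.+1 * vv n.+1))).
    apply: eq_bigr => b _; rewrite -mulrA [vv _ * vv a.+1]mulrC.
    by congr (h _ _ * (_ * vv _)); lia.
  by move=> j hj; rewrite [vv j.+1](vv_eq0 qM) ?mulr0 //; lia.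
rewrite -/N.
have -> : N = T - 2 * L by rewrite E1; ring.
rewrite /T (@sum_sym _ _ (fun a b => h a.+1 b.+1 * (vv a.+1 * vv b.+1))); last first.
  by move=> a b; rewrite sh [vv a.+1 * _]mulrC.
rewrite (@sum_sym _ _ (fun a b => g a.+1 b.+1 * (vv a.+1 * vv b.+1))); last first.
  by move=> a b; rewrite sg [vv a.+1 * _]mulrC.
pose g' : A := \sum_(a < M) \sum_(c < M)
   (if (a < c)%N then g a.+1 c.+1 * (vv a.+1 * vv c.+1) else 0).
pose h' : A := \sum_(a < M) \sum_(c < M)
   (if (a < c)%N then h a.+1 c.+1 * (vv a.+1 * vv c.+1) else 0).
rewrite -/g' -/h'.
have e : h' - L = 2 * g'.
  rewrite mulr_sumr -sumrB; apply: eq_bigr => a _.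
  rewrite mulr_sumr -sumrB; apply: eq_bigr => c _.
  case: ifP => hac; last by rewrite mulr0 subr0.
  have -> : c.+1 = (a.+1 + (c - a))%N by lia.
  by rewrite -mulrBl hg mulrA.
have -> : \sum_(a < M) (h a.+1 a.+1 - 2 * g a.+1 a.+1) * vv a.+1 ^+ 2 =
  \sum_(a < M) h a.+1 a.+1 * (vv a.+1 * vv a.+1) - 2 * \sum_(a < M) g a.+1 a.+1 * (vv a.+1 * vv a.+1).
  by rewrite mulr_sumr -sumrB; apply: eq_bigr => a _; ring.
have -> : h' = L + 2 * g' by rewrite -e; ring.
ring.
Qed.

Lemma SM i j : S i * S j = \sum_(a < M) \sum_(b < M) a.+1%:R ^+ i * b.+1%:R ^+ j * (vv a.+1 * vv b.+1).
Proof.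
rewrite mulr_suml; apply: eq_bigr => a _; rewrite mulr_sumr; apply: eq_bigr => b _; ring.
Qed.

Lemma DS k : D (S k) = S k.+1 + \sum_(a < M) a.+1%:R ^+ k.+1 * vv a.+1 ^+ 2.
Proof.
rewrite raddf_sum -big_split; apply: eq_bigr => n _ /=.
have -> : D (n.+1%:R ^+ k * vv n.+1) = n.+1%:R ^+ k * D (vv n.+1) by rewrite -natrX (Dnatl DM).
by rewrite (Dvv qM DM Dq) // !exprS; ring.
Qed.

Definition pw (j c : nat) : A := \sum_(a < c) a.+1%:R ^+ j.

Lemma pw_closed (c : nat) : let x := c%:R : A in
  [/\ pw 0 c = x, 2 * pw 1 c = x ^+ 2 + x & 6 * pw 2 c = 2 * x ^+ 3 + 3 * x ^+ 2 + x] /\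
  [/\ 4 * pw 3 c = x ^+ 4 + 2 * x ^+ 3 + x ^+ 2,
      30 * pw 4 c = 6 * x ^+ 5 + 15 * x ^+ 4 + 10 * x ^+ 3 - x,
      12 * pw 5 c = 2 * x ^+ 6 + 6 * x ^+ 5 + 5 * x ^+ 4 - x ^+ 2
    & 42 * pw 6 c = 6 * x ^+ 7 + 21 * x ^+ 6 + 21 * x ^+ 5 - 7 * x ^+ 3 + x].
Proof.
elim: c => [|c IH]; first by rewrite /pw !big_ord0; split; split; ring.
have pS j : pw j c.+1 = pw j c + (1 + c%:R) ^+ j by rewrite /pw big_ord_recr /= mulrS.
case: IH => /= -[h0 h1 h2] [h3 h4 h5 h6].
by split; split; rewrite pS ?mulrDr ?h0 ?h1 ?h2 ?h3 ?h4 ?h5 ?h6 mulrS; ring.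
Qed.

Lemma sum_DS k : \sum_(a < M) a.+1%:R ^+ k.+1 * vv a.+1 ^+ 2 = D (S k) - S k.+1.
Proof. by rewrite DS addrC addKr. Qed.

(** In the three convolutions h is a polynomial in a^2 + a b + b^2 and (a b (a + b))^2, hence h(a, c
    - a) = h(a, - c). So g is the part of h that is odd in its second argument, and only products of
    series S with odd indices arise. *)
Theorem ramanujan1 : 12 * S 1 ^+ 2 = 5 * S 3 - 6 * D (S 1) + S 1.
Proof.
have H := @convolution (fun a b => a%:R ^+ 2 + a%:R * b%:R + b%:R ^+ 2)
  (fun a b => a%:R * b%:R).
have {H} : 2 * S 1 ^+ 2 + (D (S 1) - S 2) = \sum_(n < M)
    (\sum_(a < n) (a.+1%:R ^+ 2 + a.+1%:R * (n - a)%:R + (n - a)%:R ^+ 2)) * vv n.+1.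
  rewrite -H => [|a b|a b|a b]; rewrite ?natrD; try by ring.
  rewrite expr2 SM -sum_DS; congr (2 * _ + _); by apply: eq_bigr => a _; ring.
move/(congr1 (fun z => 6 * z)).
have -> : 6 * (\sum_(n < M) (\sum_(a < n)
      (a.+1%:R ^+ 2 + a.+1%:R * (n - a)%:R + (n - a)%:R ^+ 2)) * vv n.+1) =
   5 * S 3 - 6 * S 2 + S 1.
  rewrite !mulr_sumr -sumrB -big_split; apply: eq_bigr => n _ /=.
  have -> : \sum_(a < n) (a.+1%:R ^+ 2 + a.+1%:R * (n - a)%:R + (n - a)%:R ^+ 2) =
     n.+1%:R ^+ 2 * pw 0 n - n.+1%:R * pw 1 n + pw 2 n.
    rewrite /pw !mulr_sumr -sumrB -big_split; apply: eq_bigr => a _ /=.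
    have -> : (n - a)%:R = n.+1%:R - a.+1%:R :> A by rewrite -natrB ?subSS //; apply: ltnW; rewrite ltnS ltn_ord.
    by ring.
  have [/= [h0 h1 h2] _] := pw_closed n.
  transitivity ((6 * n.+1%:R ^+ 2 * pw 0 n - 3 * n.+1%:R * (2 * pw 1 n) + 6 * pw 2 n) * vv n.+1).
    by ring.
  by rewrite h0 h1 h2 mulrS; ring.
move=> e; transitivity (6 * (2 * S 1 ^+ 2 + (D (S 1) - S 2)) - 6 * D (S 1) + 6 * S 2).
  by ring.
by rewrite e; ring.
Qed.

Theorem ramanujan2 : 240 * (S 1 * S 3) + 30 * D (S 3) = 21 * S 5 + 10 * S 3 - S 1.
Proof.
have H := @convolution (fun a b => (a%:R ^+ 2 + a%:R * b%:R + b%:R ^+ 2) ^+ 2)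
  (fun a b => 2 * (a%:R ^+ 3 * b%:R + a%:R * b%:R ^+ 3)).
have {H} : 8 * (S 1 * S 3) + (D (S 3) - S 4) = \sum_(n < M)
    (\sum_(a < n) (a.+1%:R ^+ 2 + a.+1%:R * (n - a)%:R + (n - a)%:R ^+ 2) ^+ 2) * vv n.+1.
  rewrite -H => [|a b|a b|a b]; rewrite ?natrD; try by ring.
  rewrite -sum_DS; congr (_ + _); last by apply: eq_bigr => a _; ring.
  transitivity (4 * (S 1 * S 3) + 4 * (S 3 * S 1)); first by ring.
  rewrite !SM !mulr_sumr -big_split; apply: eq_bigr => a _ /=.
  by rewrite !mulr_sumr -big_split; apply: eq_bigr => b _ /=; ring.
move/(congr1 (fun z => 30 * z)).
have -> : 30 * (\sum_(n < M) (\sum_(a < n)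
      (a.+1%:R ^+ 2 + a.+1%:R * (n - a)%:R + (n - a)%:R ^+ 2) ^+ 2) * vv n.+1) =
   21 * S 5 - 30 * S 4 + 10 * S 3 - S 1.
  rewrite !mulr_sumr -sumrB -big_split -sumrB; apply: eq_bigr => n _ /=.
  have -> : \sum_(a < n) (a.+1%:R ^+ 2 + a.+1%:R * (n - a)%:R + (n - a)%:R ^+ 2) ^+ 2 =
     n.+1%:R ^+ 4 * pw 0 n - 2 * n.+1%:R ^+ 3 * pw 1 n + 3 * n.+1%:R ^+ 2 * pw 2 n
     - 2 * n.+1%:R * pw 3 n + pw 4 n.
    rewrite /pw !mulr_sumr -sumrB -big_split -sumrB -big_split; apply: eq_bigr => a _ /=.
    have -> : (n - a)%:R = n.+1%:R - a.+1%:R :> A by rewrite -natrB ?subSS //; apply: ltnW; rewrite ltnS ltn_ord.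
    by ring.
  have [/= [h0 h1 h2] [h3 h4 _ _]] := pw_closed n.
  transitivity ((30 * n.+1%:R ^+ 4 * pw 0 n - 30 * n.+1%:R ^+ 3 * (2 * pw 1 n)
     + 15 * n.+1%:R ^+ 2 * (6 * pw 2 n) - 15 * n.+1%:R * (4 * pw 3 n) + 30 * pw 4 n) * vv n.+1).
    by ring.
  by rewrite h0 h1 h2 h3 h4 mulrS; ring.
move=> e; transitivity (30 * (8 * (S 1 * S 3) + (D (S 3) - S 4)) + 30 * S 4).
  by ring.
by rewrite e; ring.
Qed.

Theorem ramanujan3 :
  1008 * (S 1 * S 5) - 4800 * S 3 ^+ 2 + 84 * D (S 5) = 42 * S 5 + 40 * S 3 + 2 * S 1.
Proof.
(* The ratio 14 : -249 cancels the seventh power of n in the inner sum, so that no S 7 appears. The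
   odd part of [w] has the coefficients 14 * 3 = 42 and 14 * 7 - 249 * 2 = -400. *)
pose w (a b : nat) : A := 14 * (a%:R ^+ 2 + a%:R * b%:R + b%:R ^+ 2) ^+ 3
   - 249 * (a%:R * b%:R * (a%:R + b%:R)) ^+ 2.
have H := @convolution w
  (fun a b => 42 * (a%:R ^+ 5 * b%:R + a%:R * b%:R ^+ 5) - 400 * (a%:R ^+ 3 * b%:R ^+ 3)).
have {H} : 168 * (S 1 * S 5) - 800 * S 3 ^+ 2 + 14 * (D (S 5) - S 6) =
   \sum_(n < M) (\sum_(a < n) w a.+1 (n - a)%N) * vv n.+1.
  rewrite -H /w => [|a b|a b|a b]; rewrite ?natrD; try by ring.
  rewrite -sum_DS; congr (_ + _); last by rewrite mulr_sumr; apply: eq_bigr => a _; ring.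
  transitivity (84 * (S 1 * S 5) + 84 * (S 5 * S 1) - 800 * (S 3 * S 3)); first by ring.
  rewrite !SM !mulr_sumr -big_split -sumrB; apply: eq_bigr => a _ /=.
  by rewrite !mulr_sumr -big_split -sumrB; apply: eq_bigr => b _ /=; ring.
move/(congr1 (fun z => 6 * z)).
have -> : 6 * (\sum_(n < M) (\sum_(a < n) w a.+1 (n - a)%N) * vv n.+1) =
   42 * S 5 - 84 * S 6 + 40 * S 3 + 2 * S 1.
  rewrite !mulr_sumr -sumrB -!big_split; apply: eq_bigr => n _ /=.
  have -> : \sum_(a < n) w a.+1 (n - a)%N =
     14 * n.+1%:R ^+ 6 * pw 0 n - 42 * n.+1%:R ^+ 5 * pw 1 n - 165 * n.+1%:R ^+ 4 * pw 2 n
     + 400 * n.+1%:R ^+ 3 * pw 3 n - 165 * n.+1%:R ^+ 2 * pw 4 n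
     - 42 * n.+1%:R * pw 5 n + 14 * pw 6 n.
    rewrite /pw !mulr_sumr -!sumrB -big_split -!sumrB -big_split; apply: eq_bigr => a _ /=.
    rewrite /w; have -> : (n - a)%:R = n.+1%:R - a.+1%:R :> A by rewrite -natrB ?subSS //; apply: ltnW; rewrite ltnS ltn_ord.
    by ring.
  have [/= [h0 h1 h2] [h3 h4 h5 h6]] := pw_closed n.
  transitivity ((84 * n.+1%:R ^+ 6 * pw 0 n - 126 * n.+1%:R ^+ 5 * (2 * pw 1 n)
     - 165 * n.+1%:R ^+ 4 * (6 * pw 2 n) + 600 * n.+1%:R ^+ 3 * (4 * pw 3 n)
     - 33 * n.+1%:R ^+ 2 * (30 * pw 4 n) - 21 * n.+1%:R * (12 * pw 5 n)
     + 2 * (42 * pw 6 n)) * vv n.+1).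
    by ring.
  by rewrite h0 h1 h2 h3 h4 h5 h6 mulrS; ring.
move=> e; transitivity (6 * (168 * (S 1 * S 5) - 800 * S 3 ^+ 2 + 14 * (D (S 5) - S 6)) + 84 * S 6).
  by ring.
by rewrite e; ring.
Qed.

End Convolutions.

(** * Appell sums *)

Section AppellSums.
Variables (A : comNzRingType) (q : A) (M : nat) (D : {additive A -> A}).
Hypotheses (qM : q ^+ M = 0) (DM : forall x y, D (x * y) = D x * y + x * D y)
  (Dq : D q = q).
Notation qge := (qge qM).
Notation geo := (geo q M).
Notation geoE := (geoE qM).
Notation tht := (tht q).
Notation tht_eq0 := (tht_eq0 qM).
Notation vv := (vv q M).
Notation S := (sigser q M).
Notation G := (gser q M).
Notation gp := (gp q M).
Notation euler := (euler q M).

(** The solution of x_(k+1) = q^(k+1) (1 - x_k) with x_0 = 0. Its terms are the pairs (a + 1, 2 k -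
    a) of [gp] with sum 2 k + 1. *)
Definition arow (k : nat) : A :=
  \sum_(a < k) (-1) ^+ a * q ^+ ((a.+1 * (k.*2 - a))./2).

Lemma arowS k : arow k.+1 = q ^+ k.+1 - q ^+ k.+1 * arow k.
Proof.
rewrite /arow big_ord_recl expr0 mul1r [nat_of_ord ord0]/= subn0 mul1n doubleK; congr (_ + _).
rewrite mulr_sumr -sumrN; apply: eq_bigr => a _; rewrite /bump /=.
have -> : ((1 + a).+1 * (k.+1.*2 - (1 + a)) = a.+1 * (k.*2 - a) + k.+1.*2)%N.
  by have := ltn_ord a; nia.
by rewrite halfD odd_double andbF add0n doubleK !exprD expr1; ring.
Qed.

Definition vrow N (k : nat) : A := \sum_(n < N) n.+1%:R * geo n.+1 *
  (q ^+ n.+1 * tht (k%:Z - n.+1%:Z) + tht (k%:Z + n.+1%:Z)).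

(** Adding q^(k+1) times row k to row k + 1 cancels the denominators 1 - q^n and leaves Jacobi's sum
    shifted by k; [theta_null] removes the effect of the shift on the linear weight. *)
Lemma vrowS N k : (M + k <= N)%N ->
  vrow N k.+1 = q ^+ k.+1 * euler ^+ 3 - q ^+ k.+1 * vrow N k.
Proof.
move=> le; apply/eqP; rewrite eq_sym subr_eq eq_sym; apply/eqP.
have J : zsum N (fun m => m%:~R * tht (m + k%:Z)) = euler ^+ 3.
  transitivity (zsum N (fun m => (m - k%:Z)%:~R * tht m)).
    rewrite -(@zsum_shift _ N M k (fun m => (m - k%:Z)%:~R * tht m)) //.
      by apply: eq_zsum => r; rewrite addrK.
    by move=> r hr; rewrite tht_eq0 ?mulr0.
  rewrite -(jacobi_cube qM (B := N)); last by lia.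
  rewrite -[RHS]subr0 -[X in _ = _ - X](mulr0 k%:R) -(theta_null qM (B := N)); last by lia.
  rewrite -zsum_mull -zsum_opp -zsum_add; apply: eq_zsum => r.
  by rewrite /psr intrB -pmulrn mulrBl.
rewrite -J zsum_pairs mul0r add0r mulr_sumr /vrow mulr_sumr -big_split.
apply: eq_bigr => n _ /=.
have e := geoE (ltn0Sn n).
have t1 : q ^+ n.+1 * tht (k.+1%:Z - n.+1%:Z) = - (q ^+ k.+1 * tht (k%:Z - n.+1%:Z)).
  have -> : k.+1%:Z - n.+1%:Z = k%:Z - n.+1%:Z + 1 by lia.
  by apply: tht_succ; lia.
have t2 : tht (k.+1%:Z + n.+1%:Z) = - (q ^+ k.+1 * q ^+ n.+1 * tht (k%:Z + n.+1%:Z)).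
  have -> : k.+1%:Z + n.+1%:Z = k%:Z + n.+1%:Z + 1 by lia.
  rewrite -exprD -[LHS]mul1r -[1 in LHS](expr0 q); apply: tht_succ; lia.
rewrite t1 t2 intrN -pmulrn.
have -> : n.+1%:Z + k%:Z = k%:Z + n.+1%:Z by lia.
have -> : - n.+1%:Z + k%:Z = k%:Z - n.+1%:Z by lia.
transitivity (n.+1%:R * ((1 - q ^+ n.+1) * geo n.+1) * q ^+ k.+1 *
  (tht (k%:Z + n.+1%:Z) - tht (k%:Z - n.+1%:Z))); first by ring.
by rewrite e; ring.
Qed.

Lemma vrow0 N : (M <= N)%N -> vrow N 0 = - (2 * G 1).
Proof.
move=> le; rewrite GE.
have -> : \sum_(r < M) - (r.+1%:R ^+ 1 * tht r.+1%:Z * geo r.+1) =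
   \sum_(r < N) - (r.+1%:R ^+ 1 * tht r.+1%:Z * geo r.+1).
  rewrite (@sum_trim _ M N (fun r : nat => - (r.+1%:R ^+ 1 * tht r.+1%:Z * geo r.+1))) //.
  by move=> i hi; rewrite tht_eq0 ?(mulr0, mul0r, oppr0) //; lia.
rewrite mulr_sumr -sumrN; apply: eq_bigr => n _.
have -> : 0%:Z + n.+1%:Z = n.+1%:Z by lia.
have -> : 0%:Z - n.+1%:Z = -1 - n%:Z by lia.
rewrite thtN.
have := @tht_succ A q n%:Z 0 n.+1; rewrite expr0 mul1r => t.
have -> : n.+1%:Z = n%:Z + 1 by lia.
by rewrite t; [ring|lia].
Qed.

(** [arow] times (q)_oo^3 is a particular solution of the recurrence of [vrowS], t_k solves the
    homogeneous one, and row 0 fixes the coefficient. *)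
Lemma vrowE N k : (M + k <= N)%N ->
  vrow N k = euler ^+ 3 * arow k - 2 * G 1 * tht k%:Z.
Proof.
elim: k => [|k IH] le.
  rewrite vrow0; last by lia.
  by rewrite /arow big_ord0 mulr0 sub0r /tht /tri /= !expr0 !mulr1.
rewrite vrowS; last by lia.
rewrite IH; last by lia.
rewrite arowS.
have := @tht_succ A q k%:Z 0 k.+1; rewrite expr0 mul1r.
have -> : k.+1%:Z = k%:Z + 1 by lia.
by move=> ->; [ring|lia].
Qed.

(** Wide enough for [zsum_shiftN] with support radius M and shift n <= M, and larger than M. *)
Let B := (3 * M + 1)%N.
Hypothesis tf : forall (n : nat) (x : A), n.+1%:R * x = 0 -> x = 0.

Lemma tf_inj (n : nat) (x y : A) : n.+1%:R * x = n.+1%:R * y -> x = y.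
Proof.
by move=> e; apply/eqP; rewrite -subr_eq0; apply/eqP/(@tf n); rewrite mulrBr e subrr.
Qed.

(** * Summation of the Appell rows against an odd function *)

Section Moment.
Variable f : int -> A.
Hypothesis fodd : forall k, f (-1 - k) = - f k.

(** Both f and tht are odd under k -> -1 - k, so each side is half of a sum over all integers, where
    k may be shifted; the factor 2 is then cancelled. *)
Lemma moment_shift n : (n <= M)%N ->
  \sum_(k < B) f k%:Z * (tht (k%:Z - n%:Z) + tht (k%:Z + n%:Z)) =
  \sum_(m < B) (f (m%:Z + n%:Z) + f (m%:Z - n%:Z)) * tht m%:Z.
Proof.
move=> le; apply: (@tf_inj 1).
transitivity (zsum B (fun k => f k * (tht (k - n%:Z) + tht (k + n%:Z)))).
  rewrite zsum_half !tht_eq0 ?addr0 ?mulr0 ?addr0; try (rewrite /B; lia).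
  rewrite mulr_sumr; apply: eq_bigr => k _; rewrite fodd.
  have -> : -1 - k%:Z - n%:Z = -1 - (k%:Z + n%:Z) by lia.
  have -> : -1 - k%:Z + n%:Z = -1 - (k%:Z - n%:Z) by lia.
  by rewrite !thtN; ring.
transitivity (zsum B (fun m => (f (m + n%:Z) + f (m - n%:Z)) * tht m)); last first.
  rewrite zsum_half [tht B%:Z]tht_eq0 ?addr0 ?mulr0 ?addr0; try (rewrite /B; lia).
  rewrite mulr_sumr; apply: eq_bigr => k _.
  have -> : -1 - k%:Z - n%:Z = -1 - (k%:Z + n%:Z) by lia.
  have -> : -1 - k%:Z + n%:Z = -1 - (k%:Z - n%:Z) by lia.
  by rewrite !fodd !thtN; ring.
under eq_zsum => k do rewrite mulrDr.
under [RHS]eq_zsum => k do rewrite mulrDl.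
rewrite !zsum_add; congr (_ + _).
  rewrite -[RHS](@zsum_shiftN _ B M n).
  - by apply: eq_zsum => k; rewrite subrK.
  - by move=> r hr; rewrite tht_eq0 ?mulr0.
  - by rewrite /B; lia.
rewrite -[RHS](@zsum_shift _ B M n).
- by apply: eq_zsum => k; rewrite addrK.
- by move=> r hr; rewrite tht_eq0 ?mulr0.
- by rewrite /B; lia.
Qed.

Lemma moment_tail N : (M + B <= N)%N ->
  \sum_(k < B) f k%:Z * \sum_(n < N) n.+1%:R * tht (k%:Z + n.+1%:Z) =
  \sum_(m < B) (\sum_(k < m) (m - k)%:R * f k%:Z) * tht m%:Z.
Proof.
move=> le.
transitivity (\sum_(k < B) \sum_(j < B)
   (if (k < j)%N then (j - k)%:R * f k%:Z * tht j%:Z else 0)).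
  apply: eq_bigr => k _.
  rewrite -(@sum_trim _ B N (fun j => if (k < j)%N then (j - k)%:R * f k%:Z * tht j%:Z else 0)); last 2 first.
  - by lia.
  - move=> j hj; case: ifP => // _; rewrite tht_eq0 ?mulr0 //; move: hj; rewrite /B; lia.
  rewrite -(@sum_offset _ N k.+1 (fun j => (j - k)%:R * f k%:Z * tht j%:Z)); last first.
    by move=> j hj; rewrite tht_eq0 ?mulr0 //; lia.
  rewrite mulr_sumr; apply: eq_bigr => n _.
  have -> : (k.+1 + n - k = n.+1)%N by lia.
  have -> : (k.+1 + n)%N%:Z = k%:Z + n.+1%:Z by lia.
  by ring.
rewrite exchange_big /=; apply: eq_bigr => m _; rewrite mulr_suml.
rewrite (big_ord_widen B (fun k => (m - k)%:R * f k%:Z * tht m%:Z)); last exact/ltnW.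
by rewrite [RHS]big_mkcond.
Qed.

Lemma moment_arow (phi : nat -> A) : (forall k : nat, f k%:Z = phi k.*2.+1) ->
  \sum_(k < B) f k%:Z * arow k = gp (fun a b => phi (a + b)%N).
Proof.
move=> ff.
pose F a k := f k%:Z * ((-1) ^+ a * q ^+ ((a.+1 * (k.*2 - a))./2)).
transitivity (\sum_(k < B) \sum_(a < B) (if (a < k)%N then F a k else 0)).
  apply: eq_bigr => k _; rewrite mulr_sumr.
  rewrite (big_ord_widen B (fun a => F a k)); last exact/ltnW.
  by rewrite big_mkcond.
rewrite exchange_big /=.
transitivity (\sum_(a < B) - tht a.+1%:Z *
     \sum_(m < M) q ^+ (a.+1 * m) * phi (a.+1 + (a.+1 + m.*2.+1))%N).
  apply: eq_bigr => a _.
  rewrite -(@sum_offset _ B a.+1 (F a)); last first.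
    move=> k hk; rewrite /F qge ?mulr0 //; rewrite geq_half_double.
    have := ltn_ord a; move: hk; rewrite /B; nia.
  rewrite mulr_sumr.
  rewrite -(@sum_trim _ M B (fun m => - tht a.+1%:Z * (q ^+ (a.+1 * m) * phi (a.+1 + (a.+1 + m.*2.+1))%N))).
  - apply: eq_bigr => m _; rewrite /F ff thtE.
    have -> : ((a.+1 * ((a.+1 + m).*2 - a))./2 = tri a.+1%:Z + a.+1 * m)%N.
      have -> : (a.+1 * ((a.+1 + m).*2 - a) = (tri a.+1%:Z + a.+1 * m).*2)%N.
        by have := triE a.+1%:Z; nia.
      by rewrite doubleK.
    have -> : ((a.+1 + m).*2.+1 = a.+1 + (a.+1 + m.*2.+1))%N by lia.
    by rewrite exprD exprS; ring.
  - by rewrite /B; lia.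
  - by move=> m hm; rewrite qge ?(mul0r, mulr0) //; nia.
rewrite (@sum_trim _ M B (fun a : nat => - tht a.+1%:Z *
     \sum_(m < M) q ^+ (a.+1 * m) * phi (a.+1 + (a.+1 + m.*2.+1))%N)) //.
- by rewrite /B; lia.
- by move=> i hi; rewrite tht_eq0 ?oppr0 ?mul0r //; lia.
Qed.

(** The sum of [f k * vrow N k] evaluated in two ways. Writing 1 / (1 - q^n) = 1 + v_n, the parts
    with v_n form a symmetric shift by n, and the 1 leaves the tail with weights m - k. *)
Lemma moment (phi : nat -> A) : (forall k : nat, f k%:Z = phi k.*2.+1) ->
  \sum_(n < M) n.+1%:R * vv n.+1 *
     \sum_(m < B) (f (m%:Z + n.+1%:Z) + f (m%:Z - n.+1%:Z)) * tht m%:Z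
  + \sum_(m < B) (\sum_(k < m) (m - k)%:R * f k%:Z) * tht m%:Z =
  euler ^+ 3 * gp (fun a b => phi (a + b)%N)
  - 2 * G 1 * \sum_(m < B) f m%:Z * tht m%:Z.
Proof.
move=> ff; pose N := (M + B)%N.
transitivity (\sum_(k < B) f k%:Z * vrow N k); last first.
  rewrite -(moment_arow ff) mulr_sumr [X in _ - X]mulr_sumr -sumrB.
  apply: eq_bigr => k _.
  by rewrite vrowE; [ring | rewrite /N; have := ltn_ord k; lia].
rewrite -(@moment_tail N) //.
under eq_bigr => n _ do rewrite -moment_shift // mulr_sumr.
rewrite exchange_big /= -big_split; apply: eq_bigr => k _ /=.
pose h n := n.+1%:R * vv n.+1 * (f k%:Z * (tht (k%:Z - n.+1%:Z) + tht (k%:Z + n.+1%:Z))).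
rewrite -(@sum_trim _ M N h); last 2 first.
- by rewrite /N; lia.
- by move=> i hi; rewrite /h vv_eq0 ?(mulr0, mul0r) //; lia.
rewrite !mulr_sumr -big_split; apply: eq_bigr => n _ /=.
rewrite /h; transitivity (f k%:Z * (n.+1%:R * (vv n.+1 * tht (k%:Z - n.+1%:Z)
  + (1 + vv n.+1) * tht (k%:Z + n.+1%:Z)))); first by ring.
by rewrite -(geo_vv qM) // /vv; ring.
Qed.

End Moment.

(** * Odd moments of the theta series and the resulting Appell identities *)

Definition theta j : A := \sum_(m < B) m.*2.+1%:R ^+ j * tht m%:Z.

Lemma theta1 : theta 1 = euler ^+ 3.
Proof.
rewrite -(jacobi_cube qM (B := B)); last by rewrite /B; lia.
rewrite zsum_half [tht B%:Z]tht_eq0 ?mulr0 ?addr0; last by rewrite /B; lia.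
apply: eq_bigr => m _; rewrite thtN /psr intrB -pmulrn -muln2 -natr1 natrM; ring.
Qed.

(** The heat equation of the theta series: (2 m + 1)^2 = 8 m (m + 1) / 2 + 1. *)
Lemma theta_rec j : theta j.+2 = 8 * D (theta j) + theta j.
Proof.
rewrite raddf_sum mulr_sumr -big_split; apply: eq_bigr => m _ /=.
have -> : D (m.*2.+1%:R ^+ j * tht m%:Z) = m.*2.+1%:R ^+ j * D (tht m%:Z).
  by rewrite -natrX (Dnatl DM).
rewrite (Dtht DM Dq) !exprS.
have e : 8 * (tri m%:Z)%:R + 1 = m.*2.+1%:R ^+ 2 :> A.
  rewrite -natrM natr1 -natrX; congr (_%:R).
  by have := triE m%:Z; nia.
rewrite expr2 in e; rewrite mulrA -e; ring.
Qed.

Lemma oddf j : odd j -> forall k : int, (2 * (-1 - k) + 1)%:~R ^+ j = - (2 * k + 1)%:~R ^+ j :> A.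
Proof.
move=> oj k; have -> : 2 * (-1 - k) + 1 = - (2 * k + 1) :> int by lia.
by rewrite intrN exprNn -signr_odd oj expr1 mulN1r.
Qed.

Lemma moment_power j : odd j ->
  \sum_(n < M) n.+1%:R * vv n.+1 * \sum_(m < B)
     ((m.*2.+1%:R + 2 * n.+1%:R) ^+ j + (m.*2.+1%:R - 2 * n.+1%:R) ^+ j) * tht m%:Z
  + \sum_(m < B) (\sum_(k < m) (m - k)%:R * k.*2.+1%:R ^+ j) * tht m%:Z =
  euler ^+ 3 * gp (fun a b => (a + b)%:R ^+ j) - 2 * G 1 * theta j.
Proof.
move=> oj.
have e (k : nat) : (2 * k%:Z + 1)%:~R ^+ j = k.*2.+1%:R ^+ j :> A.
  by have -> : 2 * k%:Z + 1 = k.*2.+1%:Z by lia.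
rewrite /theta; under [X in _ = _ - _ * X]eq_bigr do rewrite -e.
rewrite -(@moment (fun k => (2 * k + 1)%:~R ^+ j) (oddf oj) (fun n => n%:R ^+ j)) //.
congr (_ + _); last first.
  by apply: eq_bigr => m _; congr (_ * _); apply: eq_bigr => k _; rewrite e.
apply: eq_bigr => n _; congr (_ * _); apply: eq_bigr => m _; congr ((_ ^+ _ + _ ^+ _) * _).
  have -> : 2 * (m%:Z + n.+1%:Z) + 1 = m.*2.+1%:Z + 2%:Z * n.+1%:Z by lia.
  by rewrite intrD intrM.
have -> : 2 * (m%:Z - n.+1%:Z) + 1 = m.*2.+1%:Z - 2%:Z * n.+1%:Z by lia.
by rewrite intrB intrM.
Qed.

Lemma tail3 (m : nat) : let s := m.*2.+1%:R : A in
  240 * \sum_(k < m) (m - k)%:R * k.*2.+1%:R ^+ 3 = 3 * s ^+ 5 - 20 * s ^+ 3 + 17 * s.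
Proof.
pose x := m%:R : A.
(* The increment of the sum in m is the plain sum of odd cubes, so its closed form is carried along
   in the induction. *)
suff [H _] : 240 * \sum_(k < m) (m - k)%:R * k.*2.+1%:R ^+ 3 =
    3 * (2 * x + 1) ^+ 5 - 20 * (2 * x + 1) ^+ 3 + 17 * (2 * x + 1) /\
    \sum_(k < m) k.*2.+1%:R ^+ 3 = x ^+ 2 * (2 * x ^+ 2 - 1).
  by rewrite /= (_ : m.*2.+1%:R = 2 * x + 1) // -natr1 -mul2n natrM.
rewrite {}/x; elim: m => [|m [IH1 IH2]]; first by rewrite !big_ord0; split; ring.
have e : m.*2.+1%:R = 2 * m%:R + 1 :> A by rewrite -natr1 -mul2n natrM.
have E2 : \sum_(k < m.+1) k.*2.+1%:R ^+ 3 = (m%:R + 1) ^+ 2 * (2 * (m%:R + 1) ^+ 2 - 1) :> A.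
  by rewrite big_ord_recr /= IH2 e; ring.
split; last by rewrite E2 -[m.+1%:R]natr1.
have -> : \sum_(k < m.+1) (m.+1 - k)%:R * k.*2.+1%:R ^+ 3 =
   \sum_(k < m) (m - k)%:R * k.*2.+1%:R ^+ 3 + \sum_(k < m.+1) k.*2.+1%:R ^+ 3 :> A.
  rewrite !big_ord_recr /= subSnn addrA -big_split mul1r; congr (_ + _).
  by apply: eq_bigr => k _; rewrite subSn 1?ltnW // -[(m - k).+1%:R]natr1 mulrDl mul1r.
by rewrite mulrDr IH1 E2 -[m.+1%:R]natr1; ring.
Qed.

Lemma tail5 (m : nat) : let s := m.*2.+1%:R : A in
  168 * \sum_(k < m) (m - k)%:R * k.*2.+1%:R ^+ 5 =
  s ^+ 7 - 14 * s ^+ 5 + 56 * s ^+ 3 - 43 * s.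
Proof.
pose x := m%:R : A.
suff [H _] : 168 * \sum_(k < m) (m - k)%:R * k.*2.+1%:R ^+ 5 =
    (2 * x + 1) ^+ 7 - 14 * (2 * x + 1) ^+ 5 + 56 * (2 * x + 1) ^+ 3 - 43 * (2 * x + 1) /\
    3 * \sum_(k < m) k.*2.+1%:R ^+ 5 = x ^+ 2 * (16 * x ^+ 4 - 20 * x ^+ 2 + 7).
  by rewrite /= (_ : m.*2.+1%:R = 2 * x + 1) // -natr1 -mul2n natrM.
rewrite {}/x; elim: m => [|m [IH1 IH2]]; first by rewrite !big_ord0; split; ring.
have e : m.*2.+1%:R = 2 * m%:R + 1 :> A by rewrite -natr1 -mul2n natrM.
have E2 : 3 * \sum_(k < m.+1) k.*2.+1%:R ^+ 5 =
   (m%:R + 1) ^+ 2 * (16 * (m%:R + 1) ^+ 4 - 20 * (m%:R + 1) ^+ 2 + 7) :> A.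
  by rewrite big_ord_recr /= mulrDr IH2 e; ring.
split; last by rewrite E2 -[m.+1%:R]natr1.
have -> : \sum_(k < m.+1) (m.+1 - k)%:R * k.*2.+1%:R ^+ 5 =
   \sum_(k < m) (m - k)%:R * k.*2.+1%:R ^+ 5 + \sum_(k < m.+1) k.*2.+1%:R ^+ 5 :> A.
  rewrite !big_ord_recr /= subSnn addrA -big_split mul1r; congr (_ + _).
  by apply: eq_bigr => k _; rewrite subSn 1?ltnW // -[(m - k).+1%:R]natr1 mulrDl mul1r.
transitivity (168 * (\sum_(k < m) (m - k)%:R * k.*2.+1%:R ^+ 5 : A)
  + 56 * (3 * \sum_(k < m.+1) k.*2.+1%:R ^+ 5)).
  by rewrite mulrDr; congr (_ + _); rewrite mulrA -natrM.
by rewrite IH1 E2 -[m.+1%:R]natr1; ring.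
Qed.

Lemma Dtheta1 : D (theta 1) = - (3 * S 1 * theta 1).
Proof. by rewrite theta1 (DX DM) (Deuler qM DM Dq) /=; ring. Qed.

(** [theta 1] has logarithmic derivative - 3 S 1, so each use of [theta_rec] multiplies it by a
    polynomial in E_2 = 1 - 24 S 1 and its derivatives. *)
Lemma theta3 : theta 3 = (1 - 24 * S 1) * theta 1.
Proof. by rewrite theta_rec Dtheta1; ring. Qed.

Lemma theta5 : theta 5 = ((1 - 24 * S 1) ^+ 2 - 192 * D (S 1)) * theta 1.
Proof.
rewrite theta_rec theta3 DM Dtheta1 raddfB /= (D1 DM) (Dnatl DM); ring.
Qed.

Lemma theta7 : theta 7 = (- (8 * (48 * (1 - 24 * S 1) * D (S 1) + 192 * D (D (S 1))))
  + ((1 - 24 * S 1) ^+ 2 - 192 * D (S 1)) * (1 - 24 * S 1)) * theta 1.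
Proof.
rewrite theta_rec theta5 DM Dtheta1 raddfB /= (DX DM) raddfB /= (D1 DM) !(Dnatl DM) /=; ring.
Qed.

Lemma theta1_cancel x y : x * theta 1 = y * theta 1 -> x = y.
Proof.
have e : theta 1 * ieuler q M ^+ 3 = 1 by rewrite theta1 -exprMn (eulerK qM) expr1n.
by move=> exy; rewrite -[x]mulr1 -[y]mulr1 -e !mulrA exy.
Qed.

Lemma gpb k : gp (fun _ b => b%:R ^+ k) = G k + (2 ^+ k - 1) * S k.
Proof. by rewrite -(gp_powers qM) addrC subrK. Qed.

Lemma gp_sum k : gp (fun a b => a%:R ^+ k + b%:R ^+ k) = 2 * G k + (2 ^+ k - 1) * S k.
Proof. by rewrite gpD gpb /gser; ring. Qed.

Lemma Dpow_sum (k a b : nat) : D (a%:R ^+ k + b%:R ^+ k) = 0.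
Proof. by rewrite -!natrX raddfD /= !(Dnat DM) addr0. Qed.

Lemma gp_cube : gp (fun a b => (a + b)%:R ^+ 3) =
  2 * G 3 + 7 * S 3 + 6 * D (2 * G 1 + S 1).
Proof.
have H : gp (fun a b => a%:R * b%:R * (a%:R ^+ 1 + b%:R ^+ 1)) = 2 * D (2 * G 1 + S 1).
  by rewrite -(Dgp M DM Dq) ?gp_sum => [|a b]; [do 2 congr (_ _); ring | exact: Dpow_sum].
rewrite (_ : gp _ = gp (fun a b => (a%:R ^+ 3 + b%:R ^+ 3) +
    3 * (a%:R * b%:R * (a%:R ^+ 1 + b%:R ^+ 1)))); last first.
  by apply: eq_gp => a b; rewrite natrD; ring.
by rewrite gpD gpZ H gp_sum; ring.
Qed.

Lemma gp_fifth : gp (fun a b => (a + b)%:R ^+ 5) =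
  2 * G 5 + 31 * S 5 + 10 * D (2 * G 3 + 7 * S 3) + 40 * D (D (2 * G 1 + S 1)).
Proof.
have H1 : gp (fun a b => a%:R * b%:R * (a%:R ^+ 1 + b%:R ^+ 1)) = 2 * D (2 * G 1 + S 1).
  by rewrite -(Dgp M DM Dq) ?gp_sum => [|a b]; [do 2 congr (_ _); ring | exact: Dpow_sum].
have H2 : gp (fun a b => a%:R * b%:R * (a%:R * b%:R * (a%:R ^+ 1 + b%:R ^+ 1))) =
   4 * D (D (2 * G 1 + S 1)).
  rewrite -(Dgp M DM Dq) ?H1 => [|a b]; first by rewrite (Dnatl DM); ring.
  by rewrite DM -natrM (Dnat DM) Dpow_sum mul0r mulr0 addr0.
have H3 : gp (fun a b => a%:R * b%:R * (a%:R ^+ 3 + b%:R ^+ 3)) = 2 * D (2 * G 3 + 7 * S 3).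
  by rewrite -(Dgp M DM Dq) ?gp_sum => [|a b]; [do 2 congr (_ _); ring | exact: Dpow_sum].
rewrite (_ : gp _ = gp (fun a b => (a%:R ^+ 5 + b%:R ^+ 5) +
    (5 * (a%:R * b%:R * (a%:R ^+ 3 + b%:R ^+ 3)) +
     10 * (a%:R * b%:R * (a%:R * b%:R * (a%:R ^+ 1 + b%:R ^+ 1)))))); last first.
  by apply: eq_gp => a b; rewrite natrD; ring.
by rewrite gpD [X in _ + X]gpD !gpZ H2 H3 gp_sum; ring.
Qed.

Theorem appell3 : G 3 + 6 * D (G 1) - G 1 + 24 * (G 1 * S 1) = 6 * D (S 1).
Proof.
have H := @moment_power 3 isT.
have e1 : \sum_(n < M) n.+1%:R * vv n.+1 * \sum_(m < B)
     ((m.*2.+1%:R + 2 * n.+1%:R) ^+ 3 + (m.*2.+1%:R - 2 * n.+1%:R) ^+ 3) * tht m%:Z =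
   2 * S 1 * theta 3 + 24 * S 3 * theta 1.
  transitivity (\sum_(n < M) n.+1%:R * vv n.+1 * (2 * theta 3 + 24 * n.+1%:R ^+ 2 * theta 1)).
    apply: eq_bigr => n _; congr (_ * _); rewrite !mulr_sumr -big_split.
    by apply: eq_bigr => m _ /=; ring.
  transitivity (S 1 * (2 * theta 3) + S 3 * (24 * theta 1)); last by ring.
  rewrite /sigser !mulr_suml -big_split.
  by apply: eq_bigr => n _ /=; ring.
have e2 : 240 * \sum_(m < B) (\sum_(k < m) (m - k)%:R * k.*2.+1%:R ^+ 3) * tht m%:Z =
   3 * theta 5 - 20 * theta 3 + 17 * theta 1.
  rewrite !mulr_sumr -sumrB -big_split; apply: eq_bigr => m _ /=.
  by rewrite mulrA tail3; ring.
(* 480 = 240 * 2: the denominator of [tail3] and the coefficient of G 3 in [gp_cube]. *)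
apply: (@tf_inj 479); apply: theta1_cancel.
move: H; rewrite e1 gp_cube -theta1 => /(congr1 (fun z => 240 * z)); rewrite mulrDr e2.
rewrite theta5 theta3 !raddfD /= !(Dnatl DM) => H.
have R1 := ramanujan1 qM DM Dq.
apply/eqP; rewrite -subr_eq0; apply/eqP.
transitivity (- ((240 * (2 * S 1 * ((1 - 24 * S 1) * theta 1) + 24 * S 3 * theta 1) +
    (3 * (((1 - 24 * S 1) ^+ 2 - 192 * D (S 1)) * theta 1) -
     20 * ((1 - 24 * S 1) * theta 1) + 17 * theta 1)) -
  240 * (theta 1 * (2 * G 3 + 7 * S 3 + 6 * (2 * D (G 1) + D (S 1))) -
     2 * G 1 * ((1 - 24 * S 1) * theta 1)))
  - 816 * theta 1 * (12 * S 1 ^+ 2 - (5 * S 3 - 6 * D (S 1) + S 1))); first by ring.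
by rewrite H R1 !subrr mulr0 oppr0 addr0.
Qed.

(** With C regarded as of weight 4, the right side is 30 times its Serre derivative D C - E_2 C / 3,
    plus E_4 B. *)
Theorem appell5 : let B := 1 - 24 * S 1 - 24 * G 1 in let C := 1 + 240 * S 3 - 24 * G 3 in
  216 * G 5 - 9 * (1 - 504 * S 5) =
  30 * D C - 10 * ((1 - 24 * S 1) * C) + (1 + 240 * S 3) * B.
Proof.
move=> b c.
have H := @moment_power 5 isT.
have e1 : \sum_(n < M) n.+1%:R * vv n.+1 * \sum_(m < B)
     ((m.*2.+1%:R + 2 * n.+1%:R) ^+ 5 + (m.*2.+1%:R - 2 * n.+1%:R) ^+ 5) * tht m%:Z =
   2 * S 1 * theta 5 + 80 * S 3 * theta 3 + 160 * S 5 * theta 1.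
  transitivity (\sum_(n < M) n.+1%:R * vv n.+1 *
     (2 * theta 5 + 80 * n.+1%:R ^+ 2 * theta 3 + 160 * n.+1%:R ^+ 4 * theta 1)).
    apply: eq_bigr => n _; congr (_ * _); rewrite !mulr_sumr -!big_split.
    by apply: eq_bigr => m _ /=; ring.
  transitivity (S 1 * (2 * theta 5) + S 3 * (80 * theta 3) + S 5 * (160 * theta 1)); last by ring.
  rewrite /sigser !mulr_suml -!big_split.
  by apply: eq_bigr => n _ /=; ring.
have e2 : 168 * \sum_(m < B) (\sum_(k < m) (m - k)%:R * k.*2.+1%:R ^+ 5) * tht m%:Z =
   theta 7 - 14 * theta 5 + 56 * theta 3 - 43 * theta 1.
  rewrite !mulr_sumr -sumrB -big_split -sumrB; apply: eq_bigr => m _ /=.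
  by rewrite mulrA tail5; ring.
(* The moment identity times 168 is used 9 times, and 9 * 168 * 2 = 14 * 216 matches the
   coefficients of G 5. *)
apply: (@tf_inj 13); apply: theta1_cancel.
move: H; rewrite e1 gp_fifth -theta1 => /(congr1 (fun z => 168 * z)); rewrite mulrDr e2.
rewrite theta7 theta5 theta3 /b /c !(raddfD, raddfB, raddfN) /= !(Dnatl DM) !(D1 DM) => H.
have R1 := ramanujan1 qM DM Dq; have R2 := ramanujan2 qM DM Dq.
have DR1 : 24 * (S 1 * D (S 1)) = 5 * D (S 3) - 6 * D (D (S 1)) + D (S 1).
  have := congr1 D R1; rewrite raddfD raddfB /= !(Dnatl DM) /= (DX DM) /= => <-; ring.
have A3 := appell3.
have DA3 : D (G 3) + 6 * D (D (G 1)) - D (G 1) + 24 * (D (G 1) * S 1 + G 1 * D (S 1)) = 6 * D (D (S 1)).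
  have := congr1 D A3; rewrite !(raddfD, raddfB) /= !(Dnatl DM) DM => <-; ring.
apply/eqP; rewrite -subr_eq0; apply/eqP.
move: H => /eqP; rewrite -subr_eq0 => /eqP H.
set h := (X in X = 0) in H.
transitivity (- (9 * h) + theta 1 * (- (72 * 78) * (12 * S 1 ^+ 2 - (5 * S 3 - 6 * D (S 1) + S 1))
  - 288 * 113 * (24 * (S 1 * D (S 1)) - (5 * D (S 3) - 6 * D (D (S 1)) + D (S 1)))
  + 288 * 468 * S 1 * (12 * S 1 ^+ 2 - (5 * S 3 - 6 * D (S 1) + S 1))
  - 112 * 144 * G 1 * (12 * S 1 ^+ 2 - (5 * S 3 - 6 * D (S 1) + S 1))
  - 108 * 114 * (240 * (S 1 * S 3) + 30 * D (S 3) - (21 * S 5 + 10 * S 3 - S 1))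
  - 56 * 60 * (G 3 + 6 * D (G 1) - G 1 + 24 * (G 1 * S 1) - 6 * D (S 1))
  - 144 * 140 * (D (G 3) + 6 * D (D (G 1)) - D (G 1) + 24 * (D (G 1) * S 1 + G 1 * D (S 1)) - 6 * D (D (S 1)))
  + 288 * 280 * S 1 * (G 3 + 6 * D (G 1) - G 1 + 24 * (G 1 * S 1) - 6 * D (S 1)))).
  by rewrite /h; ring.
by rewrite H R1 R2 DR1 A3 DA3 !subrr !mulr0 !(subr0, addr0) !mulr0 oppr0 addr0.
Qed.

End AppellSums.

(** * Truncated power series *)

Section TruncatedSeries.
Variables (k : comNzRingType) (n : nat).

Definition ser := {poly %/ ('X^(n.+1) : {poly k})}.
HB.instance Definition _ := GRing.ComNzRing.on ser.

Definition mks (p : {poly k}) : ser := in_qpoly 'X^(n.+1) p.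
HB.instance Definition _ := GRing.RMorphism.copy mks (in_qpoly ('X^(n.+1) : {poly k})).

Definition cf (x : ser) (i : nat) : k := (x : {poly k})`_i.

Lemma cf_mks p i : (i <= n)%N -> cf (mks p) i = p`_i.
Proof.
move=> le; rewrite /cf /mks /= mk_monic_Xn /=.
rewrite -{1}(poly_take_drop n.+1 p).
rewrite Pdiv.RingMonic.rmodpD ?monicXn // Pdiv.RingMonic.rmodp_mull ?monicXn // addr0.
rewrite Pdiv.CommonRing.rmodp_small; last by rewrite size_polyXn ltnS size_take_poly.
by rewrite coef_take_poly ltnS le.
Qed.

Lemma cf_ge x i : (n < i)%N -> cf x i = 0.
Proof.
move=> h; rewrite /cf nth_default //; apply: leq_trans h; rewrite -ltnS.
by apply: leq_trans (size_mk_monic x) _; rewrite mk_monic_Xn size_polyXn.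
Qed.

Lemma cfP (x y : ser) : (forall i, (i <= n)%N -> cf x i = cf y i) -> x = y.
Proof.
move=> e; apply: val_inj; apply/polyP => i.
by case: (leqP i n) => h; [exact: e | rewrite -!/(cf _ _) !cf_ge].
Qed.

Lemma mksK (x : ser) : mks (x : {poly k}) = x.
Proof. by apply: cfP => i hi; rewrite cf_mks. Qed.

Definition cfr i x := cf x i.

Fact cf_is_additive i : zmod_morphism (cfr i).
Proof. by move=> x y; rewrite /cfr /cf /= coefB. Qed.
HB.instance Definition _ i :=
  GRing.isZmodMorphism.Build ser k (cfr i) (cf_is_additive i).

Lemma cfD x y i : cf (x + y) i = cf x i + cf y i.
Proof. exact: (raddfD (cfr i)). Qed.
Lemma cfN x i : cf (- x) i = - cf x i.
Proof. exact: (raddfN (cfr i)). Qed.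
Lemma cfB x y i : cf (x - y) i = cf x i - cf y i.
Proof. exact: (raddfB (cfr i)). Qed.
Lemma cf0 i : cf 0 i = 0.
Proof. exact: (raddf0 (cfr i)). Qed.
Lemma cf_sum (I : Type) (r : seq I) (P : pred I) (F : I -> ser) i :
  cf (\sum_(j <- r | P j) F j) i = \sum_(j <- r | P j) cf (F j) i.
Proof. exact: (raddf_sum (cfr i)). Qed.
Lemma cf_nat m x i : cf (m%:R * x) i = m%:R * cf x i.
Proof. by rewrite !mulr_natl; exact: (raddfMn (cfr i)). Qed.

Definition qs : ser := mks 'X.

Lemma qsX m : qs ^+ m = mks 'X^m.
Proof. by rewrite -rmorphXn. Qed.

Lemma qsM : qs ^+ n.+1 = 0.
Proof. by rewrite qsX; apply: cfP => i hi; rewrite cf_mks // cf0 coefXn; case: eqP hi => // ->; lia. Qed.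

Lemma cf_qs m i : (i <= n)%N -> cf (qs ^+ m) i = (i == m)%:R.
Proof. by move=> hi; rewrite qsX cf_mks // coefXn. Qed.

(** Unlike d/dq, the operator q d/dq preserves the ideal of q^(n+1), so it descends to the
    truncation. *)
Definition Ds (x : ser) : ser := mks ('X * ((x : {poly k})^`())).

Lemma cf_Ds x i : (i <= n)%N -> cf (Ds x) i = i%:R * cf x i.
Proof.
move=> hi; rewrite cf_mks // coefXM coef_deriv; case: i hi => [|i] _ /=.
  by rewrite mul0r.
by rewrite mulr_natl.
Qed.

Fact Ds_is_additive : zmod_morphism Ds.
Proof. by move=> x y; rewrite /Ds /= derivB mulrBr rmorphB. Qed.
HB.instance Definition _ := GRing.isZmodMorphism.Build ser ser Ds Ds_is_additive.

Lemma Ds_mks p : Ds (mks p) = mks ('X * p^`()).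
Proof.
apply: cfP => i hi; rewrite cf_Ds // !cf_mks // coefXM coef_deriv.
by case: i hi => [|i] _ /=; rewrite ?mul0r // mulr_natl.
Qed.

Lemma DsM (x y : ser) : Ds (x * y) = Ds x * y + x * Ds y.
Proof.
rewrite -(mksK x) -(mksK y) -rmorphM !Ds_mks -!rmorphM -rmorphD derivM.
by congr mks; ring.
Qed.

Lemma Ds_qs : Ds qs = qs.
Proof. by rewrite Ds_mks derivX mulr1. Qed.

End TruncatedSeries.

Section Transfer.
Variables (k : comNzRingType) (n : nat).

(* The Appell identities are derived in a ring without integer torsion, so they
   are proved over [int] and then reduced. *)
Definition red (x : ser int n) : ser k n := mks n (map_poly intr (x : {poly int})).

Lemma cf_red x i : cf (red x) i = (cf x i)%:~R.
Proof.
case: (leqP i n) => h; last by rewrite !cf_ge.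
by rewrite cf_mks // coef_map_id0 // mulr0z.
Qed.

Lemma red_mks p : red (mks n p) = mks n (map_poly intr p).
Proof.
by apply: cfP => i hi; rewrite cf_red !cf_mks // coef_map_id0 // mulr0z.
Qed.

Fact red_is_additive : zmod_morphism red.
Proof. by move=> x y; apply: cfP => i hi; rewrite cf_red !cfB !cf_red intrB. Qed.
HB.instance Definition _ := GRing.isZmodMorphism.Build (ser int n) (ser k n) red red_is_additive.

Fact red_is_multiplicative : monoid_morphism red.
Proof.
split; first by rewrite -(rmorph1 (@mks int n)) red_mks !rmorph1.
by move=> x y; rewrite -(mksK x) -(mksK y) -rmorphM !red_mks !rmorphM.
Qed.
HB.instance Definition _ :=
  GRing.isMonoidMorphism.Build (ser int n) (ser k n) red red_is_multiplicative.

Lemma red_qs : red (qs _ n) = qs _ n.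
Proof. by rewrite red_mks map_polyX. Qed.

Lemma red_Ds x : red (Ds x) = Ds (red x).
Proof.
by apply: cfP => i hi; rewrite cf_red !cf_Ds // cf_red intrM mulrz_nat.
Qed.

Lemma ser_int_tf (m : nat) (x : ser int n) : m.+1%:R * x = 0 -> x = 0.
Proof.
move=> e; apply: cfP => i _; have := congr1 (fun y => cf y i) e.
by rewrite /= cf_nat !cf0 => /eqP; rewrite mulf_eq0 Num.Theory.pnatr_eq0 => /eqP.
Qed.

End Transfer.

Section Morphism.
Variables (A A' : comNzRingType) (f : {rmorphism A -> A'}) (q : A) (q' : A') (M : nat).
Hypothesis fq : f q = q'.

Lemma map_geo m : f (geo q M m) = geo q' M m.
Proof. by rewrite rmorph_sum; apply: eq_bigr => j _; rewrite rmorphXn fq. Qed.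

Lemma map_vv m : f (vv q M m) = vv q' M m.
Proof. by rewrite rmorphM rmorphXn fq map_geo. Qed.

Lemma map_S m : f (sigser q M m) = sigser q' M m.
Proof.
rewrite rmorph_sum; apply: eq_bigr => j _.
by rewrite rmorphM rmorphXn rmorph_nat map_vv.
Qed.

Lemma map_tht r : f (tht q r) = tht q' r.
Proof. by case: r => m; rewrite /tht rmorphM !rmorphXn rmorphN rmorph1 fq. Qed.

Lemma map_G m : f (gser q M m) = gser q' M m.
Proof.
rewrite !GE rmorph_sum; apply: eq_bigr => r _.
by rewrite rmorphN 2!rmorphM rmorphXn rmorph_nat map_tht map_geo.
Qed.

Lemma map_rel3 a b c d e : a + 6 * b - c + 24 * (c * d) = 6 * e ->
  f a + 6 * f b - f c + 24 * (f c * f d) = 6 * f e.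
Proof. by move=> /(congr1 f); rewrite !(rmorph_nat, rmorphM, rmorphB, rmorphD). Qed.

Lemma map_weight4 s g : f (1 + 240 * s - 24 * g) = 1 + 240 * f s - 24 * f g.
Proof. by rewrite !(rmorph1, rmorph_nat, rmorphM, rmorphB, rmorphD). Qed.

Lemma map_rel5 g5 s5 s1 d s3 g3 g1 : 216 * g5 - 9 * (1 - 504 * s5) =
    30 * d - 10 * ((1 - 24 * s1) * (1 + 240 * s3 - 24 * g3))
    + (1 + 240 * s3) * (1 - 24 * s1 - 24 * g1) ->
    216 * f g5 - 9 * (1 - 504 * f s5) =
    30 * f d - 10 * ((1 - 24 * f s1) * (1 + 240 * f s3 - 24 * f g3))
    + (1 + 240 * f s3) * (1 - 24 * f s1 - 24 * f g1).
Proof.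
by move=> /(congr1 f); rewrite !(rmorph1, rmorph_nat, rmorphM, rmorphB, rmorphD).
Qed.

End Morphism.

Section Identities.
Variables (k : comNzRingType) (n : nat).
Notation S := (sigser (qs k n) n.+1).
Notation G := (gser (qs k n) n.+1).
Notation D := (@Ds k n).

Theorem ser_appell3 : G 3 + 6 * D (G 1) - G 1 + 24 * (G 1 * S 1) = 6 * D (S 1).
Proof.
have := map_rel3 (@red k n) (appell3 (@qsM _ n) (@DsM _ n) (@Ds_qs _ n) (@ser_int_tf n)).
by rewrite /= !red_Ds !(map_S _ (@red_qs k n)) !(map_G _ (@red_qs k n)).
Qed.

Theorem ser_appell5 : let B := 1 - 24 * S 1 - 24 * G 1 in let C := 1 + 240 * S 3 - 24 * G 3 in
  216 * G 5 - 9 * (1 - 504 * S 5) =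
  30 * D C - 10 * ((1 - 24 * S 1) * C) + (1 + 240 * S 3) * B.
Proof.
move=> B C.
have := map_rel5 (@red k n) (appell5 (@qsM _ n) (@DsM _ n) (@Ds_qs _ n) (@ser_int_tf n)).
by rewrite /= !red_Ds (map_weight4 (@red k n)) !(map_S _ (@red_qs k n)) !(map_G _ (@red_qs k n)).
Qed.

End Identities.

(** * Eisenstein series modulo 13 *)

Section Eisenstein13.
Variables (A : comNzRingType) (D : {additive A -> A}) (e x y J K : A).
Hypotheses (DM : forall a b, D (a * b) = D a * b + a * D b) (h13 : 13 = 0 :> A)
  (De : D e = x - e ^+ 2) (Dx : D x = 4 * y - 4 * (e * x))
  (Dy : D y = 7 * (e * y) - 7 * x ^+ 2)
  (DJ : 8 * D J + J = e * J) (DK : 8 * D K - K = - (e * K)) (JK : J * K = 1).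

Let DE := (raddfD, raddfB, raddfN, Dnatl DM, DM, DX DM, De, Dx, Dy, D1 DM).

Lemma heatJ p : 8 * D (p * J) + p * J = (8 * D p + e * p) * J.
Proof. by rewrite DM [RHS]mulrDl -[e * p * J]mulrA [e * (p * J)]mulrCA -DJ; ring. Qed.

Lemma heatK p : 8 * D (p * K) - p * K = (8 * D p - e * p) * K.
Proof. by rewrite DM [RHS]mulrBl -[e * p * K]mulrA [e * (p * K)]mulrCA -[e * K]opprK -DK; ring. Qed.

Let heat t := 8 * D t + t.

(** Each application of 8 D + 1 raises the weight of the polynomial before J by 2. In weight 12 all
    terms containing e vanish modulo 13. *)
Lemma heat6J : iter 6 heat J = (6 * x ^+ 3 - 5 * y ^+ 2) * J.
Proof.
have s1 : heat J = e * J by exact: DJ.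
have s2 : heat ((e) * J) = (6 * (e ^+ 2) - 5 * x) * J.
  rewrite /heat heatJ; congr (_ * _); rewrite !DE /=.
  (* The multiple of 13 collects what is discarded when the coefficients are reduced; the same
     device serves in all later steps. *)
  transitivity (6 * (e ^+ 2) - 5 * x + 13 * (- (e ^+ 2) + x)); last by rewrite h13 mul0r addr0.
  by ring.
have s3 : heat ((6 * (e ^+ 2) - 5 * x) * J) = (e ^+ 3 + 4 * (e * x) - 4 * y) * J.
  rewrite /heat heatJ; congr (_ * _); rewrite !DE /=.
  transitivity (e ^+ 3 + 4 * (e * x) - 4 * y + 13 * (- (7 * (e ^+ 3)) + 19 * (e * x) - 12 * y)); last by rewrite h13 mul0r addr0.
  by ring.
have s4 : heat ((e ^+ 3 + 4 * (e * x) - 4 * y) * J) = (3 * (e ^+ 4) - 2 * (e ^+ 2 * x) + 4 * (e * y) - 4 * (x ^+ 2)) * J.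
  rewrite /heat heatJ; congr (_ * _); rewrite !DE /=.
  transitivity (3 * (e ^+ 4) - 2 * (e ^+ 2 * x) + 4 * (e * y) - 4 * (x ^+ 2) + 13 * (- (2 * (e ^+ 4)) - 10 * (e ^+ 2 * x) - 8 * (e * y) + 20 * (x ^+ 2))); last by rewrite h13 mul0r addr0.
  by ring.
have s5 : heat ((3 * (e ^+ 4) - 2 * (e ^+ 2 * x) + 4 * (e * y) - 4 * (x ^+ 2)) * J) = (- (2 * (e ^+ 5)) - 5 * (e ^+ 3 * x) + 2 * (e ^+ 2 * y) - 4 * (e * x ^+ 2) - 3 * (x * y)) * J.
  rewrite /heat heatJ; congr (_ * _); rewrite !DE /=.
  transitivity (- (2 * (e ^+ 5)) - 5 * (e ^+ 3 * x) + 2 * (e ^+ 2 * y) - 4 * (e * x ^+ 2) - 3 * (x * y) + 13 * (- (7 * (e ^+ 5)) + 15 * (e ^+ 3 * x) + 10 * (e ^+ 2 * y) - 17 * (x * y))); last by rewrite h13 mul0r addr0.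
  by ring.
have s6 : heat ((- (2 * (e ^+ 5)) - 5 * (e ^+ 3 * x) + 2 * (e ^+ 2 * y) - 4 * (e * x ^+ 2) - 3 * (x * y)) * J) = (6 * (x ^+ 3) - 5 * (y ^+ 2)) * J.
  rewrite /heat heatJ; congr (_ * _); rewrite !DE /=.
  transitivity (6 * (x ^+ 3) - 5 * (y ^+ 2) + 13 * (6 * (e ^+ 6) + 15 * (e ^+ 4 * x) - 6 * (e ^+ 3 * y) + 4 * (e ^+ 2 * x ^+ 2) - 23 * (e * x * y) + 10 * (x ^+ 3) - 7 * (y ^+ 2))); last by rewrite h13 mul0r addr0.
  by ring.
by rewrite /= s1 s2 s3 s4 s5 s6.
Qed.

Hypothesis fermat : iter 6 heat J = J.

(** This is E_12 = 1 modulo 13, since 691 E_12 = 441 E_4^3 + 250 E_6^2; it follows by cancelling the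
    invertible J in [heat6J]. *)
Lemma hasse_invariant : 3 * y ^+ 2 - x ^+ 3 = 2.
Proof.
have e1 : 6 * x ^+ 3 - 5 * y ^+ 2 = 1.
  transitivity ((6 * x ^+ 3 - 5 * y ^+ 2) * J * K); first by rewrite -mulrA JK mulr1.
  by rewrite -heat6J fermat.
transitivity (2 * (6 * x ^+ 3 - 5 * y ^+ 2) + 13 * (y ^+ 2 - x ^+ 3)); first by ring.
by rewrite e1 h13 mul0r addr0 mulr1.
Qed.

(** Differentiating the Hasse relation gives an equation linear in e. The result is E_2 = E_14 =
    E_4^2 E_6 modulo 13. *)
Lemma E2_mod13 : e = x ^+ 2 * y.
Proof.
have h : 3 * (2 * y * (7 * (e * y) - 7 * x ^+ 2)) - 3 * x ^+ 2 * (4 * y - 4 * (e * x)) = 0.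
  transitivity (D (3 * y ^+ 2 - x ^+ 3)); last by rewrite hasse_invariant (Dnat DM).
  by rewrite raddfB /= (Dnatl DM) !(DX DM) Dx Dy /=; ring.
apply/eqP; rewrite -subr_eq0; apply/eqP.
transitivity (7 * (3 * (2 * y * (7 * (e * y) - 7 * x ^+ 2)) - 3 * x ^+ 2 * (4 * y - 4 * (e * x))
  - e * (3 * y ^+ 2 - x ^+ 3 - 2))
  + 13 * (29 * (x ^+ 2 * y) - e - 21 * (e * y ^+ 2) - 7 * (e * x ^+ 3))); first by ring.
by rewrite h hasse_invariant subrr mulr0 subr0 mulr0 h13 mul0r addr0.
Qed.

Let opk t := 8 * D t - t.

(* With [e = x^2 y] and [y^2 = 9 x^3 + 5] everything lives in the free module on
   [1, y] over polynomials in [x]. *)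
Lemma opk7 : iter 7 opk ((e ^+ 2 - x) * K) = - opk ((e ^+ 2 - x) * K).
Proof.
have ee := E2_mod13.
have y2 : y ^+ 2 - (9 * x ^+ 3 + 5) = 0.
  transitivity (9 * (3 * y ^+ 2 - x ^+ 3 - 2) + 13 * (1 - 2 * y ^+ 2)); first by ring.
  by rewrite hasse_invariant subrr mulr0 h13 mul0r addr0.
have Dx' : D x = 4 * y - 4 * (x ^+ 3 * y) by rewrite Dx ee; ring.
have Dy' : D y = 7 * (x ^+ 2 * y ^+ 2) - 7 * x ^+ 2 by rewrite Dy ee; ring.
have s0 : e ^+ 2 - x = - (4 * (x ^+ 7)) + 5 * (x ^+ 4) - x.
  rewrite ee; transitivity (- (4 * (x ^+ 7)) + 5 * (x ^+ 4) - x + (x ^+ 4) * (y ^+ 2 - (9 * x ^+ 3 + 5)) + 13 * (x ^+ 7)).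
    by ring.
  by rewrite y2 h13 mulr0 mul0r !addr0.
have s1 : opk ((- (4 * (x ^+ 7)) + 5 * (x ^+ 4) - x) * K) = (3 * (x ^+ 9 * y) + 6 * (x ^+ 6 * y) - 3 * (x ^+ 3 * y) - 6 * y) * K.
  rewrite /opk heatK; congr (_ * _); rewrite ee !(raddfD, raddfB, raddfN, Dnatl DM, DM, DX DM, Dx', Dy', D1 DM, Dnat DM) /=.
  transitivity (3 * (x ^+ 9 * y) + 6 * (x ^+ 6 * y) - 3 * (x ^+ 3 * y) - 6 * y + (0) * (y ^+ 2 - (9 * x ^+ 3 + 5))
    + 13 * (69 * (x ^+ 9 * y) - 119 * (x ^+ 6 * y) + 52 * (x ^+ 3 * y) - 2 * y)); last by rewrite y2 h13 mulr0 mul0r !addr0.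
  by ring.
have s2 : opk ((3 * (x ^+ 9 * y) + 6 * (x ^+ 6 * y) - 3 * (x ^+ 3 * y) - 6 * y) * K) = (x ^+ 14 + 4 * (x ^+ 11) + 6 * (x ^+ 5) + 2 * (x ^+ 2)) * K.
  rewrite /opk heatK; congr (_ * _); rewrite ee !(raddfD, raddfB, raddfN, Dnatl DM, DM, DX DM, Dx', Dy', D1 DM, Dnat DM) /=.
  transitivity (x ^+ 14 + 4 * (x ^+ 11) + 6 * (x ^+ 5) + 2 * (x ^+ 2) + (- (699 * (x ^+ 11)) + 42 * (x ^+ 8) + 1275 * (x ^+ 5) - 618 * (x ^+ 2)) * (y ^+ 2 - (9 * x ^+ 3 + 5))
    + 13 * (- (484 * (x ^+ 14)) - 253 * (x ^+ 11) + 873 * (x ^+ 8) + 75 * (x ^+ 5) - 212 * (x ^+ 2))); last by rewrite y2 h13 mulr0 mul0r !addr0.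
  by ring.
have s3 : opk ((x ^+ 14 + 4 * (x ^+ 11) + 6 * (x ^+ 5) + 2 * (x ^+ 2)) * K) = (6 * (x ^+ 16 * y) - 2 * (x ^+ 13 * y) + 4 * (x ^+ 10 * y) - 4 * (x ^+ 7 * y) - 2 * (x ^+ 4 * y) - 2 * (x * y)) * K.
  rewrite /opk heatK; congr (_ * _); rewrite ee !(raddfD, raddfB, raddfN, Dnatl DM, DM, DX DM, Dx', Dy', D1 DM, Dnat DM) /=.
  transitivity (6 * (x ^+ 16 * y) - 2 * (x ^+ 13 * y) + 4 * (x ^+ 10 * y) - 4 * (x ^+ 7 * y) - 2 * (x ^+ 4 * y) - 2 * (x * y) + (0) * (y ^+ 2 - (9 * x ^+ 3 + 5))
    + 13 * (- (35 * (x ^+ 16 * y)) - 74 * (x ^+ 13 * y) + 108 * (x ^+ 10 * y) - 74 * (x ^+ 7 * y) + 64 * (x ^+ 4 * y) + 10 * (x * y))); last by rewrite y2 h13 mulr0 mul0r !addr0.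
  by ring.
have s4 : opk ((6 * (x ^+ 16 * y) - 2 * (x ^+ 13 * y) + 4 * (x ^+ 10 * y) - 4 * (x ^+ 7 * y) - 2 * (x ^+ 4 * y) - 2 * (x * y)) * K) = (- (4 * (x ^+ 21)) + 2 * (x ^+ 18) + 3 * (x ^+ 12) + 4 * (x ^+ 9) + x ^+ 6 + 2 * (x ^+ 3) + 5) * K.
  rewrite /opk heatK; congr (_ * _); rewrite ee !(raddfD, raddfB, raddfN, Dnatl DM, DM, DX DM, Dx', Dy', D1 DM, Dnat DM) /=.
  transitivity (- (4 * (x ^+ 21)) + 2 * (x ^+ 18) + 3 * (x ^+ 12) + 4 * (x ^+ 9) + x ^+ 6 + 2 * (x ^+ 3) + 5 + (- (2742 * (x ^+ 18)) + 3794 * (x ^+ 15) - 1892 * (x ^+ 12) + 1956 * (x ^+ 9) - 750 * (x ^+ 6) - 302 * (x ^+ 3) - 64) * (y ^+ 2 - (9 * x ^+ 3 + 5))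
    + 13 * (- (1898 * (x ^+ 21)) + 1546 * (x ^+ 18) + 158 * (x ^+ 15) + 609 * (x ^+ 12) + 250 * (x ^+ 9) - 489 * (x ^+ 6) - 152 * (x ^+ 3) - 25)); last by rewrite y2 h13 mulr0 mul0r !addr0.
  by ring.
have s5 : opk ((- (4 * (x ^+ 21)) + 2 * (x ^+ 18) + 3 * (x ^+ 12) + 4 * (x ^+ 9) + x ^+ 6 + 2 * (x ^+ 3) + 5) * K) = (x ^+ 23 * y + 6 * (x ^+ 20 * y) - 5 * (x ^+ 17 * y) + 2 * (x ^+ 14 * y) - 4 * (x ^+ 11 * y) - 3 * (x ^+ 8 * y) - 2 * (x ^+ 5 * y) + 5 * (x ^+ 2 * y)) * K.
  rewrite /opk heatK; congr (_ * _); rewrite ee !(raddfD, raddfB, raddfN, Dnatl DM, DM, DX DM, Dx', Dy', D1 DM, Dnat DM) /=.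
  transitivity (x ^+ 23 * y + 6 * (x ^+ 20 * y) - 5 * (x ^+ 17 * y) + 2 * (x ^+ 14 * y) - 4 * (x ^+ 11 * y) - 3 * (x ^+ 8 * y) - 2 * (x ^+ 5 * y) + 5 * (x ^+ 2 * y) + (0) * (y ^+ 2 - (9 * x ^+ 3 + 5))
    + 13 * (207 * (x ^+ 23 * y) - 296 * (x ^+ 20 * y) + 89 * (x ^+ 17 * y) - 89 * (x ^+ 14 * y) + 74 * (x ^+ 8 * y) + 14 * (x ^+ 2 * y))); last by rewrite y2 h13 mulr0 mul0r !addr0.
  by ring.
have s6 : opk ((x ^+ 23 * y + 6 * (x ^+ 20 * y) - 5 * (x ^+ 17 * y) + 2 * (x ^+ 14 * y) - 4 * (x ^+ 11 * y) - 3 * (x ^+ 8 * y) - 2 * (x ^+ 5 * y) + 5 * (x ^+ 2 * y)) * K) = (- (6 * (x ^+ 28)) + 4 * (x ^+ 25) + 5 * (x ^+ 22) - 5 * (x ^+ 19) - 4 * (x ^+ 16) + 6 * (x ^+ 13) + 4 * (x ^+ 7) - 5 * (x ^+ 4) + x) * K.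
  rewrite /opk heatK; congr (_ * _); rewrite ee !(raddfD, raddfB, raddfN, Dnatl DM, DM, DX DM, Dx', Dy', D1 DM, Dnat DM) /=.
  transitivity (- (6 * (x ^+ 28)) + 4 * (x ^+ 25) + 5 * (x ^+ 22) - 5 * (x ^+ 19) - 4 * (x ^+ 16) + 6 * (x ^+ 13) + 4 * (x ^+ 7) - 5 * (x ^+ 4) + x + (- (681 * (x ^+ 25)) - 2774 * (x ^+ 22) + 6285 * (x ^+ 19) - 3506 * (x ^+ 16) + 2084 * (x ^+ 13) - 805 * (x ^+ 10) - 558 * (x ^+ 7) - 365 * (x ^+ 4) + 320 * x) * (y ^+ 2 - (9 * x ^+ 3 + 5))
    + 13 * (- (471 * (x ^+ 28)) - 2187 * (x ^+ 25) + 3258 * (x ^+ 22) + 12 * (x ^+ 19) + 86 * (x ^+ 16) + 261 * (x ^+ 13) - 683 * (x ^+ 10) - 459 * (x ^+ 7) + 60 * (x ^+ 4) + 123 * x)); last by rewrite y2 h13 mulr0 mul0r !addr0.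
  by ring.
have s7 : opk ((- (6 * (x ^+ 28)) + 4 * (x ^+ 25) + 5 * (x ^+ 22) - 5 * (x ^+ 19) - 4 * (x ^+ 16) + 6 * (x ^+ 13) + 4 * (x ^+ 7) - 5 * (x ^+ 4) + x) * K) = (- (3 * (x ^+ 9 * y)) - 6 * (x ^+ 6 * y) + 3 * (x ^+ 3 * y) + 6 * y) * K.
  rewrite /opk heatK; congr (_ * _); rewrite ee !(raddfD, raddfB, raddfN, Dnatl DM, DM, DX DM, Dx', Dy', D1 DM, Dnat DM) /=.
  transitivity (- (3 * (x ^+ 9 * y)) - 6 * (x ^+ 6 * y) + 3 * (x ^+ 3 * y) + 6 * y + (0) * (y ^+ 2 - (9 * x ^+ 3 + 5))
    + 13 * (414 * (x ^+ 30 * y) - 660 * (x ^+ 27 * y) - 25 * (x ^+ 24 * y) + 505 * (x ^+ 21 * y) - 76 * (x ^+ 18 * y) - 350 * (x ^+ 15 * y) + 192 * (x ^+ 12 * y) - 69 * (x ^+ 9 * y) + 119 * (x ^+ 6 * y) - 52 * (x ^+ 3 * y) + 2 * y)); last by rewrite y2 h13 mulr0 mul0r !addr0.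
  by ring.
rewrite s0 /= s1 s2 s3 s4 s5 s6 s7; ring.
Qed.

End Eisenstein13.

(** * Generating functions of partition quadruples *)

Local Open Scope nat_scope.

Lemma smallestE s m : (smallest s == Some m) = (m \in s) && all (leq m) s.
Proof.
case: s => [|x s] //=.
have -> : (Some (foldr minn x s) == Some m) = (foldr minn x s == m) by [].
have le z : (z <= foldr minn x s) = (z <= x) && all (leq z) s.
  by elim: s => [|y s IH] /=; rewrite ?andbT // leq_min IH andbCA.
have mem : foldr minn x s \in x :: s.
  elim: s {le} => [|y s IH] /=; first by rewrite inE.
  by rewrite /minn; case: ifP => _; move: IH; rewrite !inE ?eqxx ?orbT // => /orP[]->; rewrite ?orbT.
apply/eqP/andP => [<-|[mx]]; first by rewrite mem -le.
rewrite -le => le1; apply/eqP; rewrite eqn_leq le1 andbT.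
have := leqnn (foldr minn x s); rewrite le => /andP[h1 /allP h2].
by move: mx; rewrite inE => /predU1P[->|/h2].
Qed.

Lemma leqi_smallest m s : leqi (Some m) (smallest s) = all (leq m) s.
Proof.
case e : (smallest s) => [x|] /=; last by case: s e.
have /eqP := e; rewrite smallestE => /andP[xs /allP h].
apply/idP/allP => [mx y /h|h']; [exact: leq_trans | exact: h'].
Qed.

Lemma largestE s c : (largest s <= c) = all (fun x => x <= c) s.
Proof. by elim: s => //= x s IH; rewrite geq_max IH. Qed.

(* The partitions with parts in [[m, m + len[], each of multiplicity below [M]. *)
Fixpoint plist (M m len : nat) : seq (seq nat) :=
  if len is l.+1 then [seq nseq j (m + l) ++ s | j <- iota 0 M, s <- plist M m l]
  else [:: [::]].

Arguments plist : simpl never.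

Lemma plistS M m l : plist M m l.+1 =
  [seq nseq j (m + l) ++ s | j <- iota 0 M, s <- plist M m l].
Proof. by []. Qed.

Lemma geq_trans : transitive geq.
Proof. by move=> a b c h1 h2; exact: leq_trans h2 h1. Qed.

Lemma sorted_cat_nseq s e m : sorted geq s -> all (leq m) s -> sorted geq (s ++ nseq e m).
Proof.
move=> ss h; rewrite (sorted_pairwise geq_trans) pairwise_cat -!(sorted_pairwise geq_trans) ss /=.
apply/andP; split.
  by apply/allrelP => x y xs; rewrite mem_nseq => /andP[_ /eqP->]; apply: (allP h).
by elim: e => //= e IH; case: e IH => //= e ->; rewrite leqnn.
Qed.

Lemma plist_parts M m len s : s \in plist M m len ->
  sorted geq s /\ all (fun x => m <= x < m + len) s.
Proof.
elim: len s => [|l IH] s; first by rewrite inE => /eqP->.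
rewrite plistS; case/allpairsP => -[j t] /= [_ /IH[st ht] ->]; split; last first.
  rewrite all_cat; apply/andP; split.
    by apply/allP => x; rewrite mem_nseq => /andP[_ /eqP->]; lia.
  by apply: sub_all ht => x; lia.
rewrite (sorted_pairwise geq_trans) pairwise_cat -!(sorted_pairwise geq_trans) st andbT.
apply/andP; split.
  apply/allrelP => x y; rewrite mem_nseq => /andP[_ /eqP->] yt.
  by have := allP ht _ yt => /=; lia.
by elim: j => //= j IHj; case: j IHj => //= j ->; rewrite leqnn.
Qed.

Lemma sorted_top s x : sorted geq s -> all (fun y => y <= x) s ->
  exists j t, s = nseq j x ++ t /\ all (fun y => y < x) t.
Proof.
elim: s => [|y s IH] ss /=; first by exists 0, [::].
case/andP=> yx hs; have ss' := path_sorted ss.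
case: (ltngtP y x) yx => // [lt _|-> _]; last first.
  by have [j [t [-> ht]]] := IH ss' hs; exists j.+1, t.
exists 0, (y :: s); split=> //=; rewrite lt /=.
move: ss; rewrite /= (path_sortedE geq_trans) => /andP[h _].
by apply: sub_all h => z; lia.
Qed.

Lemma mem_plist M m len s : sorted geq s -> all (fun x => m <= x < m + len) s ->
  size s < M -> s \in plist M m len.
Proof.
elim: len s => [|l IH] s ss hs sz.
  case: s hs {ss sz} => //= x s /andP[]; lia.
have [|j [t [es ht]]] := @sorted_top s (m + l) ss.
  by apply: sub_all hs => x; lia.
rewrite plistS; apply/allpairsP; exists (j, t); split=> //=.
  by rewrite mem_iota; move: sz; rewrite es size_cat size_nseq; lia.
apply: IH.
- by move: ss; rewrite es => /cat_sorted2[].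
- move: hs; rewrite es all_cat => /andP[_ h]; apply/allP => x xt.
  by have := allP h _ xt; have := allP ht _ xt => /=; lia.
- by move: sz; rewrite es size_cat; lia.
Qed.

Lemma plist_uniq M m len : uniq (plist M m len).
Proof.
elim: len => [|l IH] //; rewrite plistS; apply: allpairs_uniq => //; first exact: iota_uniq.
move=> [j s] [i t] /allpairsP[[j' s'] /= [_ hs [-> ->]]] /allpairsP[[i' t'] /= [_ ht [-> ->]]] /= e.
have c0 z : z \in plist M m l -> count_mem (m + l) z = 0.
  move/plist_parts=> [_ h]; apply/count_memPn; apply/negP => /(allP h); lia.
have ej : j' = i'.
  have := congr1 (count_mem (m + l)) e.
  by rewrite !count_cat !count_nseq /= eqxx !mul1n !c0 // !addn0.
by move: e; rewrite ej => /eqP; rewrite eqseq_cat // eqxx /= => /eqP->.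
Qed.

Definition qparts (n m : nat) :=
  [seq (s, t) | s <- [seq (a, b) | a <- plist n.+1 m (n.+2 - m), b <- plist n.+1 m (n.+2 - m)],
                t <- [seq (a, b) | a <- plist n.+1 m (n.+2 - m), b <- plist n.+1 m m.+1]].

(** The e copies of m are split off the end of the first partition, whose remainder may still
    contain m. Sizes are left unrestricted so that the generating function factors; size n is
    selected afterwards. *)
Definition qlist (e n : nat) : seq quadruple :=
  [seq (p.1.1 ++ nseq e m, p.1.2, p.2.1, p.2.2) | m <- iota 1 n, p <- qparts n m].

Definition qsize (p : quadruple) : nat :=
  let: (p1, p2, p3, p4) := p in sumn p1 + sumn p2 + sumn p3 + sumn p4.

Definition qcond (e : nat) (p : quadruple) (m : nat) : bool :=
  let: (p1, p2, p3, p4) := p in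
  [&& smallest p1 == Some m, e <= count_mem m p1, all (leq m) p2, all (leq m) p3,
      all (leq m) p4 & all (fun x => x <= 2 * m) p4].

Lemma partition_split e m s : 0 < e -> is_partition s -> smallest s = Some m ->
  e <= count_mem m s ->
  exists2 t, s = t ++ nseq e m & sorted geq t && all (leq m) t.
Proof.
move=> e0 /andP[ss s0] /eqP; rewrite smallestE => /andP[_ hm].
elim: e s e0 ss {s0} hm => // e IH s _ ss hm.
case/lastP: s ss hm => [|s x] // ss; rewrite all_rcons => /andP[mx hm].
have sx : all (leq x) s.
  move: ss; rewrite -cats1 (sorted_pairwise geq_trans) pairwise_cat => /and3P[/allrelP h _ _].
  by apply/allP => y ys; apply: h; rewrite ?inE.
have ss' : sorted geq s by move: ss; rewrite -cats1 => /cat_sorted2[].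
rewrite -cats1 count_cat /= addn0; case: (eqVneq x m) => [exm|nxm].
  rewrite addn1 ltnS exm => hc; case: e IH hc => [_ _|e IH hc].
    by exists s => //; rewrite ss' hm.
  have [t -> ht] := IH s isT ss' hm hc; exists t => //.
  by rewrite -catA; congr (_ ++ _); rewrite -[[:: m]]/(nseq 1 m) -nseqD addn1.
rewrite addn0 => hc; have ms : m \in s by rewrite -has_pred1 has_count (leq_trans _ hc).
by have := allP sx _ ms; move: mx nxm => /= ? ? ?; lia.
Qed.

Lemma qlistP e n p : 0 < e ->
  (p \in [seq p <- qlist e n | qsize p == n]) =
  is_partition_quadruple n p && [exists m : 'I_n.+1, qcond e p m].
Proof.
move=> e0; rewrite mem_filter; case: p => [[[p1 p2] p3] p4].
apply/andP/andP.
  case=> sz /allpairsPdep[m [p []]]; rewrite mem_iota => hm.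
  case/allpairsP=> -[s0 t0] /= [/allpairsP[[a b] /= [ha hb ->]] /allpairsP[[c d] /= [hc hd ->]] ->].
  move=> /= [e1 e2 e3 e4]; rewrite {}e1 {}e2 {}e3 {}e4 in sz *.
  have [sa pa] := plist_parts ha; have [sb pb] := plist_parts hb.
  have [sc pc] := plist_parts hc; have [sd pd] := plist_parts hd.
  have lo s len : all (fun x => m <= x < m + len) s -> all (leq m) s.
    by apply: sub_all => x /andP[].
  have np s : sorted geq s -> all (leq m) s -> is_partition s.
    move=> ss /allP h; rewrite /is_partition ss /=; apply/negP => /h /=.
    by rewrite leqn0 => /eqP m0; move: hm; rewrite m0.
  have al : all (leq m) (a ++ nseq e m).
    by rewrite all_cat (lo _ _ pa); apply/allP => x; rewrite mem_nseq => /andP[_ /eqP->].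
  split.
    rewrite /= (np (_ ++ _)) ?(np b) ?(np c) ?(np d) ?(lo _ _ pb) ?(lo _ _ pc) ?(lo _ _ pd) //=.
    by apply: sorted_cat_nseq => //; apply: lo pa.
  have lt : m < n.+1 by case/andP: hm.
  apply/existsP; exists (Ordinal lt) => /=.
  rewrite smallestE al mem_cat mem_nseq e0 eqxx orbT count_cat count_nseq /= eqxx mul1n leq_addl.
  rewrite (lo _ _ pb) (lo _ _ pc) (lo _ _ pd) /=.
  by apply: sub_all pd => x; clear; lia.
case=> /and5P[h1 h2 h3 h4 /eqP sz] /existsP[m] /and3P[/eqP hs hc /and4P[a2 a3 a4 b4]].
split; first by rewrite /= sz.
have [t e1 /andP[st ht]] := partition_split e0 h1 hs hc.
have m0 : 0 < m.
  rewrite lt0n; apply/negP => /eqP m0; move: h1 => /andP[_ /negP]; apply.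
  by move/eqP: hs; rewrite smallestE m0 => /andP[].
have mn : m <= n.
  have ms : (m : nat) \in p1 by move/eqP: hs; rewrite smallestE => /andP[].
  by move: (mem_sumn ms) sz; clear; lia.
apply/allpairsPdep; exists (m : nat), ((t, p2), (p3, p4)); split; rewrite ?e1 //.
  by rewrite mem_iota m0 /= add1n ltnS.
have szt s : is_partition s -> sumn s <= n -> size s < n.+1.
  by move=> /andP[_ /size_sumn h1'] h2'; rewrite ltnS (leq_trans h1').
have rng s : is_partition s -> sumn s <= n -> all (leq m) s -> all (fun x => m <= x < m + (n.+2 - m)) s.
  move=> _ hsum /allP hl; apply/allP => x xs; move: (mem_sumn xs) (hl _ xs) hsum mn => /=; clear; lia.
have pt : is_partition t.
  move: h1; rewrite e1 /is_partition st mem_cat negb_or => /andP[_ /andP[-> _]] //.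
have tn : sumn t <= n by move: sz; rewrite e1 sumn_cat; clear; lia.
have n2 : sumn p2 <= n by move: sz; clear; lia.
have n3 : sumn p3 <= n by move: sz; clear; lia.
have n4 : sumn p4 <= n by move: sz; clear; lia.
apply/allpairsP; exists ((t, p2), (p3, p4)); split=> //=.
  apply/allpairsP; exists (t, p2); split=> //=; apply: mem_plist => //.
  - exact: rng.
  - exact: szt.
  - by case/andP: h2.
  - exact: rng.
  - exact: szt.
apply/allpairsP; exists (p3, p4); split=> //=; apply: mem_plist => //.
- by case/andP: h3.
- exact: rng.
- exact: szt.
- by case/andP: h4.
- by apply/allP => x xs; move: (allP a4 _ xs) (allP b4 _ xs) => /=; clear; lia.
- exact: szt.
Qed.

(** As e > 0, m is recovered as the smallest part of the first component, and the suffix of e copies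
    cancels. *)
Lemma qlist_uniq e n : 0 < e -> uniq (qlist e n).
Proof.
move=> e0; apply: allpairs_uniq_dep; first exact: iota_uniq.
  move=> m _; apply: allpairs_uniq.
  - by apply: allpairs_uniq => [||[? ?] [? ?]]; rewrite ?plist_uniq // => _ _ [-> ->].
  - by apply: allpairs_uniq => [||[? ?] [? ?]]; rewrite ?plist_uniq // => _ _ [-> ->].
  - by move=> [? ?] [? ?] _ _ [-> ->].
have sm m p : p \in qparts n m -> smallest (p.1.1 ++ nseq e m) = Some m.
  case/allpairsP => -[s t] /= [/allpairsP[[a b] /= [/plist_parts[_ h] _ ->]] _ ->] /=.
  apply/eqP; rewrite smallestE mem_cat mem_nseq e0 eqxx orbT all_cat /=.
  apply/andP; split; first by apply: sub_all h => x /andP[].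
  by apply/allP => x; rewrite mem_nseq => /andP[_ /eqP->].
move=> x y /allpairsPdep[m [p [_ hp ->]]] /allpairsPdep[m' [p' [_ hp' ->]]] /=.
move: (sm _ _ hp) (sm _ _ hp').
case: p hp => [[a b] [c d]] hp; case: p' hp' => [[a' b'] [c' d']] hp' /= s1 s2 [e1 -> -> ->].
have em : m = m' by apply: Some_inj; rewrite -s1 -s2 e1.
have sz : size a = size a' by move: (congr1 size e1); rewrite em !size_cat => /addIn.
by move: e1; rewrite em => /eqP; rewrite eqseq_cat // => /andP[/eqP-> _].
Qed.

Lemma count_qlist e n (P : pred quadruple) : 0 < e ->
  (forall p, is_partition_quadruple n p -> P p = [exists m : 'I_n.+1, qcond e p m]) ->
  count_quadruples n P = count (fun p => qsize p == n) (qlist e n).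
Proof.
move=> e0 hP; have [l [ul ml <-]] := count_quadruplesP n P.
rewrite -size_filter; apply: perm_size; apply: uniq_perm => //.
  by apply: filter_uniq; apply: qlist_uniq.
move=> p; rewrite ml qlistP //.
by case: (boolP (is_partition_quadruple n p)) => //= h; rewrite hP.
Qed.

Lemma parts_conditionE p1 p2 p3 p4 m : smallest p1 = Some m ->
  parts_condition (p1, p2, p3, p4) = [&& all (leq m) p2, all (leq m) p3,
      all (leq m) p4 & all (fun x => x <= 2 * m) p4].
Proof. by move=> e; rewrite /parts_condition e !leqi_smallest /= largestE. Qed.

Lemma smallest_le n p1 p2 p3 p4 m : is_partition_quadruple n (p1, p2, p3, p4) ->
  smallest p1 = Some m -> m < n.+1.
Proof.
move=> /and5P[_ _ _ _ /eqP <-] /eqP; rewrite smallestE => /andP[/mem_sumn h _]; lia.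
Qed.

Lemma u_qlist n : u n = count (fun p => qsize p == n) (qlist 1 n).
Proof.
apply: count_qlist => // -[[[p1 p2] p3] p4] h.
rewrite /u_condition; apply/andP/existsP => [[]|[m /and3P[/eqP e _ h']]]; last first.
  by rewrite (parts_conditionE _ _ _ e) h'; split=> //; case: p1 e {h}.
case e : (smallest p1) => [m|]; last by case: p1 e {h}.
rewrite (parts_conditionE _ _ _ e) => _ h'.
exists (Ordinal (smallest_le h e)); rewrite /qcond e eqxx h' andbT /=.
by move/eqP: e; rewrite smallestE => /andP[]; rewrite -has_pred1 has_count.
Qed.

Lemma v_qlist n : v n = count (fun p => qsize p == n) (qlist 2 n).
Proof.
apply: count_qlist => // -[[[p1 p2] p3] p4] h.
rewrite /v_condition /smallest_repeated.
apply/andP/existsP => [[]|[m /and3P[/eqP e hc h']]]; last first.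
  by rewrite e (parts_conditionE _ _ _ e) h' hc.
case e : (smallest p1) => [m|] //; rewrite (parts_conditionE _ _ _ e) => hc h'.
by exists (Ordinal (smallest_le h e)); rewrite /qcond e eqxx h' hc.
Qed.

Local Open Scope ring_scope.

(** * Generating function of the enumerated quadruples *)

Section GeneratingFunction.
Variables (A : comNzRingType) (q : A) (n : nat).
Hypothesis qM : q ^+ n.+1 = 0.
Notation geo := (geo q n.+1).
Notation poch := (poch q).
Notation ipoch := (ipoch q n.+1).

(** Exact even before truncation: multiplicities stay below n + 1, the number of terms of [geo]. *)
Lemma gf_plist m len :
  \sum_(s <- plist n.+1 m len) q ^+ sumn s = \prod_(i < len) geo (m + i).
Proof.
elim: len => [|l IH]; first by rewrite big_seq1 big_ord0.
rewrite plistS big_allpairs_dep -[iota 0 n.+1]/(index_iota 0 n.+1) big_mkord.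
rewrite [RHS]big_ord_recr [RHS]/= mulrC -IH mulr_suml.
apply: eq_bigr => j _ /=; rewrite mulr_sumr; apply: eq_bigr => s _.
by rewrite sumn_cat sumn_nseq exprD.
Qed.

Lemma sum_pairs (T1 T2 : Type) (s1 : seq T1) (s2 : seq T2) (F1 : T1 -> A) (F2 : T2 -> A) :
  \sum_(p <- [seq (a, b) | a <- s1, b <- s2]) F1 p.1 * F2 p.2 =
  (\sum_(a <- s1) F1 a) * (\sum_(b <- s2) F2 b).
Proof.
rewrite big_allpairs_dep mulr_suml; apply: eq_bigr => a _ /=.
by rewrite mulr_sumr.
Qed.

Lemma prod_geo a len : \prod_(i < len) geo (a.+1 + i) = poch a * ipoch (a + len)%N%:Z.
Proof.
elim: len => [|l IH]; first by rewrite big_ord0 addn0 pochK.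
by rewrite big_ord_recr /= IH addnS ipochS mulrA addSn.
Qed.

Lemma gf_qlist e : (0 < e)%N -> \sum_(p <- qlist e n) q ^+ qsize p =
  ieuler q n.+1 ^+ 3 * Fser q n.+1 e.
Proof.
move=> e0; rewrite big_allpairs_dep (_ : iota 1 n = index_iota 1 n.+1); last first.
  by rewrite /index_iota subn1.
rewrite big_add1 big_mkord /Fser [X in _ * X]big_ord_recr /=.
(* The term of [Fser] for smallest part n + 1 has no counterpart in [qlist], and it vanishes because
   q^(n+1) = 0. *)
rewrite [q ^+ (e * n.+1)](qge qM); last by rewrite leq_pmull.
rewrite !mul0r addr0 mulr_sumr; apply: eq_bigr => i _.
pose w (s : seq nat) := q ^+ sumn s.
transitivity (\sum_(p <- qparts n i.+1) q ^+ (e * i.+1) *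
    ((w p.1.1 * w p.1.2) * (w p.2.1 * w p.2.2))).
  apply: eq_bigr => -[[a b] [c d]] _ /=.
  by rewrite /w sumn_cat sumn_nseq [(i.+1 * e)%N]mulnC -!exprD; congr (_ ^+ _); lia.
rewrite -mulr_sumr.
rewrite (sum_pairs _ _ (fun p => w p.1 * w p.2) (fun p => w p.1 * w p.2)) !sum_pairs.
rewrite /w !gf_plist !prod_geo.
have -> : (i + (n.+2 - i.+1) = n.+1)%N by have := ltn_ord i; lia.
have -> : (i + i.+2 = i.+1.*2)%N by lia.
by rewrite -/(ieuler q n.+1); ring.
Qed.

End GeneratingFunction.

Lemma cf_qlist (k : comNzRingType) n e : (0 < e)%N ->
  (count (fun p => qsize p == n) (qlist e n))%:R =
  cf (ieuler (qs k n) n.+1 ^+ 3 * Fser (qs k n) n.+1 e) n.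
Proof.
move=> e0; rewrite -gf_qlist //; last exact: qsM.
rewrite cf_sum -sum1_count natr_sum big_mkcond; apply: eq_bigr => p _.
by rewrite cf_qs // eq_sym; case: eqP.
Qed.

Lemma u_cf (k : comNzRingType) n :
  (u n)%:R = cf (ieuler (qs k n) n.+1 ^+ 3 * Fser (qs k n) n.+1 1) n.
Proof. by rewrite u_qlist cf_qlist. Qed.

Lemma v_cf (k : comNzRingType) n :
  (v n)%:R = cf (ieuler (qs k n) n.+1 ^+ 3 * Fser (qs k n) n.+1 2) n.
Proof. by rewrite v_qlist cf_qlist. Qed.

(** * Coefficient formulas *)

(** Frame for certificates: the difference of the two sides is displayed as a combination of known
    relations and, in positive characteristic, a multiple of the characteristic. *)
Lemma eq_from_sub0 (A : zmodType) (x y z : A) : x - y = z -> z = 0 -> x = y.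
Proof. by move=> <- /eqP; rewrite subr_eq0 => /eqP. Qed.

Section EisensteinSeries.
Variables (A : comNzRingType) (q : A) (M : nat) (D : {additive A -> A}).
Hypotheses (qM : q ^+ M = 0) (DM : forall x y, D (x * y) = D x * y + x * D y)
  (Dq : D q = q).
Notation S := (sigser q M).

Definition E2 : A := 1 - 24 * S 1.
Definition E4 : A := 1 + 240 * S 3.
Definition E6 : A := 1 - 504 * S 5.

Lemma DE2 : D E2 = - (24 * D (S 1)).
Proof. by rewrite /E2 raddfB /= (D1 DM) (Dnatl DM) sub0r. Qed.

Lemma DE4 : D E4 = 240 * D (S 3).
Proof. by rewrite /E4 raddfD /= (D1 DM) (Dnatl DM) add0r. Qed.

Lemma DE6 : D E6 = - (504 * D (S 5)).
Proof. by rewrite /E6 raddfB /= (D1 DM) (Dnatl DM) sub0r. Qed.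

Lemma DE2_E4 : 12 * D E2 = E2 ^+ 2 - E4.
Proof.
apply: (@eq_from_sub0 _ _ _ (- (48 * (12 * S 1 ^+ 2 - (5 * S 3 - 6 * D (S 1) + S 1))))).
  by rewrite DE2 /E2 /E4; ring.
by rewrite (ramanujan1 qM DM Dq) subrr mulr0 oppr0.
Qed.

Lemma DE4_E6 : 3 * D E4 = E2 * E4 - E6.
Proof.
apply: (@eq_from_sub0 _ _ _ (24 * (240 * (S 1 * S 3) + 30 * D (S 3) - (21 * S 5 + 10 * S 3 - S 1)))).
  by rewrite DE4 /E2 /E4 /E6; ring.
by rewrite (ramanujan2 qM DM Dq) subrr mulr0.
Qed.

Lemma DE6_E8 : 2 * D E6 = E2 * E6 - E4 ^+ 2.
Proof.
apply: (@eq_from_sub0 _ _ _ (- (12 * (1008 * (S 1 * S 5) - 4800 * S 3 ^+ 2 + 84 * D (S 5)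
   - (42 * S 5 + 40 * S 3 + 2 * S 1))))).
  by rewrite DE6 /E2 /E4 /E6; ring.
by rewrite (ramanujan3 qM DM Dq) subrr mulr0 oppr0.
Qed.

Lemma Dieuler3 : D (ieuler q M ^+ 3) = 3 * S 1 * ieuler q M ^+ 3.
Proof. by rewrite (DX DM) (Dieuler qM DM Dq) /=; ring. Qed.

Lemma theta_fermat p j : p \in [pchar A] -> theta q M (j + p) = theta q M (j + 1).
Proof.
move=> cp; apply: eq_bigr => m _; congr (_ * _); rewrite !exprD; congr (_ * _).
by rewrite -(pFrobenius_autE cp) pFrobenius_aut_nat expr1.
Qed.

End EisensteinSeries.

Section Coefficients.
Variables (k : fieldType) (n : nat).
Notation ser := (ser k n).

Lemma ser_nat0 m : m%:R = 0 :> k -> m%:R = 0 :> ser.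
Proof.
move=> h; apply: cfP => i _.
by rewrite -[m%:R]mulr1 cf_nat h mul0r cf0.
Qed.

Lemma cfM (x y : ser) i : (i <= n)%N ->
  cf (x * y) i = \sum_(j < i.+1) cf x j * cf y (i - j).
Proof.
move=> hi; rewrite -{1}(mksK x) -{1}(mksK y) -rmorphM cf_mks // coefM.
by [].
Qed.

(* In characteristic [p] such an [x] is a series in [q^p], so multiplication by it
   preserves the residue classes of exponents. *)
Lemma class_vanish (x y : ser) (c : k) :
  (forall j, (j <= n)%N -> j%:R != 0 :> k -> cf x j = 0) -> cf x 0 != 0 ->
  (forall N, (N <= n)%N -> N%:R = c -> cf (x * y) N = 0) ->
  forall N, (N <= n)%N -> N%:R = c -> cf y N = 0.
Proof.
move=> sx x0 hxy N; elim/ltn_ind: N => N IH hN cN.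
have := hxy N hN cN; rewrite cfM // big_ord_recl /= subn0 big1 ?addr0.
  by move/eqP; rewrite mulf_eq0 (negbTE x0) => /eqP.
move=> j _; rewrite /bump /= add1n.
have jN := ltn_ord j.
case: (eqVneq (j.+1%:R : k) 0) => hj; last by rewrite sx ?mul0r //; lia.
rewrite (IH (N - j.+1)%N) ?mulr0 //; try lia.
by rewrite natrB // hj subr0.
Qed.

Lemma Dconst_supp (x : ser) : Ds x = 0 ->
  forall j, (j <= n)%N -> j%:R != 0 :> k -> cf x j = 0.
Proof.
move=> dx j hj nj; have := cf_Ds x hj; rewrite dx cf0 => /esym/eqP.
by rewrite mulf_eq0 (negbTE nj) => /eqP.
Qed.

(** Only pairs with a b = 2 N reach the exponent N. This is where Fermat's little theorem will be
    applied to single terms. *)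
Lemma cf_gp (phi : nat -> nat -> nat) N : (N <= n)%N ->
  (forall a b, (a * b = N.*2)%N -> (phi a b)%:R = 0 :> k) ->
  cf (gp (qs k n) n.+1 (fun a b => (phi a b)%:R)) N = 0.
Proof.
move=> hN h0; rewrite cf_sum big1 // => r _; rewrite mulr_sumr cf_sum big1 // => m _.
rewrite thtE.
have -> : - ((-1) ^+ r.+1 * qs k n ^+ tri r.+1%:Z) *
   (qs k n ^+ (r.+1 * m) * (phi r.+1 (r.+1 + m.*2.+1)%N)%:R) =
   (phi r.+1 (r.+1 + m.*2.+1)%N)%:R * (- (-1) ^+ r.+1 * qs k n ^+ (tri r.+1%:Z + r.+1 * m)).
  by rewrite exprD; ring.
rewrite cf_nat; case: (eqVneq (tri r.+1%:Z + r.+1 * m)%N N) => hN'.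
  by rewrite h0 ?mul0r //; have := triE r.+1%:Z; nia.
rewrite -signr_odd; case: (odd _); rewrite ?expr1 ?expr0 ?opprK ?mul1r ?mulN1r ?cfN;
  by rewrite cf_qs // eq_sym (negbTE hN') ?oppr0 mulr0.
Qed.

Lemma cf_S_sym j N : (N <= n)%N ->
  (forall a b, (a * b = N)%N -> (a ^ j + b ^ j)%:R = 0 :> k) ->
  2 * cf (sigser (qs k n) n.+1 j) N = 0.
Proof.
move=> hN h0; rewrite -cf_nat mulr_natl mulr2n {2}S_sum exchange_big S_sum -big_split.
rewrite cf_sum big1 // => a _; rewrite -big_split cf_sum big1 // => b _ /=.
rewrite [(b.+1 * a.+1)%N]mulnC -mulrDl -!natrX -natrD cf_nat cf_qs //.
by case: eqP => [e|_]; rewrite ?mulr0 // h0 ?mul0r.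
Qed.

Lemma cf1 N : (N <= n)%N -> (0 < N)%N -> cf (1 : ser) N = 0.
Proof. by move=> hN N0; rewrite -(expr0 (qs k n)) cf_qs //; case: N N0 hN. Qed.

Lemma cf_S0 j : cf (sigser (qs k n) n.+1 j) 0 = 0.
Proof.
rewrite S_sum cf_sum big1 // => a _; rewrite cf_sum big1 // => b _.
by rewrite -natrX cf_nat cf_qs // mulr0.
Qed.

Lemma cf10 : cf (1 : ser) 0 = 1.
Proof. by rewrite -(expr0 (qs k n)) cf_qs. Qed.

Lemma cfM0 (x y : ser) : cf (x * y) 0 = cf x 0 * cf y 0.
Proof. by rewrite cfM // big_ord_recl big_ord0 addr0. Qed.

End Coefficients.

Local Opaque Fser sigser gser gp theta ieuler euler qs u v.

Section Generating.
Variables (k : fieldType) (n : nat).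
Notation ser := (ser k n).
Notation q := (qs k n).
Notation D := (@Ds k n).
Notation S := (sigser q n.+1).
Notation G := (gser q n.+1).
Notation K := (ieuler q n.+1 ^+ 3).
Notation theta := (theta q n.+1).
Let qM := @qsM k n.
Let DM := @DsM k n.
Let Dq := @Ds_qs k n.

Lemma DK : D K = 3 * S 1 * K.
Proof. exact: Dieuler3 qM DM Dq. Qed.

Lemma thetaK : theta 1 * K = 1.
Proof. by rewrite (theta1 qM) -exprMn (eulerK qM) expr1n. Qed.

(** [ser_appell3] eliminates G 3 from [Fser1], and D K = 3 S 1 K absorbs the product G 1 S 1 into D
    (G 1 K). *)
Lemma gen_u : 2 * (K * Fser q n.+1 1) = 8 * D (G 1 * K) - 6 * (D (S 1) * K).
Proof.
rewrite mulrCA (Fser1 qM DM Dq) DM DK.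
apply: (@eq_from_sub0 _ _ _ (- (K * (G 3 + 6 * D (G 1) - G 1 + 24 * (G 1 * S 1) - 6 * D (S 1))))).
  by ring.
by rewrite ser_appell3 subrr mulr0 oppr0.
Qed.

Lemma gen_v : K * Fser q n.+1 2 = K * Fser q n.+1 1 - G 1 * K.
Proof.
have H (a b g c : ser) : a - b = g -> c * b = c * a - g * c by move=> <-; ring.
exact: H (Fser_sub qM).
Qed.

Definition cm : k := cf (G 1 * K) n.
Definition cr : k := cf (D (S 1) * K) n.
Definition ck : k := cf K n.

Lemma u_coef : 2 * (u n)%:R = 8 * n%:R * cm - 6 * cr :> k.
Proof. by rewrite (u_cf k n) -cf_nat gen_u cfB !cf_nat cf_Ds // mulrA. Qed.

Lemma v_coef : (v n)%:R = (u n)%:R - cm :> k.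
Proof. by rewrite (v_cf k n) (u_cf k n) /cm -cfB -gen_v. Qed.

Definition Bs : ser := E2 q n.+1 - 24 * G 1.
Definition Cs : ser := E4 q n.+1 - 24 * G 3.

Lemma DBs : D Bs = - (24 * D (S 1)) - 24 * D (G 1).
Proof. by rewrite raddfB /= (DE2 q n.+1 DM) (Dnatl DM). Qed.

(** Since 2^1 - 1 = 1, S 1 and G 1 merge by [gp_powers] into one sum over pairs, to which [cf_gp]
    applies. *)
Lemma BsE : Bs = 1 - 24 * gp q n.+1 (fun _ b => b%:R ^+ 1).
Proof. by rewrite (gpb qM) /Bs /E2; ring. Qed.

(** -6 times the Serre derivative D B - E_2 B / 6 of B regarded as of weight 2. *)
Lemma serre_Bs : Cs = E2 q n.+1 * Bs - 6 * D Bs.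
Proof.
apply: (@eq_from_sub0 _ _ _ (- (24 * (G 3 + 6 * D (G 1) - G 1 + 24 * (G 1 * S 1) - 6 * D (S 1)))
  - 48 * (12 * S 1 ^+ 2 - (5 * S 3 - 6 * D (S 1) + S 1)))).
  by rewrite DBs /Cs /Bs /E2 /E4; ring.
by rewrite ser_appell3 (ramanujan1 qM DM Dq) !subrr !mulr0 oppr0 addr0.
Qed.

End Generating.

(** * The congruences *)

Section Abstract5.
Variables (A : comNzRingType) (h5 : 5 = 0 :> A).

(** The right side keeps D P because, times K, it is D (D K) + D K. *)
Lemma char5_DP (P S3 DP : A) : 12 * P ^+ 2 = 5 * S3 - 6 * DP + P ->
  DP = 3 * DP + 9 * P ^+ 2 + 3 * P.
Proof.
move=> r1; apply: (@eq_from_sub0 _ _ _ (- (2 * (12 * P ^+ 2 - (5 * S3 - 6 * DP + P))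
  + 5 * (P - 2 * DP - 3 * P ^+ 2 + 2 * S3)))); first by ring.
by rewrite r1 h5 subrr mulr0 mul0r addr0 oppr0.
Qed.

Lemma char5_BC (P S3 DP G1 G3 DG1 B C DB : A) :
  12 * P ^+ 2 = 5 * S3 - 6 * DP + P ->
  G3 + 6 * DG1 - G1 + 24 * (G1 * P) = 6 * DP ->
  B = 1 - 24 * P - 24 * G1 -> DB = - (24 * DP) - 24 * DG1 -> C = 1 + 240 * S3 - 24 * G3 ->
  (1 + 3 * P) * B = 3 * (B + DB + C).
Proof.
move=> r1 a3 -> -> ->; apply: (@eq_from_sub0 _ _ _ (4 * (12 * P ^+ 2 - (5 * S3 - 6 * DP + P))
  + 2 * (G3 + 6 * DG1 - G1 + 24 * (G1 * P) - 6 * DP)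
  + 5 * (12 * DG1 + 12 * DP + 10 * G1 - 24 * (G1 * P) + 14 * G3 + 11 * P
         - 24 * (P ^+ 2) - 140 * S3 - 1))); first by ring.
by rewrite r1 a3 h5 !subrr !mulr0 mul0r !addr0.
Qed.

(** Expresses D ((1 + 3 P) theta_1) = 0. Modulo 5, 2 (1 + 3 P) theta_1 = theta_1 + theta_3, and x +
    x^3 with x = 2 m + 1 is 2 x if 5 divides m (m + 1) / 2 and 0 otherwise: (1 + 3 P) theta_1 is the
    part of theta_1 with exponents divisible by 5. *)
Lemma char5_const (P S3 DP : A) : 12 * P ^+ 2 = 5 * S3 - 6 * DP + P ->
  3 * DP - 3 * P - 9 * P ^+ 2 = 0.
Proof.
move=> r1; transitivity (3 * (12 * P ^+ 2 - (5 * S3 - 6 * DP + P))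
  + 5 * (3 * S3 - 3 * DP - 9 * P ^+ 2)); first by ring.
by rewrite r1 h5 subrr mulr0 mul0r addr0.
Qed.

Lemma final5_u3 (m c : A) : 24 * m = (1 - 8 * 3) * c ->
  8 * 3 * m - 6 * (3 * (3 + 1) * c) = 0.
Proof.
move=> e; transitivity (24 * m - (1 - 8 * 3) * c + 5 * (- (19 * c))); first by ring.
by rewrite e subrr h5 mul0r addr0.
Qed.

Lemma final5_v1 (m c : A) : 24 * m = (1 - 8 * 1) * c ->
  8 * 1 * m - 6 * (1 * (1 + 1) * c) - 2 * m = 0.
Proof.
move=> e; transitivity (- (6 * (24 * m - (1 - 8 * 1) * c)) + 5 * (30 * m + 6 * c)).
  by ring.
by rewrite e subrr mulr0 oppr0 h5 mul0r addr0.
Qed.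

Lemma final5_v4 (m c : A) : 8 * 4 * m - 6 * (4 * (4 + 1) * c) - 2 * m = 0.
Proof. by transitivity (5 * (6 * m - 24 * c)); [ring | rewrite h5 mul0r]. Qed.

End Abstract5.

Section Abstract7.
Variables (A : comNzRingType) (h7 : 7 = 0 :> A).

(** E_6 = 1 modulo 7, so this is E_2 = E_4^2; hence all of P, D P and E_4 become polynomials in
    S_3. *)
Lemma char7_P (P S3 S5 DS5 : A) :
  1008 * (P * S5) - 4800 * S3 ^+ 2 + 84 * DS5 = 42 * S5 + 40 * S3 + 2 * P ->
  P = S3 ^+ 2 + S3.
Proof.
move=> r3; apply: (@eq_from_sub0 _ _ _ (3 * (1008 * (P * S5) - 4800 * S3 ^+ 2 + 84 * DS5
   - (42 * S5 + 40 * S3 + 2 * P)) + 7 * (P - 432 * (P * S5) + 2057 * S3 ^+ 2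
   - 36 * DS5 + 18 * S5 + 17 * S3))); first by ring.
by rewrite r3 h7 subrr mulr0 mul0r addr0.
Qed.

Lemma char7_DS3 (P S3 S5 DS3 : A) : P = S3 ^+ 2 + S3 ->
  240 * (P * S3) + 30 * DS3 = 21 * S5 + 10 * S3 - P ->
  DS3 = - S3 ^+ 3 + 2 * S3 ^+ 2 + S3.
Proof.
move=> -> r2; apply: (@eq_from_sub0 _ _ _ (4 * (240 * ((S3 ^+ 2 + S3) * S3) + 30 * DS3
   - (21 * S5 + 10 * S3 - (S3 ^+ 2 + S3))) + 7 * (12 * S5 - 17 * DS3 - 137 * S3 ^+ 3
   - 138 * S3 ^+ 2 + 5 * S3))); first by ring.
by rewrite r2 h7 subrr mulr0 mul0r addr0.
Qed.

Variables (D : {additive A -> A}) (P s K : A).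
Hypotheses (DM : forall x y, D (x * y) = D x * y + x * D y)
  (Ps : P = s ^+ 2 + s) (Dss : D s = - s ^+ 3 + 2 * s ^+ 2 + s) (DK : D K = 3 * P * K).

Lemma char7_DP : D P = (2 * s + 1) * D s.
Proof. by rewrite Ps raddfD /= (DX DM) /=; ring. Qed.

(** 1 + 2 s is E_4 modulo 7. On coefficients x of E_4 K and c of K at n it reads (n - 1)^2 x = (1 -
    n) c, which determines x unless n = 1. *)
Lemma char7_E4 : D (D ((1 + 2 * s) * K)) - 2 * D ((1 + 2 * s) * K) + (1 + 2 * s) * K = K - D K.
Proof.
have e1 : D ((1 + 2 * s) * K) = (- (2 * s) - s ^+ 2 - 3 * s ^+ 3) * K.
  rewrite DM raddfD /= (D1 DM) (Dnatl DM) DK Dss Ps.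
  apply: (@eq_from_sub0 _ _ _ (7 * (s + 2 * s ^+ 2 + s ^+ 3) * K)); first by ring.
  by rewrite h7 !mul0r.
rewrite !e1 DM !(raddfB, raddfN) /= !(Dnatl DM) !(DX DM) /= DK Dss Ps.
apply: (@eq_from_sub0 _ _ _ (7 * (s - s ^+ 2 - 2 * s ^+ 3 - 4 * s ^+ 4) * K)); first by ring.
by rewrite h7 !mul0r.
Qed.

Lemma char7_DPK : D P * K = 3 * ((1 + 2 * s) * K) - 3 * (D (D K) - 2 * D K + K).
Proof.
rewrite DK DM DM DK (Dnat DM) char7_DP Dss Ps.
apply: (@eq_from_sub0 _ _ _ (7 * (7 * s ^+ 2 - 2 * s + 12 * s ^+ 3 + s ^+ 4) * K)); first by ring.
by rewrite h7 !mul0r.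
Qed.

(** The left factor is (theta_5 + theta_3 + theta_1) / theta_1; on the right all products with E_2
    and E_4 are gone, so coefficients can be read off. *)
Lemma char7_BC (e2 e4 S5 B C DB DDB DC De2 G5 : A) :
  C = e2 * B - 6 * DB -> DC = De2 * B + e2 * DB - 6 * DDB ->
  216 * G5 - 9 * (1 - 504 * S5) = 30 * DC - 10 * (e2 * C) + e4 * B ->
  12 * De2 = e2 ^+ 2 - e4 ->
  (4 * e2 ^+ 2 - 3 * e4 + e2 + 1) * B = 3 * DC - 2 * DDB + 4 * G5 - 6 + C - DB + B.
Proof.
move=> h1 dh1 a5 he.
apply: (@eq_from_sub0 _ _ _ (6 * (C - (e2 * B - 6 * DB)) + 2 * e2 * (C - (e2 * B - 6 * DB))
  + 5 * (DC - (De2 * B + e2 * DB - 6 * DDB))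
  + 4 * (216 * G5 - 9 * (1 - 504 * S5) - (30 * DC - 10 * (e2 * C) + e4 * B))
  + B * (12 * De2 - (e2 ^+ 2 - e4))
  + 7 * (6 - B * De2 + B * e2 + B * e2 ^+ 2 - C - 6 * (C * e2) - 5 * DB - DB * e2
     + 16 * DC - 4 * DDB - 124 * G5 - 2592 * S5))); first by ring.
by rewrite -h1 -dh1 a5 he h7 !subrr !mulr0 mul0r !addr0.
Qed.

Lemma char7_theta (e2 e4 De2 : A) : 12 * De2 = e2 ^+ 2 - e4 ->
  e2 ^+ 2 + 8 * De2 = 4 * e2 ^+ 2 - 3 * e4.
Proof.
move=> he; apply: (@eq_from_sub0 _ _ _ (3 * (12 * De2 - (e2 ^+ 2 - e4)) - 7 * (4 * De2))).
  by ring.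
by rewrite he h7 subrr mulr0 mul0r subr0.
Qed.

Lemma final7_u5 (m c x r : A) : 24 * m = (1 - 8 * 5) * c ->
  5 * (5 * x) - 2 * (5 * x) + x = c - 5 * c ->
  r = 3 * x - 3 * (5 * (5 * c) - 2 * (5 * c) + c) -> 8 * 5 * m - 6 * r = 0.
Proof.
move=> em ex ->; transitivity (4 * (24 * m - (1 - 8 * 5) * c)
  + 5 * (5 * (5 * x) - 2 * (5 * x) + x - (c - 5 * c)) + 7 * (16 * c - 8 * m - 14 * x)).
  by ring.
by rewrite em ex !subrr !mulr0 h7 mul0r !addr0.
Qed.

End Abstract7.

Lemma mod_Fp p m : prime p -> m%:R = 0 :> 'F_p -> m = 0 %[mod p].
Proof. by move=> pp /eqP; rewrite -(dvdn_pcharf (pchar_Fp pp)) mod0n => /eqP. Qed.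

Lemma double_Fp p m : prime p -> (2 < p)%N -> 2 * m%:R = 0 :> 'F_p -> m%:R = 0 :> 'F_p.
Proof.
move=> pp p2 /eqP; rewrite mulf_eq0 => /orP[|/eqP//].
by rewrite -(dvdn_pcharf (pchar_Fp pp)) => /dvdn_leq; lia.
Qed.

Lemma pow_Fp p a : prime p -> a%:R ^+ p = a%:R :> 'F_p.
Proof. by move=> pp; rewrite -(pFrobenius_autE (pchar_Fp pp)) pFrobenius_aut_nat. Qed.

Lemma char_ser p n : prime p -> p%:R = 0 :> ser 'F_p n.
Proof. by move=> pp; apply: ser_nat0; exact: pchar_Fp_0. Qed.

Lemma pchar_ser p n : prime p -> p \in [pchar ser 'F_p n].
Proof. by move=> pp; rewrite inE pp char_ser //=. Qed.

Lemma cf_BK (k : fieldType) n : cf (Bs k n * ieuler (qs k n) n.+1 ^+ 3) n = 0 ->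
  24 * cm k n = (1 - 8 * n%:R) * ck k n.
Proof.
set K := ieuler _ _ ^+ 3 => h; rewrite -cf_nat -/K.
have e : forall P g b : ser k n, Ds K = 3 * P * K -> b = 1 - 24 * P - 24 * g ->
    24 * (g * K) = K - 8 * Ds K - b * K by move=> P g b -> ->; ring.
by rewrite (e _ _ _ (DK k n) (erefl _)) !cfB h subr0 cf_nat cf_Ds //= /ck -/K; ring.
Qed.

Lemma Ds_natl (k : comNzRingType) n m (x : ser k n) : Ds (m%:R * x) = m%:R * Ds x.
Proof. exact: (Dnatl (@DsM k n)). Qed.

Lemma Ds_1 (k : comNzRingType) n : Ds (1 : ser k n) = 0.
Proof. exact: (D1 (@DsM k n)). Qed.

Lemma Ds_add (k : comNzRingType) n (x y : ser k n) : Ds (x + y) = Ds x + Ds y.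
Proof. exact: (raddfD (@Ds k n)). Qed.

Lemma Ds_sub (k : comNzRingType) n (x y : ser k n) : Ds (x - y) = Ds x - Ds y.
Proof. exact: (raddfB (@Ds k n)). Qed.

Lemma Ds_theta1 (k : comNzRingType) n :
  Ds (theta (qs k n) n.+1 1) = - (3 * sigser (qs k n) n.+1 1 * theta (qs k n) n.+1 1).
Proof. exact: (Dtheta1 (@qsM k n) (@DsM k n) (@Ds_qs k n)). Qed.

Lemma theta_unit (k : fieldType) n : cf (theta (qs k n) n.+1 1) 0 != 0.
Proof.
have := congr1 (fun x => cf x 0) (thetaK k n); rewrite /= cfM0 cf10 => e.
by apply/eqP => h; move/eqP: e; rewrite h mul0r eq_sym oner_eq0.
Qed.

Lemma cf_Bs (k : fieldType) n N : (N <= n)%N -> (0 < N)%N ->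
  cf (Bs k n) N = - (24 * cf (gp (qs k n) n.+1 (fun _ b => b%:R ^+ 1)) N).
Proof. by move=> hN N0; rewrite BsE cfB cf_nat cf1 // sub0r. Qed.

Lemma cf_Cs (k : fieldType) n N : (N <= n)%N -> (0 < N)%N ->
  cf (Cs k n) N = 240 * cf (sigser (qs k n) n.+1 3) N - 24 * cf (gser (qs k n) n.+1 3) N.
Proof. by move=> hN N0; rewrite /Cs /E4 cfB cfD !cf_nat cf1 // add0r. Qed.

(** * Residue classes modulo 5, 3, 7 and 13 *)

Section Mod5.
Variable n : nat.
Notation k := 'F_5.
Notation q := (qs k n).
Notation S := (sigser q n.+1).
Notation G := (gser q n.+1).
Notation K := (ieuler q n.+1 ^+ 3).
Let R1 : 12 * S 1 ^+ 2 = 5 * S 3 - 6 * Ds (S 1) + S 1 :=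
  ramanujan1 (@qsM k n) (@DsM k n) (@Ds_qs k n).
Let h5 : 5 = 0 :> ser k n := char_ser n (isT : prime 5).

Lemma cr5 : cr k n = n%:R * (n%:R + 1) * ck k n.
Proof.
have e : Ds (S 1) * K = Ds (Ds K) + Ds K.
  rewrite DK (DsM (3 * S 1)) DK Ds_natl.
  have := char5_DP h5 R1; move: (S 1) (Ds (S 1)) K => a b c dp.
  by transitivity ((3 * b + 9 * a ^+ 2 + 3 * a) * c); [rewrite -dp | ring].
by rewrite /cr /ck e cfD !cf_Ds //; ring.
Qed.

(** Multiplication by the unit (1 + 3 S 1) theta_1, a series in q^5 up to truncation, turns B K into
    3 (B + D B + C), whose coefficients are explicit. *)
Lemma BK5 (c : k) : (c == 1) || (c == 3) -> n%:R = c -> cf (Bs k n * K) n = 0.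
Proof.
move=> hc; have c0 : c != 0 by case/orP: hc => /eqP->.
(* For a b = 2 c and a^5 = a, the term (c + 1) b + a^3 times a^2 is a (2 c (c + 1) + 1); the classes
   1 and 3 are the roots of this factor. *)
have cc : 2 * c * (c + 1) + 1 = 0 by case/orP: hc => /eqP->; apply/eqP.
suff H N : (N <= n)%N -> N%:R = c -> cf (Bs k n * K) N = 0 by exact: H.
apply: (@class_vanish _ _ ((1 + 3 * S 1) * theta q n.+1 1)).
- apply: Dconst_supp; rewrite DsM Ds_add Ds_1 Ds_natl.
  rewrite Ds_theta1.
  have := char5_const h5 R1; move: (S 1) (Ds (S 1)) (theta q n.+1 1) => a b t e.
  transitivity ((3 * b - 3 * a - 9 * a ^+ 2) * t); first by ring.
  by rewrite e mul0r.
- rewrite cfM0 mulf_neq0 ?theta_unit // cfD cf10 cf_nat cf_S0 mulr0 addr0.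
  exact: oner_neq0.
move=> {}N hN Nc.
have N0 : (0 < N)%N by case: N Nc {hN} => // /esym/eqP; rewrite (negbTE c0).
have -> : (1 + 3 * S 1) * theta q n.+1 1 * (Bs k n * K) = (1 + 3 * S 1) * Bs k n.
  have := thetaK k n; move: (theta _ _ 1) K (1 + 3 * S 1) (Bs k n) => t l a b e.
  by transitivity (a * b * (t * l)); [ring | rewrite e mulr1].
have eB : Bs k n = 1 - 24 * S 1 - 24 * G 1 by [].
have eC : Cs k n = 1 + 240 * S 3 - 24 * G 3 by [].
rewrite (char5_BC h5 R1 (ser_appell3 k n) eB (DBs k n) eC).
have e3 : G 3 = gp q n.+1 (fun a _ => (a ^ 3)%:R).
  by apply: eq_gp => a b; rewrite natrX.
have H : cf (gp q n.+1 (fun a b => (N.+1 * b + a ^ 3)%:R)) N = 0.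
  apply: cf_gp => // a b hab; rewrite natrD natrM natrX -natr1 Nc.
  have xy : a%:R * b%:R = 2 * c :> k by rewrite -natrM hab -mul2n natrM Nc.
  have x0 : a%:R != 0 :> k.
    apply/eqP => a0; move/eqP: xy; rewrite a0 mul0r eq_sym mulf_eq0 (negbTE c0) orbF.
    by rewrite -(dvdn_pcharf (pchar_Fp _)).
  have x5 := @pow_Fp 5 a isT.
  apply: (mulfI (expf_neq0 2 x0)); rewrite mulr0.
  transitivity (a%:R * ((c + 1) * (a%:R * b%:R)) + a%:R ^+ 5 : k); first by ring.
  by rewrite xy x5 -[X in _ + X]mulr1 -mulrDr [(c + 1) * _]mulrC cc mulr0.
have H' : N.+1%:R * cf (gp q n.+1 (fun _ b => b%:R ^+ 1)) N + cf (G 3) N = 0.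
  rewrite -H e3 -cf_nat -cfD -gpZ -gpD; congr (cf _ N).
  by apply: eq_gp => a b; rewrite natrD natrM.
rewrite cf_nat cfD [cf (Bs k n + _) N]cfD cf_Ds // cf_Bs // cf_Cs //.
have h5k : 5 = 0 :> k by apply/eqP.
move: H'; rewrite -natr1; move: (cf (gp _ _ _) N) (cf (G 3) N) (cf (S 3) N) (N%:R : k) => g g3 s x H'.
transitivity (- (72 * ((x + 1) * g + g3)) + 5 * (144 * s)); first by ring.
by rewrite H' h5k mulr0 mul0r addr0 oppr0.
Qed.

Lemma u5_0 : n%:R = 0 :> k -> (u n)%:R = 0 :> k.
Proof.
move=> n0; apply: (double_Fp (p := 5) isT isT); rewrite u_coef cr5 n0; ring.
Qed.

Lemma u5_3 : n%:R = 3 :> k -> (u n)%:R = 0 :> k.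
Proof.
move=> n3; apply: (double_Fp (p := 5) isT isT); rewrite u_coef cr5.
have := cf_BK (BK5 (c := 3) isT n3); rewrite n3; exact: (final5_u3 (pchar_Fp_0 (isT : prime 5))).
Qed.

Lemma v5_1 : n%:R = 1 :> k -> (v n)%:R = 0 :> k.
Proof.
move=> n1; apply: (double_Fp (p := 5) isT isT); rewrite v_coef mulrBr u_coef cr5.
have := cf_BK (BK5 (c := 1) isT n1); rewrite n1; exact: (final5_v1 (pchar_Fp_0 (isT : prime 5))).
Qed.

Lemma v5_4 : n%:R = 4 :> k -> (v n)%:R = 0 :> k.
Proof.
move=> n4; apply: (double_Fp (p := 5) isT isT); rewrite v_coef mulrBr u_coef cr5 n4.
exact: (final5_v4 (pchar_Fp_0 (isT : prime 5))).
Qed.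

End Mod5.

Section Mod3.
Variable n : nat.
Notation k := 'F_3.

Let final3 (m r : k) : 8 * 0 * m - 6 * r = 0 /\ 8 * 1 * m - 6 * r - 2 * m = 0.
Proof.
have h3 : 3 = 0 :> k by exact: pchar_Fp_0.
split; first by transitivity (3 * (- (2 * r))); [ring | rewrite h3 mul0r].
by transitivity (3 * (2 * m - 2 * r)); [ring | rewrite h3 mul0r].
Qed.

Lemma u3_0 : n%:R = 0 :> k -> (u n)%:R = 0 :> k.
Proof.
move=> n0; apply: (double_Fp (p := 3) isT isT); rewrite u_coef n0.
exact: (proj1 (final3 _ _)).
Qed.

Lemma v3_1 : n%:R = 1 :> k -> (v n)%:R = 0 :> k.
Proof.
move=> n1; apply: (double_Fp (p := 3) isT isT); rewrite v_coef mulrBr u_coef n1.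
exact: (proj2 (final3 _ _)).
Qed.

End Mod3.

Section Mod7.
Variable n : nat.
Notation k := 'F_7.
Notation q := (qs k n).
Notation S := (sigser q n.+1).
Notation G := (gser q n.+1).
Notation K := (ieuler q n.+1 ^+ 3).
Notation e2 := (E2 q n.+1).
Notation e4 := (E4 q n.+1).
Notation th := (theta q n.+1).
Let h7 : 7 = 0 :> ser k n := char_ser n (isT : prime 7).
Let R2 : 240 * (S 1 * S 3) + 30 * Ds (S 3) = 21 * S 5 + 10 * S 3 - S 1 :=
  ramanujan2 (@qsM k n) (@DsM k n) (@Ds_qs k n).
Let R3 : 1008 * (S 1 * S 5) - 4800 * S 3 ^+ 2 + 84 * Ds (S 5) = 42 * S 5 + 40 * S 3 + 2 * S 1 :=
  ramanujan3 (@qsM k n) (@DsM k n) (@Ds_qs k n).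
Let Ps : S 1 = S 3 ^+ 2 + S 3 := char7_P h7 R3.
Let Dss : Ds (S 3) = - S 3 ^+ 3 + 2 * S 3 ^+ 2 + S 3 := char7_DS3 h7 Ps R2.
Let he : 12 * Ds e2 = e2 ^+ 2 - e4 := DE2_E4 (@qsM k n) (@DsM k n) (@Ds_qs k n).

Definition cx7 : k := cf ((1 + 2 * S 3) * K) n.

Lemma cx7E : n%:R * (n%:R * cx7) - 2 * (n%:R * cx7) + cx7 = ck k n - n%:R * ck k n.
Proof.
have e : Ds (Ds ((1 + 2 * S 3) * K)) - 2 * Ds ((1 + 2 * S 3) * K) + (1 + 2 * S 3) * K = K - Ds K.
  exact: (@char7_E4 _ h7 (@Ds k n) _ _ _ (@DsM k n) Ps Dss (DK k n)).
by have := congr1 (fun y => cf y n) e; rewrite /= cfD !cfB cf_nat !cf_Ds.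
Qed.

Lemma cr7 : cr k n = 3 * cx7 - 3 * (n%:R * (n%:R * ck k n) - 2 * (n%:R * ck k n) + ck k n).
Proof.
have e : Ds (S 1) * K = 3 * ((1 + 2 * S 3) * K) - 3 * (Ds (Ds K) - 2 * Ds K + K).
  exact: (@char7_DPK _ h7 (@Ds k n) _ _ _ (@DsM k n) Ps Dss (DK k n)).
by rewrite /cr e cfB !cf_nat cfD cfB cf_nat !cf_Ds.
Qed.

Lemma u7_0 : n%:R = 0 :> k -> (u n)%:R = 0 :> k.
Proof.
move=> n0; apply: (double_Fp (p := 7) isT isT); have := cx7E; rewrite u_coef cr7 n0.
move: cx7 (ck k n) (cm k n) => x c m e.
have -> : x = c by transitivity (0 * (0 * x) - 2 * (0 * x) + x); [ring | rewrite e; ring].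
ring.
Qed.

(** For x = 2 m + 1 modulo 7, x + x^3 + x^5 is 3 x if x^2 = 1, that is if 7 divides m (m + 1) / 2,
    and 0 otherwise. So the sum is three times the part of theta_1 with exponents divisible by 7. *)
Lemma theta_sum7 : th 5 + th 3 + th 1 = (4 * e2 ^+ 2 - 3 * e4 + e2 + 1) * th 1.
Proof.
have t5 : th 5 = (e2 ^+ 2 - 192 * Ds (S 1)) * th 1 := theta5 (@qsM k n) (@DsM k n) (@Ds_qs k n).
have t3 : th 3 = e2 * th 1 := theta3 (@qsM k n) (@DsM k n) (@Ds_qs k n).
have d : Ds e2 = - (24 * Ds (S 1)) := DE2 q n.+1 (@DsM k n).
have := char7_theta h7 he; rewrite t5 t3 d.
move: e2 e4 (th 1) (Ds (S 1)) => a b t p <-; ring.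
Qed.

(** By [theta_rec] the operator 8 D telescopes on the sum, and Fermat closes it with theta_7 =
    theta_1. *)
Lemma Dtheta_sum7 : Ds (th 5 + th 3 + th 1) = 0.
Proof.
have tr j : th j.+2 = 8 * Ds (th j) + th j := theta_rec n.+1 (@DsM k n) (@Ds_qs k n) j.
have f : th 7 = th 1 := theta_fermat q n.+1 0 (pchar_ser n (isT : prime 7)).
rewrite !Ds_add; move: f; rewrite [th 7]tr; move: (tr 3) (tr 1).
move: (th 5) (th 3) (th 1) (Ds (th 5)) (Ds (th 3)) (Ds (th 1)) => a b c x y z ea eb ec.
transitivity (8 * x + a - c + (8 * y + b - a) + (8 * z + c - b) - 7 * (x + y + z)); first by ring.
  by rewrite ec -ea -eb !subrr h7 mul0r !(addr0, subr0, oppr0).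
Qed.

Lemma BK7 : n%:R = 5 :> k -> cf (Bs k n * K) n = 0.
Proof.
suff H N : (N <= n)%N -> N%:R = 5 :> k -> cf (Bs k n * K) N = 0 by exact: H.
apply: (@class_vanish _ _ (th 5 + th 3 + th 1)).
- exact: Dconst_supp Dtheta_sum7.
- rewrite theta_sum7 cfM0 mulf_neq0 ?theta_unit //.
  rewrite !(cfD, cfN) !cf_nat expr2 cfM0 /E2 /E4 !(cfD, cfN) !cf_nat !cf_S0 !cf10.
  by rewrite !mulr0 !subr0 !addr0 !mulr1; apply/eqP => /(congr1 val).
move=> {}N hN Nc.
have N0 : (0 < N)%N by case: N Nc {hN} => // /(congr1 val).
have -> : (th 5 + th 3 + th 1) * (Bs k n * K) = (4 * e2 ^+ 2 - 3 * e4 + e2 + 1) * Bs k n.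
  rewrite theta_sum7; have := thetaK k n.
  move: (th 1) K (4 * e2 ^+ 2 - 3 * e4 + e2 + 1) (Bs k n) => t l a b e.
  by transitivity (a * b * (t * l)); [ring | rewrite e mulr1].
have h1 := serre_Bs k n.
have dh1 : Ds (Cs k n) = Ds e2 * Bs k n + e2 * Ds (Bs k n) - 6 * Ds (Ds (Bs k n)).
  by rewrite {1}h1 (Ds_sub (e2 * _)) (DsM e2) (Ds_natl 6).
have a5 : 216 * G 5 - 9 * (1 - 504 * S 5) =
  30 * Ds (Cs k n) - 10 * (e2 * Cs k n) + e4 * Bs k n := ser_appell5 k n.
rewrite (char7_BC h7 h1 dh1 a5 he).
(* Both N = 5 and 2 N = 3 are non-residues modulo 7, so their cubes are -1 and a^3 = - b^3 whenever
   a b is one of them. *)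
have pw c (a b : nat) : (a * b)%:R = c :> k -> c ^+ 3 = - 1 -> (a ^ 3 + b ^ 3)%:R = 0 :> k.
  rewrite natrM natrD !natrX => xy cc; have x7 := @pow_Fp 7 a isT.
  have x0 : a%:R != 0 :> k.
    apply/eqP => a0; move: cc; rewrite -xy a0 mul0r expr0n /= => /eqP.
    by rewrite eq_sym oppr_eq0 oner_eq0.
  apply: (mulfI (expf_neq0 4 x0)); rewrite mulr0.
  transitivity (a%:R ^+ 7 + a%:R * (a%:R * b%:R) ^+ 3 : k); first by ring.
  by rewrite x7 xy cc mulrN1 subrr.
have s0 : cf (S 3) N = 0.
  have two : (2 : k) != 0 by apply/eqP => /(congr1 val).
  apply: (mulfI two); rewrite mulr0; apply: cf_S_sym => // a b ab.
  by apply: (pw 5); [rewrite ab | apply/eqP].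
have N2 (a b : nat) : (a * b = N.*2)%N -> (a * b)%:R = 3 :> k.
  by move=> ->; rewrite -mul2n natrM Nc; apply/eqP.
have g0 : cf (G 3) N = 0.
  have two : (2 : k) != 0 by apply/eqP => /(congr1 val).
  apply: (mulfI two); rewrite mulr0.
  have : cf (gp q n.+1 (fun a b => (a ^ 3 + b ^ 3)%:R)) N = 0.
    by apply: cf_gp => // a b /N2 ab; apply: (pw 3) => //; apply/eqP.
  rewrite (eq_gp _ _ (psi := fun a b => a%:R ^+ 3 + b%:R ^+ 3)) => [|a b]; last first.
    by rewrite natrD !natrX.
  rewrite (gp_sum (@qsM k n)) cfD cf_nat => e0; rewrite -e0.
  have -> : (2 ^+ 3 - 1) * S 3 = 7 * S 3 by move: (S 3) => s; ring.
  by rewrite cf_nat s0 mulr0 addr0.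
(* With a b = 3 and a^7 = a, the term times a^2 is 3 a + 4 a = 0. *)
have H : cf (gp q n.+1 (fun a b => (b + 4 * a ^ 5)%:R)) N = 0.
  apply: cf_gp => // a b /N2; rewrite natrM natrD natrM natrX => xy.
  have x7 := @pow_Fp 7 a isT.
  have x0 : a%:R != 0 :> k.
    by apply/eqP => a0; move: xy; rewrite a0 mul0r => /(congr1 val).
  apply: (mulfI (expf_neq0 2 x0)); rewrite mulr0.
  transitivity (a%:R * (a%:R * b%:R) + 4 * a%:R ^+ 7 : k); first by ring.
  rewrite xy x7; transitivity (7 * a%:R : k); first by ring.
  by rewrite (pchar_Fp_0 (isT : prime 7)) mul0r.
have H' : cf (gp q n.+1 (fun _ b => b%:R ^+ 1)) N + 4 * cf (G 5) N = 0.
  rewrite -H -cf_nat -cfD -gpZ -gpD; congr (cf _ N).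
  by apply: eq_gp => a b; rewrite natrD natrM natrX.
have c6 : cf (6 : ser k n) N = 0 by rewrite -[6]mulr1 cf_nat cf1 // mulr0.
rewrite cfD cfB cfD [cf (_ - 6) N]cfB cfD cfB !cf_nat !cf_Ds // c6 cf_Bs // cf_Cs // s0 g0 Nc.
move: H'; move: (cf (gp _ _ _) N) (cf (G 5) N) => g g5 H'.
transitivity (g + 4 * g5 + 7 * (185 * g)); first by ring.
by rewrite H' (pchar_Fp_0 (isT : prime 7)) mul0r addr0.
Qed.

Lemma u7_5 : n%:R = 5 :> k -> (u n)%:R = 0 :> k.
Proof.
move=> n5; apply: (double_Fp (p := 7) isT isT); rewrite u_coef.
have := cr7; have := cx7E; have := cf_BK (BK7 n5); rewrite n5.
exact: (final7_u5 (pchar_Fp_0 (isT : prime 7))).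
Qed.

End Mod7.

Section Char13.
Variables (A : comNzRingType) (h13 : 13 = 0 :> A) (d a b : A).

Lemma char13_solve12 : 12 * d = a - b -> d = b - a.
Proof.
move=> e; apply: (@eq_from_sub0 _ _ _ (13 * d - (12 * d - (a - b)))); first by ring.
by rewrite e subrr h13 mul0r subr0.
Qed.

Lemma char13_solve3 : 3 * d = a - b -> d = 4 * b - 4 * a.
Proof.
move=> e; apply: (@eq_from_sub0 _ _ _ (13 * d - 4 * (3 * d - (a - b)))); first by ring.
by rewrite e subrr h13 mul0r mulr0 subr0.
Qed.

Lemma char13_solve2 : 2 * d = a - b -> d = 7 * a - 7 * b.
Proof.
move=> e; apply: (@eq_from_sub0 _ _ _ (7 * (2 * d - (a - b)) - 13 * d)); first by ring.
by rewrite e subrr h13 mul0r mulr0 subr0.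
Qed.

End Char13.

Section Mod13.
Variable n : nat.
Notation k := 'F_13.
Notation q := (qs k n).
Notation S := (sigser q n.+1).
Notation K := (ieuler q n.+1 ^+ 3).
Notation e2 := (E2 q n.+1).
Notation e4 := (E4 q n.+1).
Notation e6 := (E6 q n.+1).
Notation th := (theta q n.+1).
Let h13 : 13 = 0 :> ser k n := char_ser n (isT : prime 13).

Let opk (t : ser k n) := 8 * Ds t - t.

Lemma cf_opk j t : cf (iter j opk t) n = (8 * n%:R - 1) ^+ j * cf t n.
Proof.
elim: j => [|j IH]; first by rewrite expr0 mul1r.
by rewrite iterS /opk cfB cf_nat cf_Ds // IH exprS; ring.
Qed.

Lemma iter_opk13 : iter 7 opk ((e2 ^+ 2 - e4) * K) = - opk ((e2 ^+ 2 - e4) * K).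
Proof.
have he : 12 * Ds e2 = e2 ^+ 2 - e4 := DE2_E4 (@qsM k n) (@DsM k n) (@Ds_qs k n).
have hx : 3 * Ds e4 = e2 * e4 - e6 := DE4_E6 (@qsM k n) (@DsM k n) (@Ds_qs k n).
have hy : 2 * Ds e6 = e2 * e6 - e4 ^+ 2 := DE6_E8 (@qsM k n) (@DsM k n) (@Ds_qs k n).
have tr j : th j.+2 = 8 * Ds (th j) + th j := theta_rec n.+1 (@DsM k n) (@Ds_qs k n) j.
have f : th 13 = th 1 := theta_fermat q n.+1 0 (pchar_ser n (isT : prime 13)).
have DJ : 8 * Ds (th 1) + th 1 = e2 * th 1.
  by rewrite -tr; exact: (theta3 (@qsM k n) (@DsM k n) (@Ds_qs k n)).
have dk : 8 * Ds K - K = - (e2 * K).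
  by rewrite DK /E2; move: (S 1) K => a c; ring.
apply: (@opk7 _ (@Ds k n) e2 e4 e6 (th 1) K (@DsM k n) h13) => //.
- exact: (char13_solve12 h13 he).
- exact: (char13_solve3 h13 hx).
- exact: (char13_solve2 h13 hy).
- exact: thetaK.
have it m : iter m (fun t : ser k n => 8 * Ds t + t) (th 1) = th m.*2.+1.
  by elim: m => //= m ->; rewrite tr.
exact: etrans (it 6) f.
Qed.

(** On coefficients [iter_opk13] reads (y^7 + y) r = 0 with y = 8 n - 1, up to the invertible factor
    288. The classes 0 and 10 give y = -1 and y = 1, where y^7 + y is not 0. *)
Lemma cr13 : n%:R = 0 :> k \/ n%:R = 10 :> k -> cr k n = 0.
Proof.
move=> hn; have two : (2 : k) != 0 by apply/eqP => /(congr1 val).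
have e : (e2 ^+ 2 - e4) * K = - (288 * (Ds (S 1) * K)).
  have he : 12 * Ds e2 = e2 ^+ 2 - e4 := DE2_E4 (@qsM k n) (@DsM k n) (@Ds_qs k n).
  have d : Ds e2 = - (24 * Ds (S 1)) := DE2 q n.+1 (@DsM k n).
  by rewrite -he d; move: (Ds (S 1)) K => a b; ring.
have := congr1 (fun y => cf y n) iter_opk13.
rewrite /= -[opk (opk _)]/(iter 2 opk _).
have := cf_opk 7 ((e2 ^+ 2 - e4) * K); have := cf_opk 1 ((e2 ^+ 2 - e4) * K).
rewrite /= cfN => -> ->; rewrite e cfN cf_nat -/(cr k n) expr1.
have h13k : 13 = 0 :> k by exact: pchar_Fp_0.
move: (cr k n) => r; case: hn => ->.
  (* The equation is 576 r = 0 with 576 = 4 + 13 * 44; the 4 is removed by cancelling 2 twice. *)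
  move=> E; apply: (mulfI two); rewrite mulr0; apply: (mulfI two); rewrite mulr0.
  transitivity ((8 * 0 - 1) ^+ 7 * - (288 * r) - - ((8 * 0 - 1) * - (288 * r)) - 13 * (44 * r)).
    by ring.
  by rewrite E subrr h13k mul0r subr0.
have -> : 8 * 10 - 1 = 1 :> k by apply/eqP.
move=> E; apply: (mulfI two); rewrite mulr0; apply: (mulfI two); rewrite mulr0.
transitivity (- (1 ^+ 7 * - (288 * r) - - (1 * - (288 * r))) - 13 * (44 * r) : k).
  by ring.
by rewrite E subrr h13k mul0r subr0 oppr0.
Qed.

Lemma u13_0 : n%:R = 0 :> k -> (u n)%:R = 0 :> k.
Proof.
move=> n0; apply: (double_Fp (p := 13) isT isT); rewrite u_coef cr13; last by left.
by rewrite n0; ring.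
Qed.

Lemma v13_10 : n%:R = 10 :> k -> (v n)%:R = 0 :> k.
Proof.
move=> n0; apply: (double_Fp (p := 13) isT isT); rewrite v_coef mulrBr u_coef cr13; last by right.
rewrite n0; transitivity (13 * (6 * cm k n)); first by ring.
by rewrite (pchar_Fp_0 (isT : prime 13)) mul0r.
Qed.

End Mod13.

Lemma residue p n r : prime p -> (p * n + r)%:R = r%:R :> 'F_p.
Proof. by move=> pp; rewrite natrD natrM pchar_Fp_0 // mul0r add0r. Qed.

Lemma residue0 p n : prime p -> (p * n)%:R = 0 :> 'F_p.
Proof. by move=> pp; rewrite natrM pchar_Fp_0 // mul0r. Qed.

Local Open Scope nat_scope.

Theorem theorem1p1 (n : nat) :
  u (3 * n) = 0 %[mod 3] /\
  u (5 * n) = 0 %[mod 5] /\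
  u (5 * n + 3) = 0 %[mod 5] /\
  u (7 * n) = 0 %[mod 7] /\
  u (7 * n + 5) = 0 %[mod 7] /\
  u (13 * n) = 0 %[mod 13] /\
  v (3 * n + 1) = 0 %[mod 3] /\
  v (5 * n + 1) = 0 %[mod 5] /\
  v (5 * n + 4) = 0 %[mod 5] /\
  v (13 * n + 10) = 0 %[mod 13].
Proof.
do !apply: conj; apply: mod_Fp => //.
- exact/u3_0/residue0.
- exact/u5_0/residue0.
- exact/u5_3/residue.
- exact/u7_0/residue0.
- exact/u7_5/residue.
- exact/u13_0/residue0.
- exact/v3_1/residue.
- exact/v5_1/residue.
- exact/v5_4/residue.
- exact/v13_10/residue.
Qed.
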